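(* Let $\mathbf{C}$ be a category and let $0\le n\le\infty$. If $\mathbf{C}$ has the property $\mathrm{FDT}_n$, then $\mathbf{C}$ has the property $\mathrm{FP}_n$.
   Context: Polygraphs. All higher categories are strict and globular. A $k$-sphere is a pair of parallel $k$-cells. A cellular extension of a $k$-category $\mathcal{C}$ is a set $\Gamma$ with a map to the $k$-spheres of $\mathcal{C}$; $\mathcal{C}(\Gamma)$ is obtained by freely adjoining the elements of $\Gamma$ as invertible $(k+1)$-cells. For $2\le n\le\infty$, an $(n,1)$-polygraph $\Sigma$ consists of a set $\Sigma_0$, a graph $\Sigma_1$ over $\Sigma_0$ with free category $\Sigma_1^*$, and, for $1\le k<n$, a cellular extension $\Sigma_{k+1}$ of $\Sigma^{\top}_k=\Sigma_1^*(\Sigma_2)\cdots(\Sigma_k)$. It presents the category $\overline{\Sigma}=\Sigma_1^*/\Sigma_2$. It is finite when it has finitely many generating cells in each dimension, and acyclic when, for every $1<k<n$, every $k$-sphere of $\Sigma_k^{\top}$ is the boundary of some $(k+1)$-cell of $\Sigma_k^{\top}(\Sigma_{k+1})$. $\mathrm{FDT}_n$: a category $\mathbf{C}$ is $\mathrm{FDT}_0$ when it has finitely many $0$-cells; $\mathrm{FDT}_1$ when it is finitely generated (finitely many $0$-cells and a finite set of generating $1$-cells); for $2\le n<\infty$, $\mathrm{FDT}_n$ when there is a finite acyclic $(n,1)$-polygraph presenting $\mathbf{C}$ (a finite partial polygraphic resolution of length $n$); $\mathrm{FDT}_\infty$ when there is a finite acyclic $(\infty,1)$-polygraph presenting $\mathbf{C}$.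 $\mathrm{FP}_n$: the category of factorisations $F\mathbf{C}$ has the $1$-cells of $\mathbf{C}$ as objects, and as morphisms $w\to w'$ the pairs $(u,v)$ of $1$-cells with $uwv=w'$; composition is $(u,v)(u',v')=(u'u,vv')$. A natural system on $\mathbf{C}$ is a functor $F\mathbf{C}\to\mathbf{Ab}$; natural systems form an abelian category. A natural system is finitely generated when it is a quotient of a finite coproduct of functors $\mathbb{Z}F\mathbf{C}(w,-)$. $\mathbf{C}$ is of homological type $\mathrm{FP}_n$ (resp. $\mathrm{FP}_\infty$) when the constant natural system $\mathbb{Z}$ admits a partial resolution $P_n\to\cdots\to P_0\to\mathbb{Z}\to0$ of length $n$ (resp. a resolution) by finitely generated projective natural systems. *)

(* Defs.v *)
From HB Require Import structures.
From mathcomp Require Import all_boot all_algebra.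
From mathcomp Require Import boolp classical_sets functions cardinality.
From mathcomp Require Import freeg.

Set Implicit Arguments.
Unset Strict Implicit.
Unset Printing Implicit Defensive.

Import GRing.Theory.

Local Open Scope nat_scope.

Inductive enat := Fin of nat | Infty.

Definition below (i : nat) (n : enat) : Prop :=
  if n is Fin m then i <= m else True.

Definition finite_type (T : Type) : Prop := finite_set [set: T].

(* Quotient of T by R, which will always be an equivalence relation: the
   elements are the classes R t, seen as subsets of T. *)
Section Quotient.
Context (T : Type) (R : T -> T -> Prop).

Definition quot : Type := {P : T -> Prop | exists t, P = R t}.

Definition class (t : T) : quot := exist _ (R t) (ex_intro _ t erefl).

Definition rep (q : quot) : T := projT1 (cid (proj2_sig q)).

Lemma repK q : class (rep q) = q.
Proof.
case: q => P eP; rewrite /rep /class; case: (cid _) => /= t et.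
by apply: eq_exist.
Qed.

Hypothesis R_refl : forall t, R t t.
Hypothesis R_sym : forall t u, R t u -> R u t.
Hypothesis R_trans : forall t u v, R t u -> R u v -> R t v.

Lemma class_eq t u : (class t = class u) <-> R t u.
Proof.
split=> [[->]//|tu]; apply: eq_exist; apply/funext => v; apply/propext.
by split; apply: R_trans => //; apply: R_sym.
Qed.

Lemma rep_class t : R (rep (class t)) t.
Proof. exact/class_eq/repK. Qed.
End Quotient.

(* Composition is written in diagrammatic order. *)
Record category := Category {
  ob :> Type;
  hom : ob -> ob -> Type;
  idm : forall x, hom x x;
  cmp : forall x y z, hom x y -> hom y z -> hom x z;
  cmp1f : forall x y (f : hom x y), cmp (idm x) f = f;
  cmpf1 : forall x y (f : hom x y), cmp f (idm y) = f;
  cmpA : forall x y z t (f : hom x y) (g : hom y z) (h : hom z t),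
    cmp f (cmp g h) = cmp (cmp f g) h
}.
Arguments idm {c} x.
Notation "f \; g" := (cmp f g).

Record functor (C D : category) := Functor {
  fob :> C -> D;
  fhom : forall x y, hom x y -> hom (fob x) (fob y);
  fhom1 : forall x, fhom (idm x) = idm (fob x);
  fhomM : forall x y z (f : hom x y) (g : hom y z),
    fhom (f \; g) = fhom f \; fhom g
}.
Arguments fhom {C D} _ {x y}.

Definition isomorphic (C D : category) : Prop :=
  exists F : functor C D,
    bijective F /\ forall x y, bijective (@fhom _ _ F x y).

Record arrow (C : category) := Arrow {
  asrc : C;
  atgt : C;
  amor :> hom asrc atgt
}.
Arguments Arrow {C asrc atgt}.

Section QuotientCategory.
Context (C : category) (R : forall x y : C, hom x y -> hom x y -> Prop).

Inductive congr : forall x y : C, hom x y -> hom x y -> Prop :=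
| congr_gen x y (f g : hom x y) : R f g -> congr f g
| congr_refl x y (f : hom x y) : congr f f
| congr_sym x y (f g : hom x y) : congr f g -> congr g f
| congr_trans x y (f g h : hom x y) : congr f g -> congr g h -> congr f h
| congr_cmp x y z (f f' : hom x y) (g g' : hom y z) :
    congr f f' -> congr g g' -> congr (f \; g) (f' \; g').

Definition qhom (x y : C) : Type := quot (@congr x y).
Definition qid (x : C) : qhom x x := class _ (idm x).
Definition qcmp x y z (f : qhom x y) (g : qhom y z) : qhom x z :=
  class _ (rep f \; rep g).

Lemma qclass_eq x y (f g : hom x y) :
  (class (@congr x y) f = class _ g) <-> congr f g.
Proof. by apply: class_eq; [exact: congr_refl|exact: congr_sym|exact: congr_trans]. Qed.

Lemma qrep_class x y (f : hom x y) : congr (rep (class (@congr x y) f)) f.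
Proof. exact/qclass_eq/repK. Qed.

Lemma qcmp1f x y (f : qhom x y) : qcmp (qid x) f = f.
Proof.
rewrite -[RHS]repK; apply/qclass_eq; rewrite -[X in congr _ X]cmp1f.
by apply: congr_cmp; [exact: qrep_class|exact: congr_refl].
Qed.

Lemma qcmpf1 x y (f : qhom x y) : qcmp f (qid y) = f.
Proof.
rewrite -[RHS]repK; apply/qclass_eq; rewrite -[X in congr _ X]cmpf1.
by apply: congr_cmp; [exact: congr_refl|exact: qrep_class].
Qed.

Lemma qcmpA x y z t (f : qhom x y) (g : qhom y z) (h : qhom z t) :
  qcmp f (qcmp g h) = qcmp (qcmp f g) h.
Proof.
apply/qclass_eq; apply: (@congr_trans _ _ _ (rep f \; (rep g \; rep h))).
  by apply: congr_cmp; [exact: congr_refl|exact: qrep_class].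
rewrite cmpA; apply: congr_cmp; last exact: congr_refl.
exact/congr_sym/qrep_class.
Qed.

Definition quotient_cat : category := Category qcmp1f qcmpf1 qcmpA.
End QuotientCategory.

Record graph := Graph {
  vertex : Type;
  edge : Type;
  esrc : edge -> vertex;
  etgt : edge -> vertex
}.

Section FreeCategory.
Context (G : graph).

Inductive path : vertex G -> vertex G -> Type :=
| pnil x : path x x
| pcons (e : edge G) y : path (etgt e) y -> path (esrc e) y.

Fixpoint pcat x y z (p : path x y) : path y z -> path x z :=
  match p in path x y return path y z -> path x z with
  | pnil _ => id
  | pcons e _ p' => fun q => pcons (pcat p' q)
  end.

Lemma pcatp0 x y (p : path x y) : pcat p (pnil y) = p.
Proof. by elim: p => //= e z p ->. Qed.

Lemma pcatA x y z t (p : path x y) (q : path y z) (r : path z t) :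
  pcat p (pcat q r) = pcat (pcat p q) r.
Proof. by elim: p q => //= e w p IH q; rewrite IH. Qed.

Definition free_cat : category :=
  @Category (vertex G) path pnil pcat (fun _ _ _ => erefl) pcatp0 pcatA.
End FreeCategory.

(* All the cells, in dimensions 0 to k, are gathered in one type, and [dim]
   gives the dimension of a cell. The operations are total functions: [src] and
   [tgt] are meaningful on cells of positive dimension, [unit] on cells of
   dimension less than k and [comp i x y] when x and y are i-composable. *)
Record globular := Globular {
  cell :> Type;
  dim : cell -> nat;
  src : cell -> cell;
  tgt : cell -> cell;
  unit : cell -> cell;
  comp : nat -> cell -> cell -> cell
}.

(* The i-source and the i-target of a cell of dimension at least i. *)
Definition bsrc (X : globular) i (x : X) : X := iter (dim x - i) (@src X) x.
Definition btgt (X : globular) i (x : X) : X := iter (dim x - i) (@tgt X) x.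

(* The unit, in dimension d, of a cell of dimension i. *)
Definition unit_from (X : globular) i d (x : X) : X := iter (d - i) (@unit X) x.

Definition composable (X : globular) i (x y : X) : Prop :=
  [/\ dim x = dim y, i < dim x & btgt i x = bsrc i y].

Definition parallel (X : globular) (x y : X) : Prop :=
  dim x = dim y /\ (0 < dim x -> src x = src y /\ tgt x = tgt y).

Record strict_axioms (k : nat) (X : globular) : Prop := StrictAxioms {
  dim_le : forall x : X, dim x <= k;
  dim_src : forall x : X, 0 < dim x -> dim (src x) = (dim x).-1;
  dim_tgt : forall x : X, 0 < dim x -> dim (tgt x) = (dim x).-1;
  glob_src : forall x : X, 1 < dim x -> src (src x) = src (tgt x);
  glob_tgt : forall x : X, 1 < dim x -> tgt (src x) = tgt (tgt x);
  dim_unit : forall x : X, dim x < k -> dim (unit x) = (dim x).+1;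
  src_unit : forall x : X, dim x < k -> src (unit x) = x;
  tgt_unit : forall x : X, dim x < k -> tgt (unit x) = x;
  dim_comp : forall i (x y : X), composable i x y -> dim (comp i x y) = dim x;
  src_comp : forall i (x y : X), composable i x y ->
    src (comp i x y) = if i.+1 == dim x then src x else comp i (src x) (src y);
  tgt_comp : forall i (x y : X), composable i x y ->
    tgt (comp i x y) = if i.+1 == dim x then tgt y else comp i (tgt x) (tgt y);
  comp1x : forall i (x : X), i < dim x ->
    comp i (unit_from i (dim x) (bsrc i x)) x = x;
  compx1 : forall i (x : X), i < dim x ->
    comp i x (unit_from i (dim x) (btgt i x)) = x;
  compA : forall i (x y z : X), composable i x y -> composable i y z ->
    comp i (comp i x y) z = comp i x (comp i y z);
  unit_comp : forall i (x y : X), composable i x y -> dim x < k ->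
    unit (comp i x y) = comp i (unit x) (unit y);
  interchange : forall i j (x y z t : X), i < j ->
    composable j x y -> composable j z t -> composable i x z ->
    comp i (comp j x y) (comp j z t) = comp j (comp i x z) (comp i y t)
}.

Record strict_cat (k : nat) := StrictCat {
  cells :> globular;
  strict_catP : strict_axioms k cells
}.

Definition sphere (k : nat) (X : globular) (x y : X) : Prop :=
  dim x = k /\ parallel x y.

Record cell_ext (k : nat) (X : globular) := CellExt {
  gen :> Type;
  gsrc : gen -> X;
  gtgt : gen -> X;
  gsphere : forall a, sphere k (gsrc a) (gtgt a)
}.

Section StrictCatTheory.
Context (k : nat) (C : strict_cat k).
Implicit Types x y z : C.
Let HC := strict_catP C.

Lemma dim_iter_src m x : m <= dim x -> dim (iter m (@src C) x) = dim x - m.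
Proof.
elim: m => [|m IH] mx; first by rewrite subn0.
by have e := IH (ltnW mx); rewrite /= (dim_src HC) e ?subn_gt0 // subnS.
Qed.

Lemma dim_iter_tgt m x : m <= dim x -> dim (iter m (@tgt C) x) = dim x - m.
Proof.
elim: m => [|m IH] mx; first by rewrite subn0.
by have e := IH (ltnW mx); rewrite /= (dim_tgt HC) e ?subn_gt0 // subnS.
Qed.

Lemma dim_bsrc i x : i <= dim x -> dim (bsrc i x) = i.
Proof. by move=> ix; rewrite dim_iter_src ?leq_subr // subKn. Qed.

Lemma dim_btgt i x : i <= dim x -> dim (btgt i x) = i.
Proof. by move=> ix; rewrite dim_iter_tgt ?leq_subr // subKn. Qed.

Lemma dim_unit_from i d x : dim x = i -> i <= d <= k ->
  dim (unit_from i d x) = d.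
Proof.
move=> xi /andP[id dk].
suff H m : i + m <= k -> dim (iter m (@unit C) x) = i + m.
  by rewrite H subnKC.
elim: m => [|m IH]; first by rewrite addn0.
by rewrite addnS => mk /=; have e := IH (ltnW mk); rewrite (dim_unit HC) e.
Qed.

Lemma bsrc_src i x : i < dim x -> bsrc i (src x) = bsrc i x.
Proof.
move=> ix; rewrite /bsrc (dim_src HC) ?(leq_ltn_trans _ ix) //.
by case: (dim x) ix => // d id; rewrite -iterSr subSn.
Qed.

Lemma btgt_tgt i x : i < dim x -> btgt i (tgt x) = btgt i x.
Proof.
move=> ix; rewrite /btgt (dim_tgt HC) ?(leq_ltn_trans _ ix) //.
by case: (dim x) ix => // d id; rewrite -iterSr subSn.
Qed.

Lemma bsrc_parallel i x y : parallel x y -> i < dim x -> bsrc i x = bsrc i y.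
Proof.
move=> [xy] + ix => /(_ (leq_ltn_trans (leq0n _) ix))[e _].
by rewrite -[LHS]bsrc_src // e bsrc_src // -xy.
Qed.

Lemma btgt_parallel i x y : parallel x y -> i < dim x -> btgt i x = btgt i y.
Proof.
move=> [xy] + ix => /(_ (leq_ltn_trans (leq0n _) ix))[_ e].
by rewrite -[LHS]btgt_tgt // e btgt_tgt // -xy.
Qed.

Lemma parallel_src_tgt x : 0 < dim x -> parallel (src x) (tgt x).
Proof.
move=> x0; split; first by rewrite (dim_src HC) ?(dim_tgt HC).
rewrite (dim_src HC) // => x1.
have {}x1 : 1 < dim x by case: (dim x) x0 x1.
by rewrite (glob_src HC) ?(glob_tgt HC).
Qed.

Lemma bsrc_tgt i x : i.+1 < dim x -> bsrc i (tgt x) = bsrc i x.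
Proof.
move=> ix; have x0 : 0 < dim x by apply: leq_ltn_trans ix.
rewrite -[RHS]bsrc_src ?(ltnW ix) //; apply/esym/bsrc_parallel.
  exact: parallel_src_tgt.
by rewrite (dim_src HC) // -ltnS prednK.
Qed.

Lemma btgt_src i x : i.+1 < dim x -> btgt i (src x) = btgt i x.
Proof.
move=> ix; have x0 : 0 < dim x by apply: leq_ltn_trans ix.
rewrite -[RHS]btgt_tgt ?(ltnW ix) //; apply/btgt_parallel.
  exact: parallel_src_tgt.
by rewrite (dim_src HC) // -ltnS prednK.
Qed.

Lemma bsrc_id i x : dim x = i -> bsrc i x = x.
Proof. by move=> xi; rewrite /bsrc xi subnn. Qed.

Lemma btgt_id i x : dim x = i -> btgt i x = x.
Proof. by move=> xi; rewrite /btgt xi subnn. Qed.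

Lemma dim_ind (P : C -> Prop) j :
  (forall x, dim x = j -> P x) ->
  (forall x, j < dim x -> P (src x) -> P (tgt x) -> P x) ->
  forall x, j <= dim x -> P x.
Proof.
move=> P0 PS x; have [n] := ubnP (dim x); elim: n x => // n IH x xn.
rewrite leq_eqVlt => /predU1P[jx|jx]; first exact: P0.
have x0 : 0 < dim x by apply: leq_ltn_trans jx.
have [y y'] : dim (src x) = (dim x).-1 /\ dim (tgt x) = (dim x).-1.
  by rewrite (dim_src HC) ?(dim_tgt HC).
by apply: PS => //; apply: IH; rewrite ?y ?y' -ltnS prednK.
Qed.

Lemma bsrc_bsrc i j x : i <= j <= dim x -> bsrc i (bsrc j x) = bsrc i x.
Proof.
case/andP=> ij jx; move: x jx; apply: dim_ind => [x xj|x jx + _].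
  by rewrite (bsrc_id xj).
by rewrite !bsrc_src // (leq_ltn_trans ij jx).
Qed.

Lemma btgt_btgt i j x : i <= j <= dim x -> btgt i (btgt j x) = btgt i x.
Proof.
case/andP=> ij jx; move: x jx; apply: dim_ind => [x xj|x jx _ +].
  by rewrite (btgt_id xj).
by rewrite !btgt_tgt // (leq_ltn_trans ij jx).
Qed.

Lemma bsrc_btgt i j x : i < j <= dim x -> bsrc i (btgt j x) = bsrc i x.
Proof.
case/andP=> ij jx; move: x jx; apply: dim_ind => [x xj|x jx _ +].
  by rewrite (btgt_id xj).
by rewrite btgt_tgt // bsrc_tgt // (leq_ltn_trans ij jx).
Qed.

Lemma btgt_bsrc i j x : i < j <= dim x -> btgt i (bsrc j x) = btgt i x.
Proof.
case/andP=> ij jx; move: x jx; apply: dim_ind => [x xj|x jx + _].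
  by rewrite (bsrc_id xj).
by rewrite bsrc_src // btgt_src // (leq_ltn_trans ij jx).
Qed.

Lemma composable_src_tgt i x y : composable i x y -> i.+1 < dim x ->
  composable i (src x) (src y) /\ composable i (tgt x) (tgt y).
Proof.
move=> [xy ix e] ix1; have iy := ix1; rewrite xy in iy.
have x0 : 0 < dim x by apply: leq_ltn_trans ix.
have y0 : 0 < dim y by rewrite -xy.
split; split; rewrite ?(dim_src HC) ?(dim_tgt HC) ?xy //.
- by rewrite -ltnS prednK.
- by rewrite btgt_src // bsrc_src // ltnW.
- by rewrite -ltnS prednK.
- by rewrite btgt_tgt // ?bsrc_tgt.
Qed.

Lemma bsrc_comp_le i j x y : composable j x y -> i <= j ->
  bsrc i (comp j x y) = bsrc i x.
Proof.
move=> c ij; have [_ jx _] := c; move: x jx y c; apply: dim_ind => [x xj|x jx + _] y c.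
  have [_ _ _] := c; have jx : i < dim x by rewrite xj.
  rewrite -[LHS]bsrc_src ?(dim_comp HC c) //.
  by rewrite (src_comp HC c) xj eqxx bsrc_src.
move=> /(_ _ (composable_src_tgt c jx).1).
rewrite -[bsrc i (comp j x y)]bsrc_src ?(dim_comp HC c) ?(leq_ltn_trans ij (ltnW jx)) //.
by rewrite (src_comp HC c) (ltn_eqF jx) => ->; rewrite bsrc_src // (leq_ltn_trans ij (ltnW jx)).
Qed.

Lemma btgt_comp_le i j x y : composable j x y -> i <= j ->
  btgt i (comp j x y) = btgt i y.
Proof.
move=> c ij; have [_ jx _] := c; move: x jx y c; apply: dim_ind => [x xj|x jx _ +] y c.
  have [xy _ _] := c; have jx : i < dim x by rewrite xj.
  rewrite -[LHS]btgt_tgt ?(dim_comp HC c) //.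
  by rewrite (tgt_comp HC c) xj eqxx btgt_tgt -?xy.
have [xy _ _] := c.
move=> /(_ _ (composable_src_tgt c jx).2).
have ix := leq_ltn_trans ij (ltnW jx).
rewrite -[btgt i (comp j x y)]btgt_tgt ?(dim_comp HC c) //.
by rewrite (tgt_comp HC c) (ltn_eqF jx) => ->; rewrite btgt_tgt // -xy.
Qed.

Lemma composable_lt i j x y : composable j x y -> i < j ->
  bsrc i x = bsrc i y /\ btgt i x = btgt i y.
Proof.
move=> [xy jx e] ij; have jy := jx; rewrite xy in jy.
split.
- rewrite -(@bsrc_btgt i j) ?ij ?(ltnW jx) // e bsrc_bsrc //.
  by rewrite (ltnW ij) (ltnW jy).
- rewrite -(@btgt_btgt i j) ?(ltnW ij) ?(ltnW jx) // e btgt_bsrc //.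
  by rewrite ij (ltnW jy).
Qed.

Lemma bsrc_comp_gt i j x y : composable i x y -> i < j <= dim x ->
  bsrc j (comp i x y) = comp i (bsrc j x) (bsrc j y).
Proof.
move=> c /andP[ij jx]; move: x jx y c; apply: dim_ind => [x xj|x jx + _] y c;
  have [xy _ _] := c.
  by rewrite !bsrc_id // ?(dim_comp HC c) // -xy.
have ix := leq_ltn_trans ij jx.
move=> /(_ _ (composable_src_tgt c ix).1).
rewrite -[bsrc j (comp i x y)]bsrc_src ?(dim_comp HC c) //.
by rewrite (src_comp HC c) (ltn_eqF ix) => ->; rewrite !bsrc_src // -xy.
Qed.

Lemma btgt_comp_gt i j x y : composable i x y -> i < j <= dim x ->
  btgt j (comp i x y) = comp i (btgt j x) (btgt j y).
Proof.
move=> c /andP[ij jx]; move: x jx y c; apply: dim_ind => [x xj|x jx _ +] y c;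
  have [xy _ _] := c.
  by rewrite !btgt_id // ?(dim_comp HC c) // -xy.
have ix := leq_ltn_trans ij jx.
move=> /(_ _ (composable_src_tgt c ix).2).
rewrite -[btgt j (comp i x y)]btgt_tgt ?(dim_comp HC c) //.
by rewrite (tgt_comp HC c) (ltn_eqF ix) => ->; rewrite !btgt_tgt // -xy.
Qed.

Lemma iter_src_unit m x : dim x + m <= k ->
  iter m (@src C) (iter m (@unit C) x) = x.
Proof.
elim: m => // m IH; rewrite addnS => mk; have e := IH (ltnW mk).
rewrite iterSr /= (src_unit HC) //.
suff -> : dim (iter m (@unit C) x) = dim x + m by [].
rewrite -[X in iter X](addKn (dim x)).
by rewrite (@dim_unit_from (dim x) (dim x + m)) // leq_addr ltnW.
Qed.

Lemma iter_tgt_unit m x : dim x + m <= k ->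
  iter m (@tgt C) (iter m (@unit C) x) = x.
Proof.
elim: m => // m IH; rewrite addnS => mk; have e := IH (ltnW mk).
rewrite iterSr /= (tgt_unit HC) //.
suff -> : dim (iter m (@unit C) x) = dim x + m by [].
rewrite -[X in iter X](addKn (dim x)).
by rewrite (@dim_unit_from (dim x) (dim x + m)) // leq_addr ltnW.
Qed.

Lemma bsrc_unit_from i d x : dim x = i -> i <= d <= k ->
  bsrc i (unit_from i d x) = x.
Proof.
move=> xi idk; rewrite /bsrc dim_unit_from // iter_src_unit //.
by case/andP: idk => id dk; rewrite xi subnKC.
Qed.

Lemma btgt_unit_from i d x : dim x = i -> i <= d <= k ->
  btgt i (unit_from i d x) = x.
Proof.
move=> xi idk; rewrite /btgt dim_unit_from // iter_tgt_unit //.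
by case/andP: idk => id dk; rewrite xi subnKC.
Qed.
Lemma comp_unitl i d x : dim x = d -> i < d ->
  comp i (unit_from i d (bsrc i x)) x = x.
Proof. by move=> <-; apply: (comp1x HC). Qed.

Lemma comp_unitr i d x : dim x = d -> i < d ->
  comp i x (unit_from i d (btgt i x)) = x.
Proof. by move=> <-; apply: (compx1 HC). Qed.
End StrictCatTheory.

Section OfCategory.
Context (C : category).

Definition arrow_cmp (f g : arrow C) : arrow C :=
  match pselect (atgt f = asrc g) with
  | left e => Arrow (amor f \; ecast x (hom x (atgt g)) (esym e) (amor g))
  | right _ => f
  end.

Definition cat_cell : Type := (C + arrow C)%type.

Definition cat_globular : globular := {|
  cell := cat_cell;
  dim := fun a => match a with inl _ => 0 | inr _ => 1 end;
  src := fun a => match a with inl _ => a | inr f => inl (asrc f) end;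
  tgt := fun a => match a with inl _ => a | inr f => inl (atgt f) end;
  unit := fun a => match a with inl x => inr (Arrow (idm x)) | inr _ => a end;
  comp := fun _ a b =>
    match a, b with inr f, inr g => inr (arrow_cmp f g) | _, _ => a end
|}.

Lemma arrow_cmpE x y z (f : hom x y) (g : hom y z) :
  arrow_cmp (Arrow f) (Arrow g) = Arrow (f \; g).
Proof.
rewrite /arrow_cmp; case: pselect => //= e.
by rewrite (Prop_irrelevance e erefl).
Qed.

Lemma cat_composable i (a b : cat_globular) : composable i a b ->
  exists x y z (f : hom x y) (g : hom y z),
    [/\ i = 0, a = inr (Arrow f) & b = inr (Arrow g)].
Proof.
case: a b => [x|[x y f]] [z|[z t g]] [] //= _; case: i => // _ [e].
by move: g; rewrite -e => g; exists x, y, t, f, g.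
Qed.

Lemma cat_strict : strict_axioms 1 cat_globular.
Proof.
split=> //=.
- by case.
- by case.
- by case.
- by case.
- by case.
- by case.
- by case.
- by case.
- by move=> i a b /cat_composable[x [y [z [f [g [_ -> ->]]]]]].
- move=> i a b /cat_composable[x [y [z [f [g [-> -> ->]]]]]] /=.
  by rewrite arrow_cmpE.
- move=> i a b /cat_composable[x [y [z [f [g [-> -> ->]]]]]] /=.
  by rewrite arrow_cmpE.
- by move=> [|i] [x|[x y f]] //= _; rewrite arrow_cmpE cmp1f.
- by move=> [|i] [x|[x y f]] //= _; rewrite arrow_cmpE cmpf1.
- move=> i a b c /cat_composable[x [y [z [f [g [-> -> ->]]]]]].
  case: c => [x'|[x' y' h]] [] //= _ _ [e].
  by move: h; rewrite -e => h; rewrite !arrow_cmpE cmpA.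
- by move=> i a b /cat_composable[x [y [z [f [g [_ -> ->]]]]]].
- move=> i j a b c d ij /cat_composable[? [? [? [? [? [j0 _ _]]]]]].
  by rewrite j0 in ij.
Qed.

Definition cat1 : strict_cat 1 := StrictCat cat_strict.
End OfCategory.
Arguments cat_composable {C i a b}.

Section FreeExtension.
Context (k : nat) (C : strict_cat k) (A : cell_ext k C).

(* Formal (k+1)-cells. Inverses of the generators suffice: by interchange, every
   composite of invertible cells and units is then invertible. *)
Inductive term : Type :=
| Gen of A
| Inv of A
| Unit of C
| Comp of nat & term & term.

Fixpoint tsrc (t : term) : C :=
  match t with
  | Gen a => gsrc a
  | Inv a => gtgt a
  | Unit x => x
  | Comp i t u => if i == k then tsrc t else comp i (tsrc t) (tsrc u)
  end.

Fixpoint ttgt (t : term) : C :=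
  match t with
  | Gen a => gtgt a
  | Inv a => gsrc a
  | Unit x => x
  | Comp i t u => if i == k then ttgt u else comp i (ttgt t) (ttgt u)
  end.

Definition tcomposable i (t u : term) : Prop :=
  i <= k /\ btgt i (ttgt t) = bsrc i (tsrc u).

Fixpoint wf (t : term) : Prop :=
  match t with
  | Gen _ | Inv _ => True
  | Unit x => dim x = k
  | Comp i t u => [/\ wf t, wf u & tcomposable i t u]
  end.

Inductive teq : term -> term -> Prop :=
| teq_refl t : wf t -> teq t t
| teq_sym t u : teq t u -> teq u t
| teq_trans t u v : teq t u -> teq u v -> teq t v
| teq_Comp i t t' u u' : wf (Comp i t u) ->
    teq t t' -> teq u u' -> teq (Comp i t u) (Comp i t' u')
| teq_unitl i t : wf t -> i <= k ->
    teq (Comp i (Unit (unit_from i k (bsrc i (tsrc t)))) t) t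
| teq_unitr i t : wf t -> i <= k ->
    teq (Comp i t (Unit (unit_from i k (btgt i (ttgt t))))) t
| teq_assoc i t u v : wf (Comp i t u) -> wf (Comp i u v) ->
    teq (Comp i (Comp i t u) v) (Comp i t (Comp i u v))
| teq_unit_comp i x y : composable i x y -> dim x = k ->
    teq (Unit (comp i x y)) (Comp i (Unit x) (Unit y))
| teq_interchange i j t u v w : i < j ->
    wf (Comp j t u) -> wf (Comp j v w) -> wf (Comp i t v) ->
    teq (Comp i (Comp j t u) (Comp j v w)) (Comp j (Comp i t v) (Comp i u w))
| teq_invr a : teq (Comp k (Gen a) (Inv a)) (Unit (gsrc a))
| teq_invl a : teq (Comp k (Inv a) (Gen a)) (Unit (gtgt a)).

Definition wf_term : Type := {t : term | wf t}.
Definition wf_teq (t u : wf_term) : Prop := teq (proj1_sig t) (proj1_sig u).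

Definition free_cell : Type := quot wf_teq.

Definition free_rep (q : free_cell) : term := proj1_sig (rep q).

(* The class of t, or the default value z when t is not well-formed. *)
Definition free_class (t : term) (z : C + free_cell) : C + free_cell :=
  match pselect (wf t) with
  | left h => inr (class wf_teq (exist _ t h))
  | right _ => z
  end.

Definition ext_globular : globular := {|
  cell := (C + free_cell)%type;
  dim := fun c => match c with inl x => dim x | inr _ => k.+1 end;
  src := fun c => match c with
    | inl x => inl (src x)
    | inr q => inl (tsrc (free_rep q)) end;
  tgt := fun c => match c with
    | inl x => inl (tgt x)
    | inr q => inl (ttgt (free_rep q)) end;
  unit := fun c => match c with
    | inl x => if dim x == k then free_class (Unit x) c else inl (unit x)
    | inr _ => c end;
  comp := fun i c d => match c, d with
    | inl x, inl y => inl (comp i x y)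
    | inr p, inr q => free_class (Comp i (free_rep p) (free_rep q)) c
    | _, _ => c end
|}.

Let HC := strict_catP C.

Lemma wf_dim t : wf t ->
  [/\ dim (tsrc t) = k, dim (ttgt t) = k & parallel (tsrc t) (ttgt t)].
Proof.
elim: t => [a|a|x|i t IHt u IHu] /=.
- by have [d p] := gsphere a; split=> //; exact: etrans (esym p.1) d.
- have [d [dd p]] := gsphere a; split=> //; first exact: etrans (esym dd) d.
  by split=> // d0; have [|-> ->] := p; rewrite ?dd.
- by [].
move=> [wt wu [ik e]]; have [dt dt' pt] := IHt wt; have [du du' pu] := IHu wu.
move: ik e; rewrite leq_eqVlt; case: eqP => [-> _|_ /= ik] e.
  have eq_tu : ttgt t = tsrc u by rewrite btgt_id ?bsrc_id in e.
  split=> //; split; first by rewrite dt.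
  move=> t0; have u0 : 0 < dim (tsrc u) by rewrite du -dt.
  by have [-> ->] := pt.2 t0; have [<- <-] := pu.2 u0; rewrite eq_tu.
have ct : composable i (tsrc t) (tsrc u).
  by split; rewrite ?dt ?du // -e; apply: (btgt_parallel pt); rewrite dt.
have cu : composable i (ttgt t) (ttgt u).
  by split; rewrite ?dt' ?du' // e; apply: (bsrc_parallel pu); rewrite du.
split; rewrite ?(dim_comp HC ct) ?(dim_comp HC cu) //.
split; rewrite ?(dim_comp HC ct) ?(dim_comp HC cu) ?dt ?dt' // => k0.
have [es et] : src (tsrc t) = src (ttgt t) /\ tgt (tsrc t) = tgt (ttgt t).
  by apply: pt.2; rewrite dt.
have [es' et'] : src (tsrc u) = src (ttgt u) /\ tgt (tsrc u) = tgt (ttgt u).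
  by apply: pu.2; rewrite du.
rewrite (src_comp HC ct) (src_comp HC cu) (tgt_comp HC ct) (tgt_comp HC cu).
by rewrite dt dt' es es' et et'.
Qed.

Lemma wf_composable i t u : wf (Comp i t u) -> i < k ->
  composable i (tsrc t) (tsrc u) /\ composable i (ttgt t) (ttgt u).
Proof.
move=> [wt wu [_ e]] ik.
have [dt dt' pt] := wf_dim wt; have [du du' pu] := wf_dim wu.
split; split; rewrite ?dt ?dt' ?du ?du' //.
  by rewrite -e; apply: (btgt_parallel pt); rewrite dt.
by rewrite e; apply: (bsrc_parallel pu); rewrite du.
Qed.

Lemma tbound_Comp i t u : wf (Comp i t u) ->
  bsrc i (tsrc (Comp i t u)) = bsrc i (tsrc t) /\
  btgt i (ttgt (Comp i t u)) = btgt i (ttgt u).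
Proof.
move=> w /=; case: eqP => // ik; have [_ _ [lik _]] := w.
have {ik}lik : i < k by rewrite ltn_neqAle lik andbT; apply/eqP.
have [cs ct] := wf_composable w lik.
by rewrite (bsrc_comp_le cs) // (btgt_comp_le ct).
Qed.

Lemma tbound_Comp_lt i j t u : i < j -> wf (Comp j t u) ->
  [/\ bsrc i (tsrc (Comp j t u)) = bsrc i (tsrc t),
      bsrc i (tsrc (Comp j t u)) = bsrc i (tsrc u),
      btgt i (ttgt (Comp j t u)) = btgt i (ttgt t) &
      btgt i (ttgt (Comp j t u)) = btgt i (ttgt u)].
Proof.
move=> ij w /=; have [wt wu [ljk e]] := w.
have [dt dt' pt] := wf_dim wt; have [du du' pu] := wf_dim wu.
case: eqP => jk.
  have ik : i < k by rewrite -jk.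
  move: e; rewrite jk btgt_id // bsrc_id // => e; split=> //.
    by rewrite (bsrc_parallel pt) ?dt // e.
  by rewrite -(btgt_parallel pu) ?du // e.
have {jk}ljk : j < k by rewrite ltn_neqAle ljk andbT; apply/eqP.
have [cs ct] := wf_composable w ljk.
have [es _] := composable_lt cs ij; have [_ et] := composable_lt ct ij.
by rewrite (bsrc_comp_le cs) ?(btgt_comp_le ct) 1?ltnW.
Qed.

Lemma wf_unitl i t : wf t -> i <= k ->
  wf (Comp i (Unit (unit_from i k (bsrc i (tsrc t)))) t).
Proof.
move=> wt ik; have [dt dt' _] := wf_dim wt.
have d : dim (bsrc i (tsrc t)) = i by rewrite dim_bsrc ?dt.
split=> //=; first by rewrite dim_unit_from // ik leqnn.
by split=> //; rewrite btgt_unit_from // ik leqnn.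
Qed.

Lemma wf_unitr i t : wf t -> i <= k ->
  wf (Comp i t (Unit (unit_from i k (btgt i (ttgt t))))).
Proof.
move=> wt ik; have [dt dt' _] := wf_dim wt.
have d : dim (btgt i (ttgt t)) = i by rewrite dim_btgt ?dt'.
split=> //=; first by rewrite dim_unit_from // ik leqnn.
by split=> //; rewrite bsrc_unit_from // ik leqnn.
Qed.

Lemma teq_wf t u : teq t u ->
  [/\ wf t, wf u, tsrc t = tsrc u & ttgt t = ttgt u].
Proof.
elim=> {t u}.
- by [].
- by move=> t u _ [].
- by move=> t u v _ [? ? -> ->] _ [].
- move=> i t t' u u' w _ [wt wt' es et] _ [wu wu' es' et'].
  by case: w => _ _ [ik e]; rewrite /= /tcomposable -es -es' -et -et'.
- move=> i t wt ik; have [dt dt' _] := wf_dim wt.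
  have w := wf_unitl wt ik; split=> //=.
    case: eqP => [->|/eqP nik]; first by rewrite bsrc_id // /unit_from subnn.
    by rewrite comp_unitl // ltn_neqAle nik.
  case: eqP => [//|/eqP nik]; have lik : i < k by rewrite ltn_neqAle nik.
  have [_ _ p] := wf_dim wt; rewrite (bsrc_parallel p) ?dt //.
  by rewrite comp_unitl.
- move=> i t wt ik; have [dt dt' _] := wf_dim wt.
  have w := wf_unitr wt ik; split=> //=.
    case: eqP => [//|/eqP nik]; have lik : i < k by rewrite ltn_neqAle nik.
    have [_ _ p] := wf_dim wt; rewrite -(btgt_parallel p) ?dt //.
    by rewrite comp_unitr.
  case: eqP => [->|/eqP nik]; first by rewrite btgt_id // /unit_from subnn.
  by rewrite comp_unitr // ltn_neqAle nik.
- move=> i t u v wtu wuv; have [wt wu [ik e]] := wtu; have [_ wv [_ e']] := wuv.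
  have [_ b] := tbound_Comp wtu; have [b' _] := tbound_Comp wuv.
  split; rewrite /= -?/(tsrc (Comp i t u)) -?/(wf (Comp i u v)).
  + by split=> //; split=> //; rewrite -/(ttgt (Comp i t u)) b.
  + by split=> //; split=> //; rewrite -/(tsrc (Comp i u v)) b'.
  + rewrite /=; case: eqVneq => // nik; have lik : i < k by rewrite ltn_neqAle nik.
    have [cs _] := wf_composable wtu lik; have [cs' _] := wf_composable wuv lik.
    exact: (compA HC).
  + rewrite /=; case: eqVneq => // nik; have lik : i < k by rewrite ltn_neqAle nik.
    have [_ ct] := wf_composable wtu lik; have [_ ct'] := wf_composable wuv lik.
    exact: (compA HC).
- move=> i x y c dx; have [xy ix e] := c; rewrite dx in ix.
  split=> /=; rewrite ?(ltn_eqF ix) ?(dim_comp HC c) //.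
  by split; rewrite -?xy //; split=> //; apply: ltnW.
- move=> i j t u v w ij w1 w2 w3.
  have [wt wu [jk e1]] := w1; have [wv ww [_ e2]] := w2; have [_ _ [_ e3]] := w3.
  have ik : i < k := leq_trans ij jk.
  have [b1 b2 b3 b4] := tbound_Comp_lt ij w1.
  have [b1' b2' b3' b4'] := tbound_Comp_lt ij w2.
  have w4 : wf (Comp i u w).
    by split=> //; split; [exact: ltnW|rewrite -b4 b3 e3 -b1' b2'].
  have [cs ct] := wf_composable w3 ik; have [cs' ct'] := wf_composable w4 ik.
  have [dt dt' _] := wf_dim wt; have [du du' _] := wf_dim wu.
  have w5 : wf (Comp i (Comp j t u) (Comp j v w)).
    by split=> //; split; [exact: ltnW|rewrite b3 e3 b1'].
  have w6 : wf (Comp j (Comp i t v) (Comp i u w)).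
    split=> //; split=> //=; rewrite (ltn_eqF ik).
    rewrite (btgt_comp_gt ct) ?dt' ?ij // (bsrc_comp_gt cs') ?du ?ij //.
    by rewrite e1 e2.
  split=> //=; rewrite (ltn_eqF ik); case: eqP => // /eqP njk.
    have ljk : j < k by rewrite ltn_neqAle njk.
    have [c1 _] := wf_composable w1 ljk; have [c2 _] := wf_composable w2 ljk.
    exact: (interchange HC).
  have ljk : j < k by rewrite ltn_neqAle njk.
  have [_ c1] := wf_composable w1 ljk; have [_ c2] := wf_composable w2 ljk.
  exact: (interchange HC).
- move=> a; have [d [d' _]] := gsphere a; have dt := etrans (esym d') d.
  by split; rewrite /= ?eqxx //; split=> //; split; rewrite ?btgt_id ?bsrc_id.
- move=> a; have [d [d' _]] := gsphere a; have dt := etrans (esym d') d.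
  by split; rewrite /= ?eqxx //; split=> //; split; rewrite ?btgt_id ?bsrc_id.
Qed.

Lemma wf_teq_eq (t u : wf_term) : (class wf_teq t = class _ u) <-> wf_teq t u.
Proof.
apply: class_eq => [[v wv]|v w|v w z]; first exact: teq_refl.
  exact: teq_sym.
exact: teq_trans.
Qed.

Lemma free_class_eq t u z z' : teq t u -> free_class t z = free_class u z'.
Proof.
move=> tu; have [wt wu _ _] := teq_wf tu.
rewrite /free_class; do 2!case: pselect => // ?.
by congr inr; apply/wf_teq_eq.
Qed.

Lemma wf_rep q : wf (free_rep q).
Proof. exact: proj2_sig. Qed.

Lemma free_repK q z : free_class (free_rep q) z = inr q.
Proof.
rewrite /free_class; case: pselect => [w|/(_ (wf_rep q))//].
congr inr; rewrite -[RHS]repK; apply/wf_teq_eq; exact: teq_refl.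
Qed.

Lemma free_classP t z : wf t ->
  exists2 q, free_class t z = inr q & teq (free_rep q) t.
Proof.
move=> wt; rewrite /free_class; case: pselect => // w.
exists (class wf_teq (exist _ t w)) => //.
suff : wf_teq (rep (class wf_teq (exist _ t w))) (exist _ t w) by [].
exact/wf_teq_eq/repK.
Qed.

Local Notation X := ext_globular.

Lemma iter_inl (f : X -> X) (g : C -> C) m (x : C) :
  (forall y, f (inl y) = inl (g y)) -> iter m f (inl x) = inl (iter m g x).
Proof. by move=> fg; elim: m => //= m ->. Qed.

Lemma ext_bsrc_inl i (x : C) : bsrc i (inl x : X) = inl (bsrc i x).
Proof. exact: iter_inl. Qed.

Lemma ext_btgt_inl i (x : C) : btgt i (inl x : X) = inl (btgt i x).
Proof. exact: iter_inl. Qed.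

Lemma ext_bsrc_inr i q : i <= k ->
  bsrc i (inr q : X) = inl (bsrc i (tsrc (free_rep q))).
Proof.
move=> ik; have [d _ _] := wf_dim (wf_rep q).
by rewrite {1}/bsrc /= subSn // iterSr /= (@iter_inl _ (@src C)) // /bsrc d.
Qed.

Lemma ext_btgt_inr i q : i <= k ->
  btgt i (inr q : X) = inl (btgt i (ttgt (free_rep q))).
Proof.
move=> ik; have [_ d _] := wf_dim (wf_rep q).
by rewrite {1}/btgt /= subSn // iterSr /= (@iter_inl _ (@tgt C)) // /btgt d.
Qed.

Lemma ext_unit_from i d (x : C) : dim x = i -> i <= d <= k ->
  unit_from i d (inl x : X) = inl (unit_from i d x).
Proof.
move=> xi /andP[id dk]; rewrite /unit_from.
suff H m : i + m <= k ->
    iter m (@unit X) (inl x) = inl (iter m (@unit C) x).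
  by rewrite H // subnKC.
elim: m => // m IH; rewrite addnS => mk; rewrite /= IH ?(ltnW mk) //=.
suff -> : dim (iter m (@unit C) x) = i + m by rewrite (ltn_eqF mk).
by rewrite -[X in iter X](addKn i) (@dim_unit_from k C i (i + m)) // leq_addr ltnW.
Qed.

Lemma ext_unit_fromS i (x : C) : dim x = i -> i <= k ->
  unit_from i k.+1 (inl x : X) =
  free_class (Unit (unit_from i k x)) (inl (unit_from i k x)).
Proof.
move=> xi ik; rewrite {1}/unit_from subSn //= -/(unit_from i k (inl x : X)).
rewrite ext_unit_from ?ik ?leqnn //= dim_unit_from ?ik ?leqnn //.
by rewrite eqxx.
Qed.

Lemma ext_composable i (a b : X) : composable i a b ->
  (exists x y : C, [/\ a = inl x, b = inl y & composable i x y]) \/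
  (exists p q, [/\ a = inr p, b = inr q & wf (Comp i (free_rep p) (free_rep q))]).
Proof.
case: a b => [x|p] [y|q] [] /=.
- by rewrite ext_btgt_inl ext_bsrc_inl => e l [e']; left; exists x, y.
- by move=> e; have := dim_le HC x; rewrite e ltnn.
- by move=> e; have := dim_le HC y; rewrite -e ltnn.
move=> _ ik; rewrite ext_btgt_inr ?ext_bsrc_inr // => -[e]; right.
by exists p, q; split=> //; split=> //; exact: wf_rep.
Qed.

Lemma ext_comp_inr i p q : wf (Comp i (free_rep p) (free_rep q)) ->
  exists2 r, comp i (inr p : X) (inr q) = inr r &
    teq (free_rep r) (Comp i (free_rep p) (free_rep q)).
Proof. exact: free_classP. Qed.

Lemma ext_strict : strict_axioms k.+1 X.
Proof.
split.
- by move=> [x|q] //=; apply/leqW/(dim_le HC).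
- case=> [x /(dim_src HC) //|q _] /=; by have [] := wf_dim (wf_rep q).
- case=> [x /(dim_tgt HC) //|q _] /=; by have [] := wf_dim (wf_rep q).
- case=> [x /(glob_src HC) /= -> //|q /= k0].
  by have [d _ [_ []]] := wf_dim (wf_rep q); rewrite ?d // => -> _.
- case=> [x /(glob_tgt HC) /= -> //|q /= k0].
  by have [d _ [_ []]] := wf_dim (wf_rep q); rewrite ?d // => _ ->.
- case=> [x|q] /=; last by rewrite ltnn.
  rewrite ltnS leq_eqVlt; case: eqP => [xk _|_ /= xk].
    by have [q -> _] := @free_classP (Unit x) (inl x) xk; rewrite /= xk.
  by rewrite /= (dim_unit HC).
- case=> [x|q] /=; last by rewrite ltnn.
  rewrite ltnS leq_eqVlt; case: eqP => [xk _|_ /= xk].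
    have [q -> /teq_wf[_ _ e _]] := @free_classP (Unit x) (inl x) xk.
    by rewrite /= e.
  by rewrite /= (src_unit HC).
- case=> [x|q] /=; last by rewrite ltnn.
  rewrite ltnS leq_eqVlt; case: eqP => [xk _|_ /= xk].
    have [q -> /teq_wf[_ _ _ e]] := @free_classP (Unit x) (inl x) xk.
    by rewrite /= e.
  by rewrite /= (tgt_unit HC).
- move=> i a b /ext_composable[[x [y [-> -> c]]]|[p [q [-> -> w]]]].
    exact: (dim_comp HC).
  by have [r -> _] := ext_comp_inr w.
- move=> i a b /ext_composable[[x [y [-> -> c]]]|[p [q [-> -> w]]]].
    by rewrite /= (src_comp HC) //; case: ifP.
  have [r -> /teq_wf[_ _ e _]] := ext_comp_inr w.
  by rewrite /= e /= eqSS; case: ifP.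
- move=> i a b /ext_composable[[x [y [-> -> c]]]|[p [q [-> -> w]]]].
    by rewrite /= (tgt_comp HC) //; case: ifP.
  have [r -> /teq_wf[_ _ _ e]] := ext_comp_inr w.
  by rewrite /= e /= eqSS; case: ifP.
- move=> i [x|q] /= ik.
    have d := dim_bsrc (ltnW ik).
    rewrite ext_bsrc_inl ext_unit_from //; last by rewrite ltnW ?(dim_le HC).
    by rewrite (comp1x HC).
  rewrite ltnS in ik; have [d _ _] := wf_dim (wf_rep q).
  rewrite ext_bsrc_inr // ext_unit_fromS ?dim_bsrc ?d //.
  have w := wf_unitl (wf_rep q) ik.
  have wu : wf (Unit (unit_from i k (bsrc i (tsrc (free_rep q))))) by case: w.
  have [r -> er] := free_classP (inl (unit_from i k (bsrc i (tsrc (free_rep q))))) wu.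
  rewrite -[RHS](free_repK q (inr q)); apply: free_class_eq.
  apply: teq_trans (teq_unitl (wf_rep q) ik); apply/teq_sym.
  by apply: teq_Comp => //; [exact: teq_sym|exact: teq_refl (wf_rep q)].
- move=> i [x|q] /= ik.
    have d := dim_btgt (ltnW ik).
    rewrite ext_btgt_inl ext_unit_from //; last by rewrite ltnW ?(dim_le HC).
    by rewrite (compx1 HC).
  rewrite ltnS in ik; have [_ d _] := wf_dim (wf_rep q).
  rewrite ext_btgt_inr // ext_unit_fromS ?dim_btgt ?d //.
  have w := wf_unitr (wf_rep q) ik.
  have wu : wf (Unit (unit_from i k (btgt i (ttgt (free_rep q))))) by case: w.
  have [r -> er] := free_classP (inl (unit_from i k (btgt i (ttgt (free_rep q))))) wu.
  rewrite -[RHS](free_repK q (inr q)); apply: free_class_eq.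
  apply: teq_trans (teq_unitr (wf_rep q) ik); apply/teq_sym.
  by apply: teq_Comp => //; [exact: teq_refl (wf_rep q)|exact: teq_sym].
- move=> i a b c ab bc; case: (ext_composable ab) bc.
    move=> [x [y [-> -> cxy]]] /ext_composable[[y' [z [[<-] -> cyz]]]|[? [? []]]] //.
    by rewrite /= (compA HC).
  move=> [p [q [-> -> w]]] /ext_composable[[? [? []]]|] //.
  move=> [q' [r [[<-] -> w']]].
  have [pq -> epq] := ext_comp_inr w; have [qr -> eqr] := ext_comp_inr w'.
  have e := teq_assoc w w'; have [wl wr _ _] := teq_wf e.
  apply: free_class_eq; apply: teq_trans (teq_trans e _).
    by apply/teq_sym/teq_Comp => //; [exact: teq_sym|exact: teq_refl (wf_rep r)].
  by apply/teq_Comp => //; [exact: teq_refl (wf_rep p)|exact: teq_sym].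
- move=> i a b /ext_composable[[x [y [-> -> c]]]|[p [q [-> -> w]]]] /=; last first.
    by rewrite ltnn.
  have [xy ix _] := c; rewrite (dim_comp HC c) -xy ltnS leq_eqVlt.
  case: eqP => [xk _|_ /= xk]; last by rewrite (unit_comp HC).
  have yk : dim y = k by rewrite -xy.
  have e := teq_unit_comp c xk; have [_ w _ _] := teq_wf e.
  have [p -> ep] := @free_classP (Unit x) (inl x) xk.
  have [q -> eq] := @free_classP (Unit y) (inl y) yk.
  apply: free_class_eq; apply: teq_trans e _.
  by apply: teq_Comp => //; exact: teq_sym.
move=> i j a b c d ij ab cd ac; case: (ext_composable ab) cd ac.
  move=> [x [y [-> -> cxy]]].
  move=> /ext_composable[[z [t [-> -> czt]]]|[? [? [-> -> _]]]].
    move=> /ext_composable[[x' [z' [[<-] [<-] cxz]]]|[? [? []]]] //.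
    by rewrite /= (interchange HC).
  by move=> /ext_composable[[? [? []]]|[? [? []]]].
move=> [p [q [-> -> w1]]].
move=> /ext_composable[[? [? [-> -> _]]]|[r [s [-> -> w2]]]].
  by move=> /ext_composable[[? [? []]]|[? [? []]]].
move=> /ext_composable[[? [? []]]|[p' [r' [[<-] [<-] w3]]]] //.
have e := teq_interchange ij w1 w2 w3; have [wl wr _ _] := teq_wf e.
have [_ w4 _] := wr.
have [pq -> e1] := ext_comp_inr w1; have [rs -> e2] := ext_comp_inr w2.
have [pr -> e3] := ext_comp_inr w3; have [qs -> e4] := ext_comp_inr w4.
apply: free_class_eq; apply: teq_trans (teq_trans e _).
  by apply/teq_sym/teq_Comp => //; exact: teq_sym.
by apply/teq_Comp => //; exact: teq_sym.
Qed.

(* The (k+1)-category C(A). *)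
Definition free_ext : strict_cat k.+1 := StrictCat ext_strict.
End FreeExtension.

Record polygraph2 := Polygraph2 {
  gens1 : graph;
  gens2 : cell_ext 1 (cat1 (free_cat gens1))
}.

Definition free2 (S : polygraph2) : strict_cat 2 := free_ext (gens2 S).

Fixpoint tower (l k : nat) (C : strict_cat k) : Type :=
  match l with
  | 0 => Datatypes.unit
  | l'.+1 => {A : cell_ext k C & tower l' (free_ext A)}
  end.

CoInductive infinite_tower (k : nat) (C : strict_cat k) : Type :=
| InfiniteTower (A : cell_ext k C) of infinite_tower (free_ext A).

Fixpoint truncation (l k : nat) (C : strict_cat k) (T : infinite_tower C) :
    tower l C :=
  match l return tower l C with
  | 0 => tt
  | l'.+1 => let: InfiniteTower A T' := T in
             existT (fun A => tower l' (free_ext A)) A (truncation l' T')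
  end.

(* An (l+2,1)-polygraph, for 0 <= l <= oo. *)
Record polygraph (l : enat) := Polygraph {
  base :> polygraph2;
  upper : match l with
          | Fin m => tower m (free2 base)
          | Infty => infinite_tower (free2 base)
          end
}.

Fixpoint finite_tower (l k : nat) (C : strict_cat k) : tower l C -> Prop :=
  match l return tower l C -> Prop with
  | 0 => fun _ => True
  | l'.+1 => fun T => finite_type (projT1 T) /\ finite_tower (projT2 T)
  end.

Definition acyclic_ext (k : nat) (C : strict_cat k) (A : cell_ext k C) : Prop :=
  forall x y : C, sphere k x y ->
    exists f : free_ext A,
      [/\ dim f = k.+1, src f = inl x & tgt f = inl y].

Fixpoint acyclic_tower (l k : nat) (C : strict_cat k) : tower l C -> Prop :=
  match l return tower l C -> Prop with
  | 0 => fun _ => True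
  | l'.+1 => fun T => acyclic_ext (projT1 T) /\ acyclic_tower (projT2 T)
  end.

Definition finite_polygraph (l : enat) (S : polygraph l) : Prop :=
  [/\ finite_type (vertex (gens1 S)), finite_type (edge (gens1 S)),
      finite_type (gens2 S) &
      match l return polygraph l -> Prop with
      | Fin m => fun S => @finite_tower m _ _ (upper S)
      | Infty => fun S => forall m, finite_tower (truncation m (upper S))
      end S].

(* Spheres are filled from dimension 2 on: no condition on the 2-cells [gens2],
   whose role is to present the category. *)
Definition acyclic_polygraph (l : enat) : polygraph l -> Prop :=
  match l return polygraph l -> Prop with
  | Fin m => fun S => @acyclic_tower m _ _ (upper S)
  | Infty => fun S => forall m, acyclic_tower (truncation m (upper S))
  end.

Definition ext_rel (C : category) (A : cell_ext 1 (cat1 C)) (x y : C)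
    (f g : hom x y) : Prop :=
  exists a : A, gsrc a = inr (Arrow f) /\ gtgt a = inr (Arrow g).

Definition presented_cat (S : polygraph2) : category :=
  quotient_cat (@ext_rel _ (gens2 S)).

Definition presents (S : polygraph2) (C : category) : Prop :=
  isomorphic (presented_cat S) C.

Inductive generated (C : category) (S : set (arrow C)) :
    forall x y : C, hom x y -> Prop :=
| generated_gen x y (f : hom x y) : S (Arrow f) -> generated S f
| generated_id x : generated S (idm x)
| generated_cmp x y z (f : hom x y) (g : hom y z) :
    generated S f -> generated S g -> generated S (f \; g).

Definition finitely_generated_cat (C : category) : Prop :=
  finite_type C /\
  exists S : set (arrow C),
    finite_set S /\ forall (x y : C) (f : hom x y), generated S f.

Definition has_finite_resolution (l : enat) (C : category) : Prop :=
  exists S : polygraph l,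
    [/\ finite_polygraph S, acyclic_polygraph S & presents S C].

Definition FDT (n : enat) (C : category) : Prop :=
  match n with
  | Fin 0 => finite_type C
  | Fin 1 => finitely_generated_cat C
  | Fin m.+2 => has_finite_resolution (Fin m) C
  | Infty => has_finite_resolution Infty C
  end.

Record ab_functor (D : category) := AbFunctor {
  aob :> D -> zmodType;
  amap : forall x y, hom x y -> {additive aob x -> aob y};
  amap1 : forall x a, amap (idm x) a = a;
  amapM : forall x y z (f : hom x y) (g : hom y z) a,
    amap (f \; g) a = amap g (amap f a)
}.
Arguments amap {D} _ {x y}.

Record ab_trans (D : category) (F G : ab_functor D) := AbTrans {
  acomp :> forall x, {additive F x -> G x};
  anatural : forall x y (f : hom x y) a,
    acomp y (amap F f a) = amap G f (acomp x a)
}.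

(* Epimorphisms and exactness in a category of functors to Ab are pointwise. *)
Definition epi (D : category) (F G : ab_functor D) (p : ab_trans F G) : Prop :=
  forall (x : D) (b : G x), exists a, p x a = b.

Definition exact_at (D : category) (F G H : ab_functor D)
    (p : ab_trans F G) (q : ab_trans G H) : Prop :=
  forall (x : D) (b : G x), q x b = 0%R <-> exists a, p x a = b.

Definition projective (D : category) (P : ab_functor D) : Prop :=
  forall (F G : ab_functor D) (p : ab_trans F G) (g : ab_trans P G),
    epi p -> exists h : ab_trans P F, forall x a, p x (h x a) = g x a.

Section Constant.
Context (D : category) (V : zmodType).

Definition constant_functor : ab_functor D :=
  @AbFunctor D (fun _ => V) (fun _ _ _ => idfun)
    (fun _ _ => erefl) (fun _ _ _ _ _ _ => erefl).
End Constant.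

Section DirectSum.
Context (D : category) (F G : ab_functor D).

Definition sum_map x y (f : hom x y) (a : F x * G x) : F y * G y :=
  (amap F f a.1, amap G f a.2).

Lemma sum_map_additive x y (f : hom x y) : zmod_morphism (sum_map f).
Proof. by move=> a b; rewrite /sum_map /= !raddfB. Qed.

HB.instance Definition _ x y (f : hom x y) :=
  GRing.isZmodMorphism.Build _ _ (sum_map f) (sum_map_additive f).

Lemma sum_map1 x a : sum_map (idm x) a = a.
Proof. by rewrite /sum_map !amap1; case: a. Qed.

Lemma sum_mapM x y z (f : hom x y) (g : hom y z) a :
  sum_map (f \; g) a = sum_map g (sum_map f a).
Proof. by rewrite /sum_map !amapM. Qed.

Definition direct_sum : ab_functor D :=
  @AbFunctor D (fun x => (F x * G x)%type : zmodType)
    (fun x y f => sum_map f) sum_map1 sum_mapM.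
End DirectSum.

(* The functor ZD(w,-): the free abelian groups on the sets D(w,x). *)
Section Representable.
Context (D : category) (w : D).

Definition zhom (x : D) : zmodType := {freeg {classic hom w x} / int}.

Definition zhom_map x y (f : hom x y) : zhom x -> zhom y :=
  fglift (fun g : {classic hom w x} =>
    << (g : hom w x) \; f : {classic hom w y} >> : {freeg _ / int})%R.

Lemma zhom_map_additive x y (f : hom x y) : zmod_morphism (zhom_map f).
Proof. exact: lift_is_additive. Qed.

HB.instance Definition _ x y (f : hom x y) :=
  GRing.isZmodMorphism.Build _ _ (zhom_map f) (zhom_map_additive f).

Lemma zhom_mapU x y (f : hom x y) (g : {classic hom w x}) (c : int) :
  (zhom_map f << c *g g >> = << c *g (g : hom w x) \; f : {classic hom w y} >>)%R.
Proof.
rewrite /zhom_map liftU; apply/eqP/freeg_eqP => h.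
by rewrite coeffZ !coeffU mul1r.
Qed.

Lemma zhom_map1 x a : zhom_map (idm x) a = a.
Proof.
rewrite -[a]freeg_sumE raddf_sum; apply: eq_bigr => g _.
by rewrite /= zhom_mapU cmpf1.
Qed.

Lemma zhom_mapM x y z (f : hom x y) (g : hom y z) a :
  zhom_map (f \; g) a = zhom_map g (zhom_map f a).
Proof.
rewrite -[a]freeg_sumE !raddf_sum; apply: eq_bigr => h _.
by rewrite /= !zhom_mapU cmpA.
Qed.

Definition free_functor : ab_functor D :=
  @AbFunctor D zhom (fun x y f => zhom_map f) zhom_map1 zhom_mapM.
End Representable.

Definition zero_functor (D : category) : ab_functor D :=
  constant_functor D 'rV[int]_0.

(* The coproduct of the functors ZD(w,-), for w in ws. *)
Definition free_sum (D : category) (ws : seq D) : ab_functor D :=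
  foldr (fun w F => direct_sum (free_functor w) F) (zero_functor D) ws.

Definition finitely_generated (D : category) (F : ab_functor D) : Prop :=
  exists (ws : seq D) (p : ab_trans (free_sum ws) F), epi p.

Section Factorisations.
Context (C : category).

Record factorisation (w w' : arrow C) := Factorisation {
  fleft : hom (asrc w') (asrc w);
  fright : hom (atgt w) (atgt w');
  factorisationE : fleft \; amor w \; fright = amor w'
}.

Lemma factorisation_eq w w' (f g : factorisation w w') :
  fleft f = fleft g -> fright f = fright g -> f = g.
Proof.
case: f g => [u v e] [u' v' e'] /= uu' vv'; subst u' v'.
by rewrite (Prop_irrelevance e e').
Qed.

Lemma fact_idE (w : arrow C) : idm _ \; amor w \; idm _ = amor w.
Proof. by rewrite cmp1f cmpf1. Qed.

Definition fact_id (w : arrow C) : factorisation w w :=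
  Factorisation (fact_idE w).

Lemma fact_cmpE w w' w'' (f : factorisation w w') (g : factorisation w' w'') :
  (fleft g \; fleft f) \; amor w \; (fright f \; fright g) = amor w''.
Proof. by rewrite -(factorisationE g) -(factorisationE f) !cmpA. Qed.

Definition fact_cmp w w' w'' (f : factorisation w w')
    (g : factorisation w' w'') : factorisation w w'' :=
  Factorisation (fact_cmpE f g).

Lemma fact_cmp1f w w' (f : factorisation w w') : fact_cmp (fact_id w) f = f.
Proof. by apply: factorisation_eq; rewrite /= ?cmpf1 ?cmp1f. Qed.

Lemma fact_cmpf1 w w' (f : factorisation w w') : fact_cmp f (fact_id w') = f.
Proof. by apply: factorisation_eq; rewrite /= ?cmpf1 ?cmp1f. Qed.

Lemma fact_cmpA w0 w1 w2 w3 (f : factorisation w0 w1)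
    (g : factorisation w1 w2) (h : factorisation w2 w3) :
  fact_cmp f (fact_cmp g h) = fact_cmp (fact_cmp f g) h.
Proof. by apply: factorisation_eq; rewrite /= cmpA. Qed.

Definition fact_cat : category := Category fact_cmp1f fact_cmpf1 fact_cmpA.
End Factorisations.

Definition natural_system (C : category) : Type := ab_functor (fact_cat C).

Definition constant_Z (C : category) : natural_system C :=
  constant_functor (fact_cat C) int.

(* In the sequences P and d, only the P i with i <= n, and the maps d i
   between them, are constrained. *)
Definition FP (n : enat) (C : category) : Prop :=
  exists (P : nat -> natural_system C)
         (d : forall i, ab_trans (P i.+1) (P i))
         (e : ab_trans (P 0) (constant_Z C)),
    [/\ forall i, below i n -> finitely_generated (P i) /\ projective (P i),
        epi e,
        below 1 n -> exact_at (d 0) e &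
        forall i, below i.+2 n -> exact_at (d i.+1) (d i)].

(* Main.v *)
(* The Fox derivative, or bracket, of a cell is a combination of triples
   (u, a, v), where a is a generating cell of the same dimension and u, v are
   arrows of C: it is additive for the higher compositions and satisfies the
   Leibniz rule for the composition of 1-cells. With d(a) = [s a] - [t a], the
   free natural systems on the generators form a complex that resolves Z.
   A contracting homotopy is obtained from the polygraph itself. Choose a normal
   form u^ for each arrow u of C, and 2-cells that reduce u^ p to the normal
   form of up. Acyclicity then gives, by induction on the dimension, for every
   cell x a cell tau_u(x) of the next dimension, from the conjugate of u^ x by
   these reductions to a cell that depends only on the boundary of x, in a way
   compatible with all compositions. The homotopy sends (u, a, v) to the bracket
   of tau_u(a), acted upon by v on the right.
   Only finiteness in dimensions up to n matters, so that every tower is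
   prolonged by adjoining all spheres. For n = 0 and n = 1 one starts from all
   the arrows of C, or from a generating set, with a 2-cell for each pair of
   parallel paths with the same value. *)
From HB Require Import structures.
From mathcomp Require Import all_boot all_algebra zify.
From mathcomp Require Import boolp classical_sets functions cardinality.
From mathcomp Require Import freeg.
Require Import Defs.

Set Implicit Arguments.
Unset Strict Implicit.
Unset Printing Implicit Defensive.

Import GRing.Theory.

Local Open Scope ring_scope.

(** * Linear combinations of generators acted upon by arrows *)

(** The difficulty lies in the compatibility of tau with compositions. Its values can be chosen on
    generators only; on composites they are forced, tau_u(x y) being tau_u(x), acted upon by y,
    followed by tau_{ux}(y), and this prescription must respect the laws of a strict category.
    Conjugation by the reductions turns every cell into a loop over a normal form, so that the
    0-composition becomes a 1-composition of loops. The one delicate law is then the interchange of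
    the compositions 0 and 1, which asks two such loops to commute. This is an Eckmann-Hilton
    argument, and it uses the invertibility of cells of dimension at least 2. Compatibility yields
    K(u [x]) = [tau_u(x)] for the homotopy K and every cell x. Above dimension 2, the target of
    tau_u(f) is chosen as tau_u(s f) followed by the inverse of tau_u(t f), whence d [tau_u(f)] = u
    [f] - [tau_u(s f)] + [tau_u(t f)] = u [f] - K(u d [f]), the homotopy identity. Linearity of K is
    asked on the right only, because normal forms absorb arrows from the left. *)

Definition fab (T : Type) : zmodType := {freeg {classic T} / int}.

Section FreeAbelian.
Context (T : Type).

Definition fabU (t : T) : fab T := << (t : {classic T}) >>.

Definition fab_lift (M : zmodType) (f : T -> M) : fab T -> M :=
  fglift (f : {classic T} -> zmodule M).

Lemma fab_lift_additive (M : zmodType) (f : T -> M) :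
  zmod_morphism (fab_lift f).
Proof. exact: (@lift_is_additive _ _ (zmodule M)). Qed.

HB.instance Definition _ (M : zmodType) (f : T -> M) :=
  GRing.isZmodMorphism.Build (fab T) M (fab_lift f) (fab_lift_additive f).

Lemma fab_liftU (M : zmodType) (f : T -> M) t : fab_lift f (fabU t) = f t.
Proof. by rewrite /fab_lift liftU scale1r. Qed.

Variant supported (D : T -> Prop) (z : fab T) : Prop :=
  Supported of forall t, coeff (t : {classic T}) z != 0 -> D t.

Lemma supported0 D : supported D 0.
Proof. by split=> t; rewrite coeff0 eqxx. Qed.

Lemma supportedB D x y : supported D x -> supported D y -> supported D (x - y).
Proof.
move=> [dx] [dy]; split=> t; rewrite coeffB.
have [e|/dx//] := eqVneq (coeff (t : {classic T}) x) 0.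
by rewrite e sub0r oppr_eq0 => /dy.
Qed.

Lemma supportedD D x y : supported D x -> supported D y -> supported D (x + y).
Proof.
move=> dx dy; have -> : x + y = x - (0 - y) by rewrite sub0r opprK.
by apply: (supportedB dx); apply: supportedB dy; exact: supported0.
Qed.

Lemma supportedU (D : T -> Prop) t : D t -> supported D (fabU t).
Proof.
move=> Dt; split=> u; rewrite coeffU mul1r; case: (@eqP {classic T} t u) => [<- //|_].
by rewrite mulr0n eqxx.
Qed.

(** Closure under differences yields opposites, sums and natural multiples, hence all integer
    coefficients. *)
Lemma supported_ind (D : T -> Prop) (P : fab T -> Prop) :
  P 0 -> (forall x y, P x -> P y -> P (x - y)) ->
  (forall t, D t -> P (fabU t)) -> forall z, supported D z -> P z.
Proof.
move=> P0 PB PU z [Dz].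
have PN x : P x -> P (- x) by rewrite -sub0r; apply: PB.
have PD x y : P x -> P y -> P (x + y).
  by move=> Px Py; rewrite -[y]opprK; apply: PB => //; apply: PN.
have PM x n : P x -> P (x *+ n).
  by move=> Px; elim: n => [|n IH]; rewrite ?mulr0n // mulrS; apply: PD.
rewrite -[z]freeg_sumE big_seq; elim/big_rec: _ => // t y.
rewrite mem_dom => /Dz/PU Pt Py; apply: PD => //.
suff -> : << coeff t z *g t >> = fabU t *~ coeff t z.
  by case: (coeff t z) => n; rewrite ?NegzE ?mulrNz -?pmulrn; [|apply: PN]; exact: PM.
by rewrite /fabU freeg_mulz intz.
Qed.

Lemma fab_ind (P : fab T -> Prop) :
  P 0 -> (forall x y, P x -> P y -> P (x - y)) ->
  (forall t, P (fabU t)) -> forall z, P z.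
Proof.
by move=> P0 PB PU z; apply: (@supported_ind (fun _ => True)).
Qed.
End FreeAbelian.

Section Arrows.
Context (C : category).
Implicit Types u v w : arrow C.

Definition cc u v : Prop := atgt u = asrc v.
Definition aid (x : C) : arrow C := Arrow (idm x).

Lemma ccP u v : cc u v -> exists x y z (f : hom x y) (g : hom y z),
  u = Arrow f /\ v = Arrow g.
Proof.
by case: u v => x y f [y' z g]; rewrite /cc /= => e; subst y'; exists x, y, z, f, g.
Qed.

Lemma asrc_cmp u v : cc u v -> asrc (arrow_cmp u v) = asrc u.
Proof. by move/ccP=> [x [y [z [f [g [-> ->]]]]]]; rewrite arrow_cmpE. Qed.

Lemma atgt_cmp u v : cc u v -> atgt (arrow_cmp u v) = atgt v.
Proof. by move/ccP=> [x [y [z [f [g [-> ->]]]]]]; rewrite arrow_cmpE. Qed.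

Lemma arrow_cmp1 u x : x = asrc u -> arrow_cmp (aid x) u = u.
Proof. by move=> ->; case: u => x' y f; rewrite /= arrow_cmpE cmp1f. Qed.

Lemma arrow_cmpid u x : x = atgt u -> arrow_cmp u (aid x) = u.
Proof. by move=> ->; case: u => x' y f; rewrite /= arrow_cmpE cmpf1. Qed.

Lemma arrow_cmpA u v w : cc u v -> cc v w ->
  arrow_cmp u (arrow_cmp v w) = arrow_cmp (arrow_cmp u v) w.
Proof.
move/ccP=> [x [y [z [f [g [-> ->]]]]]]; case: w => z' t h; rewrite /cc /= => e.
by subst z'; rewrite !arrow_cmpE cmpA.
Qed.

Lemma cc_cmpl u v w : cc u v -> cc (arrow_cmp u v) w <-> cc v w.
Proof. by move=> uv; rewrite /cc atgt_cmp. Qed.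

Lemma cc_cmpr u v w : cc v w -> cc u (arrow_cmp v w) <-> cc u v.
Proof. by move=> uv; rewrite /cc asrc_cmp. Qed.
End Arrows.

(* The triple (u, a, v) stands for the generator a acted upon by u on the left
   and v on the right; the actions vanish on non-composable arrows. *)
Definition triples (C : category) (A : Type) : Type :=
  (arrow C * A * arrow C)%type.

Section Actions.
Context (C : category) (A : Type).
Implicit Types (u v w : arrow C) (z : fab (triples C A)).

Definition lact u : fab (triples C A) -> fab (triples C A) :=
  fab_lift (fun t => if pselect (cc u t.1.1)
    then fabU (arrow_cmp u t.1.1, t.1.2, t.2) else 0).

Definition ract v : fab (triples C A) -> fab (triples C A) :=
  fab_lift (fun t => if pselect (cc t.2 v)
    then fabU (t.1, arrow_cmp t.2 v) else 0).

HB.instance Definition _ u := GRing.Additive.on (lact u).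
HB.instance Definition _ v := GRing.Additive.on (ract v).

Lemma lactU u v a w : cc u v ->
  lact u (fabU (v, a, w)) = fabU (arrow_cmp u v, a, w).
Proof. by move=> uv; rewrite /lact fab_liftU; case: pselect. Qed.

Lemma lactU0 u v a w : ~ cc u v -> lact u (fabU (v, a, w)) = 0.
Proof. by move=> uv; rewrite /lact fab_liftU; case: pselect. Qed.

Lemma ractU u v a w : cc v w ->
  ract w (fabU (u, a, v)) = fabU (u, a, arrow_cmp v w).
Proof. by move=> uv; rewrite /ract fab_liftU; case: pselect. Qed.

Lemma ractU0 u v a w : ~ cc v w -> ract w (fabU (u, a, v)) = 0.
Proof. by move=> uv; rewrite /ract fab_liftU; case: pselect. Qed.

Lemma lactM u v z : cc u v -> lact u (lact v z) = lact (arrow_cmp u v) z.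
Proof.
move=> uv; elim/fab_ind: z => [|x y ex ey|[[w a] w']]; first by rewrite !raddf0.
  by rewrite !raddfB /= ex ey.
have [vw|vw] := pselect (cc v w).
  by rewrite !lactU ?arrow_cmpA //; [apply/cc_cmpl|apply/cc_cmpr].
by rewrite !lactU0 ?raddf0 // => /(cc_cmpl _ uv).
Qed.

Lemma ractM u v z : cc u v -> ract v (ract u z) = ract (arrow_cmp u v) z.
Proof.
move=> uv; elim/fab_ind: z => [|x y ex ey|[[w a] w']]; first by rewrite !raddf0.
  by rewrite !raddfB /= ex ey.
have [vw|vw] := pselect (cc w' u).
  by rewrite !ractU ?arrow_cmpA //; [apply/cc_cmpr|apply/cc_cmpl].
by rewrite !ractU0 ?raddf0 // => /(cc_cmpr _ uv).
Qed.

(** On each triple one of the two actions vanishes. Equivariant extensions thus commute with the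
    actions without any side condition. *)
Lemma ractM0 u v z : ~ cc u v -> ract v (ract u z) = 0.
Proof.
move=> uv; elim/fab_ind: z => [|x y ex ey|[[w a] w']]; first by rewrite !raddf0.
  by rewrite !raddfB /= ex ey subr0.
have [vw|vw] := pselect (cc w' u); last by rewrite !ractU0 ?raddf0.
by rewrite ractU // ractU0 // => /(cc_cmpl _ vw).
Qed.

Lemma lract u v z : lact u (ract v z) = ract v (lact u z).
Proof.
elim/fab_ind: z => [|x y ex ey|[[w a] w']]; first by rewrite !raddf0.
  by rewrite !raddfB /= ex ey.
have [uw|uw] := pselect (cc u w); have [wv|wv] := pselect (cc w' v).
- by rewrite ractU // !lactU // ractU.
- by rewrite ractU0 // lactU // ractU0 // raddf0.
- by rewrite ractU // !lactU0 // raddf0.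
- by rewrite ractU0 // lactU0 // !raddf0.
Qed.
End Actions.

Section Homogeneous.
Context (C : category) (A : Type) (l : A -> arrow C).
Implicit Types (u v w : arrow C) (z : fab (triples C A)).

Definition valid w (t : triples C A) : Prop :=
  [/\ cc t.1.1 (l t.1.2), cc (l t.1.2) t.2 &
      arrow_cmp (arrow_cmp t.1.1 (l t.1.2)) t.2 = w].

Definition homog w z : Prop := supported (valid w) z.

Definition gena (a : A) : fab (triples C A) :=
  fabU (aid (asrc (l a)), a, aid (atgt (l a))).

Lemma homog_gena a : homog (l a) (gena a).
Proof.
apply: supportedU; split=> //=; rewrite arrow_cmp1 // arrow_cmpid //.
Qed.

Lemma gena_act u a v : cc u (l a) -> cc (l a) v ->
  lact u (ract v (gena a)) = fabU (u, a, v).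
Proof.
by move=> ua av; rewrite /gena ractU ?lactU // arrow_cmp1 // arrow_cmpid.
Qed.

Lemma homog_ind w (P : fab (triples C A) -> Prop) :
  P 0 -> (forall x y, P x -> P y -> P (x - y)) ->
  (forall u a v, cc u (l a) -> cc (l a) v ->
     arrow_cmp (arrow_cmp u (l a)) v = w -> P (lact u (ract v (gena a)))) ->
  forall z, homog w z -> P z.
Proof.
move=> P0 PB PU; apply: supported_ind => // -[[u a] v] [/= ua av e].
by rewrite -gena_act //; apply: PU.
Qed.

Lemma homog_lact u w z : homog w z -> cc u w -> homog (arrow_cmp u w) (lact u z).
Proof.
move=> hz uw; elim/homog_ind: hz => [|x y hx hy|v a v' va av e].
- by rewrite raddf0; exact: supported0.
- by rewrite raddfB; exact: supportedB.
have uv : cc u v.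
  by move: uw; rewrite -e /cc asrc_cmp ?asrc_cmp //; apply/cc_cmpl.
rewrite lactM // gena_act //; last exact/cc_cmpl.
apply: supportedU; split=> //=; first exact/cc_cmpl.
rewrite -e -(@arrow_cmpA _ u v) // -(@arrow_cmpA _ u) //.
  exact/cc_cmpr.
exact/cc_cmpl.
Qed.

Lemma homog_ract u w z : homog w z -> cc w u -> homog (arrow_cmp w u) (ract u z).
Proof.
move=> hz wu; elim/homog_ind: hz => [|x y hx hy|v a v' va av e].
- by rewrite raddf0; exact: supported0.
- by rewrite raddfB; exact: supportedB.
have va' : cc (arrow_cmp v (l a)) v' by apply/cc_cmpl.
have uv : cc v' u by move: wu; rewrite -e /cc atgt_cmp.
rewrite -lract ractM // gena_act //; last exact/cc_cmpr.
by apply: supportedU; split=> //=; [exact/cc_cmpr|rewrite -e arrow_cmpA].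
Qed.

Lemma lact1 w z x : homog w z -> x = asrc w -> lact (aid x) z = z.
Proof.
move=> hz ->; elim/homog_ind: hz => [|y y' hx hy|v a v' va av e].
- by rewrite raddf0.
- by rewrite raddfB /= hx hy.
by rewrite gena_act // lactU -?e ?arrow_cmp1 // /cc !asrc_cmp //; apply/cc_cmpl.
Qed.

Lemma ract1 w z x : homog w z -> x = atgt w -> ract (aid x) z = z.
Proof.
move=> hz ->; elim/homog_ind: hz => [|y y' hx hy|v a v' va av e].
- by rewrite raddf0.
- by rewrite raddfB /= hx hy.
rewrite -e atgt_cmp; last exact/cc_cmpl.
by rewrite gena_act // ractU ?arrow_cmpid.
Qed.
End Homogeneous.

(** * Free natural systems *)

Lemma arrowK (C : category) (w : arrow C) : Arrow (amor w) = w.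
Proof. by case: w. Qed.

(** The right-hand side is generalised to an arbitrary arrow with proofs that its ends are [x] and
    [y]; after substitution both transports are trivial by proof irrelevance. *)
Lemma Arrow_inj (C : category) (x y : C) (f g : hom x y) :
  Arrow f = Arrow g -> f = g.
Proof.
suff H (a : arrow C) (e1 : asrc a = x) (e2 : atgt a = y) : Arrow f = a ->
    f = ecast z (hom z y) e1 (ecast z (hom (asrc a) z) e2 (amor a)).
  by move/(H (Arrow g) erefl erefl).
by move=> e; subst a; rewrite (Prop_irrelevance e1 erefl)
  (Prop_irrelevance e2 erefl).
Qed.

Lemma arrow_cmp3 (C : category) (x y : C) (w : arrow C)
    (u : hom x (asrc w)) (v : hom (atgt w) y) :
  arrow_cmp (arrow_cmp (Arrow u) w) (Arrow v) = Arrow (u \; amor w \; v).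
Proof. by case: w u v => x' y' w /= u v; rewrite !arrow_cmpE -cmpA. Qed.

Lemma arrow_cmp_fact (C : category) (w w' : arrow C) (f : factorisation w w') :
  arrow_cmp (Arrow (fleft f)) (arrow_cmp w (Arrow (fright f))) = w'.
Proof.
case: w w' f => x y w [x' y' w'] [u v /= <-].
by rewrite !arrow_cmpE.
Qed.

Section FreeSystem.
Context (C : category) (A : Type) (l : A -> arrow C).

Definition homogp (w : arrow C) : {pred fab (triples C A)} :=
  fun z => `[< homog l w z >].

Lemma homogp_zmod w : zmod_closed (homogp w).
Proof.
split; first by apply/asboolP; exact: supported0.
by move=> x y /asboolP hx /asboolP hy; apply/asboolP; exact: supportedB.
Qed.

HB.instance Definition _ w :=
  GRing.isZmodClosed.Build (fab (triples C A)) (homogp w) (homogp_zmod w).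

Record piece (w : arrow C) := Piece {
  pval :> fab (triples C A);
  _ : pval \in homogp w
}.

HB.instance Definition _ w := [isSub for @pval w].
HB.instance Definition _ w := [Choice of piece w by <:].
HB.instance Definition _ w := [SubChoice_isSubZmodule of piece w by <:].

Lemma pvalP w (z : piece w) : homog l w z.
Proof. by case: z => z h; exact/asboolP. Qed.

Definition mkpiece w z (hz : homog l w z) : piece w := Piece (introT (asboolP _) hz).

Section Map.
Context (w w' : arrow C) (f : factorisation w w').

Lemma fact_homog z : homog l w z ->
  homog l w' (lact (Arrow (fleft f)) (ract (Arrow (fright f)) z)).
Proof.
move=> hz; rewrite -[X in homog l X](arrow_cmp_fact f).
by apply: homog_lact; [exact: homog_ract|apply/cc_cmpr].
Qed.

Definition piece_map (z : piece w) : piece w' := mkpiece (fact_homog (pvalP z)).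

Lemma piece_map_additive : zmod_morphism piece_map.
Proof. by move=> x y; apply/val_inj; rewrite /= !raddfB. Qed.

HB.instance Definition _ :=
  GRing.isZmodMorphism.Build _ _ piece_map piece_map_additive.
End Map.

Lemma piece_map1 w (z : piece w) : piece_map (fact_id w) z = z.
Proof.
by apply/val_inj; rewrite /= (@ract1 _ _ l w) ?(@lact1 _ _ l w) //; exact: pvalP.
Qed.

Lemma piece_mapM w w' w'' (f : factorisation w w') (g : factorisation w' w'')
  (z : piece w) : piece_map (fact_cmp f g) z = piece_map g (piece_map f z).
Proof.
apply/val_inj => /=; rewrite -lract lactM // ractM //.
by rewrite !arrow_cmpE.
Qed.

Definition free_system : natural_system C :=
  @AbFunctor (fact_cat C) (fun w => piece w) (fun w w' f => piece_map f)
    piece_map1 piece_mapM.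

Definition is_fact w (t : triples C A) (f : factorisation (l t.1.2) w) : Prop :=
  Arrow (fleft f) = t.1.1 /\ Arrow (fright f) = t.2.

(** A valid triple (u, a, v) is a morphism (u, v) from [l a] to [w] in the category of
    factorisations, so that the free system is the coproduct of the representable functors at the
    arrows [l a]. *)
Lemma valid_fact w t : valid l w t -> {f | @is_fact w t f}.
Proof.
move=> vt; apply/cid; case: t vt => [[u a] v] [/=].
case: u v => xu yu u [xv yv v]; rewrite /cc /= => e1 e2; subst yu xv.
rewrite arrow_cmp3 => e; subst w.
by exists (@Factorisation C (l a) (Arrow (u \; amor (l a) \; v)) u v erefl).
Qed.

Lemma is_fact_inj w t f g : @is_fact w t f -> @is_fact w t g -> f = g.
Proof.
move=> [fu fv] [gu gv]; apply: factorisation_eq; apply: Arrow_inj.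
  by rewrite fu gu.
by rewrite fv gv.
Qed.

Section Lift.
Context (F : natural_system C) (m : forall a, F (l a)).

Definition lift_raw (w : arrow C) : fab (triples C A) -> F w :=
  fab_lift (fun t => match pselect (valid l w t) with
    | left h => amap F (projT1 (valid_fact h)) (m t.1.2)
    | right _ => 0 end).

HB.instance Definition _ w := GRing.Additive.on (lift_raw w).

Lemma lift_rawU w t f : @is_fact w t f ->
  lift_raw w (fabU t) = amap F f (m t.1.2).
Proof.
move=> tf; rewrite /lift_raw fab_liftU; case: pselect => [h|[]].
  by case: (valid_fact h) => g tg /=; rewrite (is_fact_inj tf tg).
case: t f tf => [[u a] v] f [/= <- <-]; split=> //=.
by rewrite arrow_cmp3 factorisationE arrowK.
Qed.

Lemma lift_rawM w w' (f : factorisation w w') z : homog l w z ->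
  lift_raw w' (lact (Arrow (fleft f)) (ract (Arrow (fright f)) z)) =
  amap F (f : @hom (fact_cat C) w w') (lift_raw w z).
Proof.
rewrite /homog => hz.
elim/supported_ind: hz => [|x y ex ey|t /valid_fact[g [e1 e2]]].
- by rewrite !raddf0.
- by rewrite !raddfB /= ex ey.
rewrite (lift_rawU (conj e1 e2)) -amapM.
case: t g e1 e2 => [[u a] v] /= g <- <-.
rewrite ractU // lactU // !arrow_cmpE.
exact: (@lift_rawU w' (_, a, _) (fact_cmp g f)).
Qed.

Definition lift_comp (w : arrow C) (z : piece w) : F w := lift_raw w z.

Lemma lift_comp_additive w : zmod_morphism (@lift_comp w).
Proof. by move=> x y; rewrite /lift_comp raddfB. Qed.

HB.instance Definition _ w :=
  GRing.isZmodMorphism.Build _ _ (@lift_comp w) (@lift_comp_additive w).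

Lemma lift_natural w w' (f : @hom (fact_cat C) w w') (z : free_system w) :
  lift_comp (amap free_system f z) = amap F f (lift_comp z).
Proof. by apply: lift_rawM; exact: pvalP. Qed.

Definition system_lift : ab_trans free_system F :=
  @AbTrans _ free_system F (fun w => @lift_comp w) lift_natural.
End Lift.

Definition gen_piece (a : A) : piece (l a) := mkpiece (homog_gena l a).

Lemma piece_ind w (Q : piece w -> Prop) :
  Q 0 -> (forall x y, Q x -> Q y -> Q (x - y)) ->
  (forall a (f : factorisation (l a) w), Q (piece_map f (gen_piece a))) ->
  forall z, Q z.
Proof.
move=> Q0 QB QU z.
(* The induction takes place in the ambient group, so the goal is relaxed to the existence of a
   piece with the same underlying element. *)
suff [z' <- //] : exists2 z' : piece w, z' = z & Q z'.
suff [z' e qz] : exists2 z' : piece w, pval z' = pval z & Q z'.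
  by exists z' => //; apply/val_inj.
have := pvalP z; rewrite /homog => hz.
elim/supported_ind: hz => [|x y|t vt].
- by exists 0.
- by move=> [x' <- qx] [y' <- qy]; exists (x' - y') => //; exact: QB.
have [f [e1 e2]] := valid_fact vt; case: t vt f e1 e2 => [[u a] v] [/= c1 c2 _] f e1 e2.
by exists (piece_map f (gen_piece a)) => //=; rewrite e1 e2 gena_act.
Qed.

Lemma free_system_ext (F : natural_system C) (p q : ab_trans free_system F) :
  (forall a, p (l a) (gen_piece a) = q (l a) (gen_piece a)) ->
  forall w z, p w z = q w z.
Proof.
move=> pq w; apply: piece_ind => [|x y ex ey|a f].
- by rewrite !raddf0.
- by rewrite !raddfB ex ey.
have n (r : ab_trans free_system F) := anatural r (f : @hom (fact_cat C) _ _) (gen_piece a).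
by rewrite [LHS]n [RHS]n pq.
Qed.

Lemma system_lift_gen (F : natural_system C) (m : forall a, F (l a)) a :
  system_lift m (l a) (gen_piece a) = m a.
Proof.
rewrite /= /lift_comp /= /gena.
by rewrite (@lift_rawU _ _ _ (_, a, _) (fact_id (l a))) //= (@amap1 _ F (l a)).
Qed.

Lemma free_system_projective : projective free_system.
Proof.
move=> F G p g ep.
have [m hm] : {m : forall a, F (l a) & forall a, p (l a) (m a) = g (l a) (gen_piece a)}.
  by exists (fun a => projT1 (cid (ep _ (g (l a) (gen_piece a))))) => a; case: cid.
exists (system_lift m).
pose q : ab_trans free_system G := @AbTrans _ _ _ (fun w => p w \o system_lift m w)
   (fun w w' f z => etrans (f_equal (p w') (anatural (system_lift m) f z)) (anatural p f _)).
have /= H := @free_system_ext G q g.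
by apply: H => a; rewrite /= system_lift_gen hm.
Qed.
End FreeSystem.

(** * Finite generation of free natural systems *)

Section Yoneda.
Context (D : category) (F : ab_functor D) (w : D) (m : F w).

Definition yoneda_comp (x : D) : zhom w x -> F x :=
  @fab_lift (hom w x) (F x) (fun g => amap F g m).

HB.instance Definition _ x := GRing.Additive.on (@yoneda_comp x).

Lemma yoneda_natural x y (f : hom x y) (z : zhom w x) :
  yoneda_comp (zhom_map f z) = amap F f (yoneda_comp z).
Proof.
elim/(@fab_ind (hom w x)): z => [|a b ea eb|g]; first by rewrite !raddf0.
  by rewrite !raddfB /= ea eb.
by rewrite zhom_mapU /yoneda_comp (fab_liftU _ (g \; f)) (fab_liftU _ g) amapM.
Qed.

Definition yoneda : ab_trans (free_functor w) F :=
  @AbTrans D (free_functor w) F (fun x => @yoneda_comp x) yoneda_natural.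
End Yoneda.

Section Copair.
Context (D : category) (F G H : ab_functor D).
Context (p : ab_trans F H) (q : ab_trans G H).

Definition copair_comp (x : D) (a : direct_sum F G x) : H x :=
  p x a.1 + q x a.2.

Lemma copair_additive x : zmod_morphism (@copair_comp x).
Proof. by move=> a b; rewrite /copair_comp /= !raddfB opprD addrACA. Qed.

HB.instance Definition _ x :=
  GRing.isZmodMorphism.Build _ _ (@copair_comp x) (@copair_additive x).

Lemma copair_natural x y (f : hom x y) (a : direct_sum F G x) :
  copair_comp (amap (direct_sum F G) f a) = amap H f (copair_comp a).
Proof. by rewrite /copair_comp /= raddfD !anatural. Qed.

Definition copair : ab_trans (direct_sum F G) H :=
  @AbTrans D _ _ (fun x => @copair_comp x) copair_natural.
End Copair.

Section ZeroTrans.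
Context (D : category) (F G : ab_functor D).

Lemma zero_natural x y (f : hom x y) (a : F x) :
  (\0 : {additive F y -> G y}) (amap F f a) =
  amap G f ((\0 : {additive F x -> G x}) a).
Proof. by rewrite /= raddf0. Qed.

Definition zero_trans : ab_trans F G :=
  @AbTrans D F G (fun x => (\0 : {additive F x -> G x})) zero_natural.
End ZeroTrans.

(** The Yoneda maps of the listed elements are added up. Membership is [List.In], which asks for no
    decidable equality on dependent pairs. *)
Lemma free_sum_cover (D : category) (F : ab_functor D) (s : seq {w : D & F w}) :
  exists p : ab_trans (free_sum [seq tag m | m <- s]) F,
    forall m, List.In m s -> forall x (f : hom (tag m) x),
    exists b, p x b = amap F f (tagged m).
Proof.
elim: s => [|m s [p hp]]; first by exists (zero_trans _ _).
exists (copair (yoneda (tagged m)) p) => m' /= [<- x f|/hp H x f].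
  exists (fabU (f : hom (tag m) x), 0).
  by rewrite /= /copair_comp /= raddf0 addr0 /yoneda_comp fab_liftU.
have [b e] := H x f; exists (0, b).
by rewrite /= /copair_comp /= raddf0 add0r.
Qed.

Lemma finite_typeP (T : Type) : finite_type T ->
  exists s : seq T, forall t, List.In t s.
Proof.
rewrite /finite_type => /(@finite_seqP {classic T})[s e]; exists s => t.
have : [set: {classic T}]%classic t by [].
rewrite e /=; elim: (s) => //= a s' IH; rewrite inE => /predU1P[->|/IH]; first by left.
by right.
Qed.

Lemma free_system_fg (C : category) (A : Type) (l : A -> arrow C) :
  finite_type A -> finitely_generated (free_system l).
Proof.
move=> /finite_typeP[s hs].
pose g a : {w : fact_cat C & free_system l w} :=
  Tagged (fun w : fact_cat C => free_system l w) (gen_piece l a : free_system l (l a)).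
have [p hp] := free_sum_cover (map g s).
exists (map tag (map g s)), p => w z.
elim/piece_ind: z => [|x y [a ea] [b eb]|a f].
- by exists 0; rewrite raddf0.
- by exists (a - b); rewrite raddfB ea eb.
by have [b e] := hp (g a) (List.in_map g _ _ (hs a)) w f; exists b.
Qed.

(** * Boundary maps determined by their values on generators *)

Section Boundary.
Context (C : category) (A B : Type) (lA : A -> arrow C) (lB : B -> arrow C).
Context (bd : A -> fab (triples C B)) (hbd : forall a, homog lB (lA a) (bd a)).

Definition bilin : fab (triples C A) -> fab (triples C B) :=
  fab_lift (fun t => lact t.1.1 (ract t.2 (bd t.1.2))).

HB.instance Definition _ := GRing.Additive.on bilin.
End Boundary.

Lemma lactM0 (C : category) (A : Type) (u v : arrow C) (z : fab (triples C A)) :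
  ~ cc u v -> lact u (lact v z) = 0.
Proof.
move=> uv; elim/fab_ind: z => [|x y ex ey|[[w a] w']]; first by rewrite !raddf0.
  by rewrite !raddfB /= ex ey subr0.
have [vw|vw] := pselect (cc v w); last by rewrite [lact v _]lactU0 ?raddf0.
by rewrite lactU // lactU0 // => /(cc_cmpr _ vw).
Qed.

Section BoundaryTheory.
Context (C : category) (A B : Type) (bd : A -> fab (triples C B)).
Implicit Types (u v w : arrow C) (z : fab (triples C A)).

Lemma bilin_lact u z : bilin bd (lact u z) = lact u (bilin bd z).
Proof.
elim/fab_ind: z => [|x y ex ey|[[v a] v']]; first by rewrite !raddf0.
  by rewrite !raddfB /= ex ey.
have [uv|uv] := pselect (cc u v).
  by rewrite lactU // /bilin !fab_liftU /= lactM.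
by rewrite lactU0 // /bilin fab_liftU /= lactM0 // raddf0.
Qed.

Lemma bilin_ract u z : bilin bd (ract u z) = ract u (bilin bd z).
Proof.
elim/fab_ind: z => [|x y ex ey|[[v a] v']]; first by rewrite !raddf0.
  by rewrite !raddfB /= ex ey.
have [uv|uv] := pselect (cc v' u).
  by rewrite ractU // /bilin !fab_liftU /= -lract ractM.
by rewrite ractU0 // /bilin fab_liftU /= -lract ractM0 // !raddf0.
Qed.

Context (lA : A -> arrow C) (lB : B -> arrow C).
Hypothesis hbd : forall a, homog lB (lA a) (bd a).

Lemma bilin_gena a : bilin bd (gena lA a) = bd a.
Proof.
rewrite /bilin /gena fab_liftU /= (ract1 (hbd a)) // (lact1 (hbd a)) //.
Qed.

Definition bd_trans : ab_trans (free_system lA) (free_system lB) :=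
  system_lift (F := free_system lB) (fun a => mkpiece (hbd a)).

Lemma pval_bd_trans w (z : piece lA w) :
  pval (bd_trans w z) = bilin bd (pval z).
Proof.
elim/piece_ind: z => [|x y ex ey|a f]; first by rewrite !raddf0.
  have pB w' (B' : Type) (l : B' -> arrow C) (a b : piece l w') :
    pval (a - b) = pval a - pval b by exact: (raddfB val).
  by rewrite raddfB !pB ex ey -raddfB.
have n := anatural bd_trans (f : @hom (fact_cat C) _ _) (gen_piece lA a).
rewrite [bd_trans _ _]n /= bilin_lact bilin_ract bilin_gena; congr lact; congr ract.
by have -> := system_lift_gen (F := free_system lB) (fun a => mkpiece (hbd a)) a.
Qed.
End BoundaryTheory.

(** * From chain complexes to resolutions *)

Definition augm (T : Type) : fab T -> int := fab_lift (fun _ => 1%R : int).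
HB.instance Definition _ T := GRing.Additive.on (@augm T).

Lemma pvalB (C : category) (A : Type) (l : A -> arrow C) w (x y : piece l w) :
  pval (x - y) = pval x - pval y.
Proof. exact: (raddfB val). Qed.

Section Chain.
Context (C : category) (n : enat) (A : nat -> Type).
Context (l : forall i, A i -> arrow C).
Context (bd : forall i, A i.+1 -> fab (triples C (A i))).
Hypothesis homog_bd : forall i a, homog (@l i) (l a) (bd a).
Hypothesis finite_A : forall i, below i n -> finite_type (A i).
Hypothesis label0 : forall x : C, exists a : A 0, l a = aid x.
Hypothesis augm_bd : forall (a : A 1) u v,
  cc u (l a) -> cc (l a) v -> augm (lact u (ract v (bd a))) = 0.
Hypothesis exact0 : below 1 n -> forall w (z : fab (triples C (A 0))),
  homog (@l 0) w z -> augm z = 0 ->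
  exists2 y, homog (@l 1) w y & bilin (@bd 0) y = z.
Hypothesis bd_bd : forall i (a : A i.+2), below i.+2 n -> bilin (@bd i) (bd a) = 0.
Hypothesis exactS : forall i, below i.+2 n -> forall w z,
  homog (@l i.+1) w z -> bilin (@bd i) z = 0 ->
  exists2 y, homog (@l i.+2) w y & bilin (@bd i.+1) y = z.

Let P i : natural_system C := free_system (@l i).
Let d i : ab_trans (P i.+1) (P i) := bd_trans (@homog_bd i).
Let e : ab_trans (P 0) (constant_Z C) :=
  system_lift (F := constant_Z C) (fun _ => 1%R : int).

Lemma augm_gena (a : A 0) u v : cc u (l a) -> cc (l a) v ->
  augm (lact u (ract v (gena (@l 0) a))) = 1.
Proof. by move=> ua av; rewrite gena_act // /augm fab_liftU. Qed.

Lemma eE w (z : piece (@l 0) w) : e w z = augm (pval z).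
Proof.
elim/piece_ind: z => [|x y ex ey|a f]; first by rewrite !raddf0.
  by rewrite raddfB pvalB ex ey raddfB.
rewrite /= augm_gena //.
have n' := anatural e (f : @hom (fact_cat C) _ _) (gen_piece (@l 0) a).
by rewrite [LHS]n' [LHS](system_lift_gen (F := constant_Z C) (fun _ => 1%R : int) a).
Qed.

Lemma piece_eq i w (x y : piece (@l i) w) : pval x = pval y -> x = y.
Proof. exact: val_inj. Qed.

(** The inclusions of kernels in images are the hypotheses. The opposite inclusions need a check on
    generators only, since the boundaries commute with the actions. *)
Lemma FP_of_chain : FP n C.
Proof.
exists P, d, e; split.
- by move=> i /finite_A h; split; [exact: free_system_fg|exact: free_system_projective].
- move=> w b; have [a ha] := label0 (asrc w).
  have ca : cc (l a) w by rewrite /cc ha.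
  (* The triple (1, a, w), with [a] over the identity of the source of [w], has augmentation 1, so
     its multiples reach every integer. *)
  have hz : homog (@l 0) w (fabU (aid (asrc w), a, w)).
    apply: supportedU; split=> //=; first by rewrite /cc ha.
    by rewrite ha arrow_cmp1 // arrow_cmp1.
  exists (mkpiece hz *~ b); rewrite raddfMz eE /= /augm fab_liftU.
  by rewrite -[RHS]intz.
- move=> n1 w z; rewrite eE; split.
    move=> z0; have [y hy yz] := exact0 n1 (pvalP z) z0.
    by exists (mkpiece hy); apply: piece_eq; rewrite pval_bd_trans.
  move=> [y <-]; rewrite pval_bd_trans.
  elim/piece_ind: y => [|x y ex ey|a f]; first by rewrite !raddf0.
    by rewrite pvalB !raddfB /= ex ey subrr.
  rewrite /= bilin_lact bilin_ract (bilin_gena (@homog_bd 0)); exact: augm_bd.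
- move=> i n2 w z; split.
    move=> z0; have [|y hy yz] := exactS n2 (pvalP z).
      by rewrite -(pval_bd_trans (@homog_bd i)) z0.
    by exists (mkpiece hy); apply: piece_eq; rewrite pval_bd_trans.
  move=> [y <-]; apply: piece_eq; rewrite !pval_bd_trans.
  elim/piece_ind: y => [|x y ex ey|a f]; first by rewrite !raddf0.
    by rewrite pvalB !raddfB /= ex ey subrr.
  rewrite /= !(bilin_lact, bilin_ract) (bilin_gena (@homog_bd i.+1)) bd_bd //.
  by rewrite !raddf0.
Qed.
End Chain.

Local Open Scope nat_scope.

(** * One-sorted strict n-categories *)

Reserved Notation "x *[ i ] y" (at level 40, i at level 200, left associativity,
  format "x  *[ i ]  y").

(* Strict n-categories in one-sorted form: a cell of dimension i < n is
   identified with its unit in dimension n, and is thus a fixed point of the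
   i-source and i-target maps [ss i] and [tt i]. *)
Record ocat (n : nat) := OCat {
  oc :> Type;
  ss : nat -> oc -> oc;
  tt : nat -> oc -> oc;
  cp : nat -> oc -> oc -> oc;
  ss_id : forall i (x : oc), n <= i -> ss i x = x;
  tt_id : forall i (x : oc), n <= i -> tt i x = x;
  ssss : forall i j (x : oc), i <= j -> ss i (ss j x) = ss i x;
  tttt : forall i j (x : oc), i <= j -> tt i (tt j x) = tt i x;
  sstt : forall i j (x : oc), i < j -> ss i (tt j x) = ss i x;
  ttss : forall i j (x : oc), i < j -> tt i (ss j x) = tt i x;
  ssK : forall i j (x : oc), i <= j -> ss j (ss i x) = ss i x;
  ttK : forall i j (x : oc), i <= j -> tt j (tt i x) = tt i x;
  sttK : forall i j (x : oc), i <= j -> ss j (tt i x) = tt i x;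
  tssK : forall i j (x : oc), i <= j -> tt j (ss i x) = ss i x;
  ss_cp : forall i (x y : oc), i < n -> tt i x = ss i y -> ss i (cp i x y) = ss i x;
  tt_cp : forall i (x y : oc), i < n -> tt i x = ss i y -> tt i (cp i x y) = tt i y;
  ss_cp_gt : forall i j (x y : oc), i < n -> tt i x = ss i y -> i < j ->
    ss j (cp i x y) = cp i (ss j x) (ss j y);
  tt_cp_gt : forall i j (x y : oc), i < n -> tt i x = ss i y -> i < j ->
    tt j (cp i x y) = cp i (tt j x) (tt j y);
  cp1x : forall i (x : oc), i < n -> cp i (ss i x) x = x;
  cpx1 : forall i (x : oc), i < n -> cp i x (tt i x) = x;
  cpA : forall i (x y z : oc), i < n -> tt i x = ss i y -> tt i y = ss i z ->
    cp i x (cp i y z) = cp i (cp i x y) z;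
  cp_inter : forall i j (x y z w : oc), i < j -> j < n ->
    tt j x = ss j y -> tt j z = ss j w -> tt i x = ss i z ->
    cp i (cp j x y) (cp j z w) = cp j (cp i x z) (cp i y w)
}.
Notation "x *[ i ] y" := (cp i x y).

(** * The top cells of a strict category in one-sorted form *)

Section TopCells.
Context (k : nat) (C : strict_cat k).
Let HC := strict_catP C.

Lemma unit_from_iter i j (y : C) : i <= j <= k ->
  unit_from i k y = unit_from j k (unit_from i j y).
Proof. by move=> /andP[ij jk]; rewrite /unit_from -iterD; congr iter; lia. Qed.

Lemma bsrc_unit_le i j (y : C) : dim y = j -> i <= j <= k ->
  bsrc i (unit_from j k y) = bsrc i y.
Proof.
move=> yj /andP[ij jk]; rewrite -(@bsrc_bsrc _ _ i j) ?bsrc_unit_from ?jk ?leqnn //.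
by rewrite ij (dim_unit_from yj) ?jk ?leqnn.
Qed.

Lemma btgt_unit_le i j (y : C) : dim y = j -> i <= j <= k ->
  btgt i (unit_from j k y) = btgt i y.
Proof.
move=> yj /andP[ij jk]; rewrite -(@btgt_btgt _ _ i j) ?btgt_unit_from ?jk ?leqnn //.
by rewrite ij (dim_unit_from yj) ?jk ?leqnn.
Qed.

Lemma bsrc_unit_ge i j (y : C) : dim y = j -> j <= i <= k ->
  bsrc i (unit_from j k y) = unit_from j i y.
Proof.
move=> yj /andP[ij jk]; rewrite (@unit_from_iter j i) ?ij // bsrc_unit_from ?jk ?leqnn //.
by rewrite (dim_unit_from yj) ?ij.
Qed.

Lemma btgt_unit_ge i j (y : C) : dim y = j -> j <= i <= k ->
  btgt i (unit_from j k y) = unit_from j i y.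
Proof.
move=> yj /andP[ij jk]; rewrite (@unit_from_iter j i) ?ij // btgt_unit_from ?jk ?leqnn //.
by rewrite (dim_unit_from yj) ?ij.
Qed.

Lemma unit_from_comp i j (x y : C) : composable i x y -> dim x = j -> j <= k ->
  unit_from j k (comp i x y) = comp i (unit_from j k x) (unit_from j k y).
Proof.
move=> c xj jk; have [m e] : exists m, k = j + m by exists (k - j); lia.
have {}e : k - j = m by lia.
rewrite /unit_from e; have mk : j + m <= k by lia.
elim: m {e} j x y c xj jk mk => // m IH j x y c xj jk mk.
have [xy ix eb] := c; have dx : dim x < k by lia.
have dy : dim y < k by rewrite -xy.
rewrite !iterSr (unit_comp HC) //; apply: (IH j.+1); rewrite ?(dim_unit HC) ?xj //; try lia.
split; rewrite ?(dim_unit HC) ?xy //; first by rewrite -xy ltnW.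
rewrite -btgt_tgt ?(dim_unit HC) ?ltnS ?(ltnW ix) // (tgt_unit HC) //.
by rewrite -bsrc_src ?(dim_unit HC) -?xy ?ltnS ?(ltnW ix) // (src_unit HC).
Qed.

Record top := Top { tv :> C; dim_tv : dim tv = k }.

Lemma top_eq (x y : top) : tv x = tv y -> x = y.
Proof.
case: x y => x dx [y dy] /= e; subst y; congr Top; exact: eq_irrelevance.
Qed.

Lemma dim_tss i (x : top) : dim (unit_from i k (bsrc i x)) = k.
Proof.
have dx := dim_tv x; have [ik|ik] := leqP i k.
  by rewrite dim_unit_from ?dim_bsrc ?dx ?ik ?leqnn.
have e0 : k - i = 0 by lia.
by rewrite /unit_from /bsrc dx e0.
Qed.

Lemma dim_ttt i (x : top) : dim (unit_from i k (btgt i x)) = k.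
Proof.
have dx := dim_tv x; have [ik|ik] := leqP i k.
  by rewrite dim_unit_from ?dim_btgt ?dx ?ik ?leqnn.
have e0 : k - i = 0 by lia.
by rewrite /unit_from /btgt dx e0.
Qed.

Definition tss i (x : top) : top := Top (dim_tss i x).
Definition ttt i (x : top) : top := Top (dim_ttt i x).

Lemma dim_tcp i (x y : top) :
  dim (if pselect (composable i (tv x) y) then comp i (tv x) y else x) = k.
Proof.
by case: pselect => c; rewrite ?(dim_comp HC c) dim_tv.
Qed.

Definition tcp i (x y : top) : top := Top (dim_tcp i x y).

Lemma tcomposable_top i (x y : top) : i < k -> ttt i x = tss i y ->
  composable i (tv x) y.
Proof.
have [dx dy] := (dim_tv x, dim_tv y).
move=> ik /(congr1 (fun z : top => bsrc i z)) /=.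
rewrite !bsrc_unit_from ?dim_bsrc ?dim_btgt ?dx ?dy ?(ltnW ik) ?leqnn //.
by split; rewrite ?dx ?dy.
Qed.

Lemma tv_tcp i (x y : top) : i < k -> ttt i x = tss i y ->
  tv (tcp i x y) = comp i (tv x) y.
Proof. by move=> ik /(tcomposable_top ik) c /=; case: pselect. Qed.

Lemma tss_id i (x : top) : k <= i -> tss i x = x.
Proof.
move=> ki; apply: top_eq; have e : k - i = 0 by lia.
by rewrite /= /unit_from /bsrc dim_tv e.
Qed.

Lemma ttt_id i (x : top) : k <= i -> ttt i x = x.
Proof.
move=> ki; apply: top_eq; have e : k - i = 0 by lia.
by rewrite /= /unit_from /btgt dim_tv e.
Qed.

Lemma tboundary_lt i j (x : top) : i <= j ->
  [/\ tss i (tss j x) = tss i x, ttt i (ttt j x) = ttt i x,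
      i < j -> tss i (ttt j x) = tss i x & i < j -> ttt i (tss j x) = ttt i x].
Proof.
move=> ij; have dx := dim_tv x; have [kj|jk] := leqP k j.
  have eS z : tss j z = z by exact: tss_id.
  have eT z : ttt j z = z by exact: ttt_id.
  by split; rewrite ?eS ?eT.
have ijk : i <= j <= k by rewrite ij ltnW.
have d1 : dim (bsrc j x) = j by rewrite dim_bsrc // dx ltnW.
have d2 : dim (btgt j x) = j by rewrite dim_btgt // dx ltnW.
by split=> [||ij'|ij']; apply: top_eq; rewrite /= ?(bsrc_unit_le d1, bsrc_unit_le d2, btgt_unit_le d1, btgt_unit_le d2) //
  ?(bsrc_bsrc, btgt_btgt, bsrc_btgt, btgt_bsrc) // dx ?ij' ?ij ltnW.
Qed.

Lemma tboundary_ge i j (x : top) : i <= j ->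
  [/\ tss j (tss i x) = tss i x, ttt j (ttt i x) = ttt i x,
      tss j (ttt i x) = ttt i x & ttt j (tss i x) = tss i x].
Proof.
move=> ij; have dx := dim_tv x; have [kj|jk] := leqP k j.
  have eS z : tss j z = z by exact: tss_id.
  have eT z : ttt j z = z by exact: ttt_id.
  by split; rewrite ?eS ?eT.
have ijk : i <= j <= k by rewrite ij ltnW.
have d1 : dim (bsrc i x) = i by rewrite dim_bsrc // dx; lia.
have d2 : dim (btgt i x) = i by rewrite dim_btgt // dx; lia.
by split; apply: top_eq; rewrite /= ?(bsrc_unit_ge d1, bsrc_unit_ge d2, btgt_unit_ge d1, btgt_unit_ge d2) //
 -unit_from_iter.
Qed.

Lemma ttcp_le i (x y : top) : i < k -> ttt i x = tss i y ->
  tss i (tcp i x y) = tss i x /\ ttt i (tcp i x y) = ttt i y.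
Proof.
move=> ik c; have c' := tcomposable_top ik c; have e := tv_tcp ik c.
by split; apply: top_eq; rewrite /= -/(tv (tcp i x y)) e ?(bsrc_comp_le c') ?(btgt_comp_le c').
Qed.

Lemma ttcp_gt i j (x y : top) : i < k -> ttt i x = tss i y -> i < j ->
  tss j (tcp i x y) = tcp i (tss j x) (tss j y) /\
  ttt j (tcp i x y) = tcp i (ttt j x) (ttt j y).
Proof.
move=> ik c ij; have [dx dy] := (dim_tv x, dim_tv y).
have c' := tcomposable_top ik c; have e := tv_tcp ik c.
have [kj|jk] := leqP k j.
  have eS z : tss j z = z by exact: tss_id.
  have eT z : ttt j z = z by exact: ttt_id.
  by rewrite !eS !eT.
have [_ _ h1 h2] := tboundary_lt x (ltnW ij).
have [h3 h4 h5 h6] := tboundary_lt y (ltnW ij).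
have [h1' h2' h3' h4'] := tboundary_lt x (ltnW ij).
have cs : ttt i (tss j x) = tss i (tss j y) by rewrite h3 h4'.
have ct : ttt i (ttt j x) = tss i (ttt j y) by rewrite h2' h5.
have cc' : composable i (bsrc j x) (bsrc j y) /\ composable i (btgt j x) (btgt j y).
  have [_ _ eb] := c'; split; split; rewrite ?dim_bsrc ?dim_btgt ?dx ?dy ?(ltnW jk) //.
    by rewrite btgt_bsrc ?bsrc_bsrc // ?dx ?dy ?ij ?(ltnW ij) ltnW.
  by rewrite btgt_btgt ?bsrc_btgt // ?dx ?dy ?ij ?(ltnW ij) ltnW.
have [c1 c2] := cc'.
split; apply: top_eq; rewrite ?(tv_tcp ik cs) ?(tv_tcp ik ct) /= -/(tv (tcp i x y)) e.
  rewrite (bsrc_comp_gt c') ?dx ?ij ?(ltnW jk) //.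
  by apply: unit_from_comp; rewrite ?dim_bsrc ?dx ?(ltnW jk).
rewrite (btgt_comp_gt c') ?dx ?ij ?(ltnW jk) //.
by apply: unit_from_comp; rewrite ?dim_btgt ?dx ?(ltnW jk).
Qed.

Lemma tcp1 i (x : top) : i < k ->
  tcp i (tss i x) x = x /\ tcp i x (ttt i x) = x.
Proof.
move=> ik; have dx := dim_tv x.
have [h1 h2 h3 h4] := tboundary_ge x (leqnn i).
split; apply: top_eq; rewrite tv_tcp //.
  by rewrite /= comp_unitl.
by rewrite /= comp_unitr.
Qed.

Lemma tcpA i (x y z : top) : i < k -> ttt i x = tss i y -> ttt i y = tss i z ->
  tcp i x (tcp i y z) = tcp i (tcp i x y) z.
Proof.
move=> ik xy yz; have [s1 t1] := ttcp_le ik xy; have [s2 t2] := ttcp_le ik yz.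
apply: top_eq; rewrite !tv_tcp ?s2 ?t1 //; apply/esym.
by apply: (compA HC); exact: tcomposable_top.
Qed.

Lemma tcp_inter i j (x y z w : top) : i < j -> j < k ->
  ttt j x = tss j y -> ttt j z = tss j w -> ttt i x = tss i z ->
  tcp i (tcp j x y) (tcp j z w) = tcp j (tcp i x z) (tcp i y w).
Proof.
move=> ij jk xy zw xz; have ik := ltn_trans ij jk.
have [s1 t1] := ttcp_le jk xy; have [s2 t2] := ttcp_le jk zw.
have S a : tss i a = tss i (tss j a) by have [-> _ _ _] := tboundary_lt a (ltnW ij).
have T a : ttt i a = ttt i (ttt j a) by have [_ -> _ _] := tboundary_lt a (ltnW ij).
have ST a : tss i a = tss i (ttt j a) by have [_ _ /(_ ij)-> _] := tboundary_lt a (ltnW ij).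
have TS a : ttt i a = ttt i (tss j a) by have [_ _ _ /(_ ij)->] := tboundary_lt a (ltnW ij).
have yw : ttt i y = tss i w.
  by rewrite [LHS]TS -xy -T xz [LHS]ST zw -S.
have c1 : ttt i (tcp j x y) = tss i (tcp j z w).
  by rewrite [LHS]T t1 -T [RHS]S s2 -S yw -xz -[LHS]yw TS -xy -T.
have [s3 t3] := ttcp_gt ik xz ij; have [s4 t4] := ttcp_gt ik yw ij.
have c2 : ttt j (tcp i x z) = tss j (tcp i y w) by rewrite t3 s4 xy zw.
apply: top_eq; rewrite !tv_tcp //.
by apply: (interchange HC) => //; exact: tcomposable_top.
Qed.

Definition top_ocat : ocat k.
Proof.
apply: (@OCat k top tss ttt tcp tss_id ttt_id) => [i j x h|i j x h|i j x h|i j x h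
 |i j x h|i j x h|i j x h|i j x h|i x y ik c|i x y ik c|i j x y ik c ij|i j x y ik c ij
 |i x ik|i x ik||].
- by have [] := tboundary_lt x h.
- by have [] := tboundary_lt x h.
- by have [_ _ ->] := tboundary_lt x (ltnW h).
- by have [_ _ _ ->] := tboundary_lt x (ltnW h).
- by have [] := tboundary_ge x h.
- by have [] := tboundary_ge x h.
- by have [] := tboundary_ge x h.
- by have [] := tboundary_ge x h.
- by have [] := ttcp_le ik c.
- by have [] := ttcp_le ik c.
- by have [] := ttcp_gt ik c ij.
- by have [] := ttcp_gt ik c ij.
- by have [] := tcp1 x ik.
- by have [] := tcp1 x ik.
- exact: tcpA.
- exact: tcp_inter.
Defined.
End TopCells.

(* Y is freely generated over X by invertible (n+1)-cells [gn a], with inverses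
   [gi a]; [io] sends a cell to its unit. *)
Record free_over (n : nat) (X : ocat n) (Y : ocat n.+1) (A : Type)
    (bs bt : A -> X) := FreeOver {
  io : X -> Y;
  sf : Y -> X;
  tf : Y -> X;
  gn : A -> Y;
  gi : A -> Y;
  sf_io : forall x, sf (io x) = x;
  tf_io : forall x, tf (io x) = x;
  io_sf : forall z, io (sf z) = ss n z;
  io_tf : forall z, io (tf z) = tt n z;
  io_ss : forall i x, io (ss i x) = ss i (io x);
  io_tt : forall i x, io (tt i x) = tt i (io x);
  io_cp : forall i x y, i < n -> tt i x = ss i y ->
    io (x *[i] y) = io x *[i] io y;
  sf_gn : forall a, sf (gn a) = bs a;
  tf_gn : forall a, tf (gn a) = bt a;
  sf_gi : forall a, sf (gi a) = bt a;
  tf_gi : forall a, tf (gi a) = bs a;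
  gn_gi : forall a, gn a *[n] gi a = io (bs a);
  gi_gn : forall a, gi a *[n] gn a = io (bt a);
  fo_ind : forall P : Y -> Prop,
    (forall x, P (io x)) -> (forall a, P (gn a)) -> (forall a, P (gi a)) ->
    (forall i x y, i <= n -> tt i x = ss i y -> P x -> P y -> P (x *[i] y)) ->
    forall z, P z;
  fo_rec : forall (V : Type) (good : Y -> V -> Prop) (fU : X -> V)
      (fG fI : A -> V) (op : nat -> Y -> Y -> V -> V -> V),
    (forall x, good (io x) (fU x)) ->
    (forall a, good (gn a) (fG a)) ->
    (forall a, good (gi a) (fI a)) ->
    (forall i x y a b, i <= n -> tt i x = ss i y -> good x a -> good y b ->
      good (x *[i] y) (op i x y a b)) ->
    (forall i x a z, i <= n -> good x a -> io z = ss i x ->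
      op i (io z) x (fU z) a = a) ->
    (forall i x a z, i <= n -> good x a -> io z = tt i x ->
      op i x (io z) a (fU z) = a) ->
    (forall i x y z a b c, i <= n -> tt i x = ss i y -> tt i y = ss i z ->
      good x a -> good y b -> good z c ->
      op i (x *[i] y) z (op i x y a b) c = op i x (y *[i] z) a (op i y z b c)) ->
    (forall i x y, i < n -> tt i x = ss i y ->
      fU (x *[i] y) = op i (io x) (io y) (fU x) (fU y)) ->
    (forall i j x y z w a b c d, i < j -> j <= n ->
      tt j x = ss j y -> tt j z = ss j w -> tt i x = ss i z ->
      good x a -> good y b -> good z c -> good w d ->
      op i (x *[j] y) (z *[j] w) (op j x y a b) (op j z w c d) =
      op j (x *[i] z) (y *[i] w) (op i x z a c) (op i y w b d)) ->
    (forall a, op n (gn a) (gi a) (fG a) (fI a) = fU (bs a)) ->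
    (forall a, op n (gi a) (gn a) (fI a) (fG a) = fU (bt a)) ->
    exists F : Y -> V,
      [/\ forall x, F (io x) = fU x,
          forall a, F (gn a) = fG a,
          forall a, F (gi a) = fI a,
          forall i x y, i <= n -> tt i x = ss i y ->
            F (x *[i] y) = op i x y (F x) (F y) &
          forall x, good x (F x)]
}.

(** * The universal property of a free extension *)

Section FreeExt.
Context (k : nat) (C : strict_cat k) (A : cell_ext k C).
Let HC := strict_catP C.
Let X := top_ocat C.
Let Y := top_ocat (free_ext A).

Definition cl (t : term A) (h : wf t) : Y :=
  @Top _ (free_ext A) (inr (class (@wf_teq _ _ A) (exist _ t h))) erefl.

Lemma cl_eq (t u : term A) (ht : wf t) (hu : wf u) :
  (cl ht = cl hu) <-> teq t u.
Proof.
split=> [e|tu].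
  apply/(wf_teq_eq (exist _ t ht) (exist _ u hu)).
  by move/(congr1 (fun y : Y => if tv y is inr q then q else class _ (exist _ t ht))): e.
by apply: top_eq; congr inr; apply/(wf_teq_eq (exist _ t ht) (exist _ u hu)).
Qed.

Lemma clP (y : Y) : exists t (h : wf t), y = cl h.
Proof.
case: y => [[x|q] d]; first by have := dim_le HC x; rewrite (d : dim x = k.+1) ltnn.
exists (free_rep q), (wf_rep q); apply: top_eq => /=.
rewrite -[q in LHS]repK; congr (inr (class _ _)).
have E (s : wf_term A) (h : wf (proj1_sig s)) : s = exist _ _ h.
  by case: s h => t h1 h2; exact: eq_exist.
exact: E.
Qed.

Lemma rep_cl (t : term A) (h : wf t) : teq (free_rep (class (@wf_teq _ _ A) (exist _ t h))) t.
Proof.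
have := repK (class (@wf_teq _ _ A) (exist _ t h)).
by move=> /(wf_teq_eq (rep _) (exist _ t h)).
Qed.

Lemma wf_ssU i (t : term A) : wf t -> i <= k ->
  wf (Unit A (unit_from i k (bsrc i (tsrc t)))).
Proof. by move=> wt ik; case: (wf_unitl wt ik). Qed.

Lemma wf_ttU i (t : term A) : wf t -> i <= k ->
  wf (Unit A (unit_from i k (btgt i (ttgt t)))).
Proof. by move=> wt ik; case: (wf_unitr wt ik). Qed.

Lemma free_class_cl (t : term A) (h : wf t) z :
  free_class t z = inr (class (@wf_teq _ _ A) (exist _ t h)).
Proof.
rewrite /free_class; case: pselect => // h'; congr (inr (class _ _)).
exact: eq_exist.
Qed.

Lemma ss_cl i (t : term A) (h : wf t) (ik : i <= k) :
  ss i (cl h) = cl (wf_ssU h ik).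
Proof.
have [wr _ es _] := teq_wf (rep_cl h); have [d _ _] := wf_dim wr.
apply: top_eq; rewrite /= ext_bsrc_inr // ext_unit_fromS ?dim_bsrc ?d //.
have wU := wf_ssU wr ik; rewrite (free_class_cl wU).
by congr inr; apply/(wf_teq_eq (exist _ _ wU) (exist _ _ _)); rewrite /wf_teq /= -es; exact: teq_refl.
Qed.

Lemma tt_cl i (t : term A) (h : wf t) (ik : i <= k) :
  tt i (cl h) = cl (wf_ttU h ik).
Proof.
have [wr _ _ es] := teq_wf (rep_cl h); have [_ d _] := wf_dim wr.
apply: top_eq; rewrite /= ext_btgt_inr // ext_unit_fromS ?dim_btgt ?d //.
have wU := wf_ttU wr ik; rewrite (free_class_cl wU).
by congr inr; apply/(wf_teq_eq (exist _ _ wU) (exist _ _ _)); rewrite /wf_teq /= -es; exact: teq_refl.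
Qed.

Lemma comp_clP i (t u : term A) (ht : wf t) (hu : wf u) : i <= k ->
  (tt i (cl ht) = ss i (cl hu)) <-> wf (Comp i t u).
Proof.
move=> ik; have [_ dt _] := wf_dim ht; have [du _ _] := wf_dim hu.
rewrite (tt_cl _ ik) (ss_cl _ ik); split=> [/cl_eq/teq_wf[_ _ /= e _]|[_ _ [_ e]]].
  split=> //; split=> //; move/(congr1 (bsrc i)): e.
  by rewrite !bsrc_unit_from ?dim_btgt ?dim_bsrc ?dt ?du ?ik ?leqnn.
by apply/cl_eq; rewrite e; apply: teq_refl; exact: wf_ssU hu ik.
Qed.

Lemma cp_cl i (t u : term A) (ht : wf t) (hu : wf u) (h : wf (Comp i t u)) :
  cl ht *[i] cl hu = cl h.
Proof.
have ik : i <= k by case: h => _ _ [].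
apply: top_eq; rewrite tv_tcp ?ltnS //=; last exact/comp_clP.
have w : wf (Comp i (free_rep (class (@wf_teq _ _ A) (exist _ t ht)))
                    (free_rep (class (@wf_teq _ _ A) (exist _ u hu)))).
  have e : teq (Comp i t u) (Comp i (free_rep (class (@wf_teq _ _ A) (exist _ t ht)))
                    (free_rep (class (@wf_teq _ _ A) (exist _ u hu)))).
    by apply: teq_Comp => //; apply: teq_sym; exact: rep_cl.
  by have [] := teq_wf e.
rewrite (free_class_cl w); congr inr; apply/(wf_teq_eq (exist _ _ w) (exist _ _ h)).
by apply: teq_Comp => //; exact: rep_cl.
Qed.

Definition ext_io (x : X) : Y := @cl (Unit A (tv x)) (dim_tv x).
Definition ext_gn (a : A) : Y := @cl (Gen a) I.
Definition ext_gi (a : A) : Y := @cl (Inv a) I.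

Lemma dim_gtgt (a : A) : dim (gtgt a) = k.
Proof. by have [e [<- _]] := gsphere a. Qed.

Definition ext_bs (a : A) : X := Top (gsphere a).1.
Definition ext_bt (a : A) : X := Top (dim_gtgt a).

Lemma ext_boundary (y : Y) : exists b : X * X, forall t (h : wf t),
  y = cl h -> tv b.1 = tsrc t /\ tv b.2 = ttgt t.
Proof.
have [t [h ->]] := clP y; have [ds dt _] := wf_dim h.
exists (Top ds, Top dt) => t' h' /cl_eq /teq_wf[_ _ <- <-] //.
Qed.

Definition ext_sf (y : Y) : X := (projT1 (cid (ext_boundary y))).1.
Definition ext_tf (y : Y) : X := (projT1 (cid (ext_boundary y))).2.

Lemma tv_sf (t : term A) (h : wf t) : tv (ext_sf (cl h)) = tsrc t.
Proof. by rewrite /ext_sf; case: cid => b /= /(_ _ _ erefl)[]. Qed.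

Lemma tv_tf (t : term A) (h : wf t) : tv (ext_tf (cl h)) = ttgt t.
Proof. by rewrite /ext_tf; case: cid => b /= /(_ _ _ erefl)[]. Qed.

Lemma ext_io_eq (x : X) (t : term A) (h : wf t) : t = Unit A (tv x) ->
  ext_io x = cl h.
Proof. by move=> e; apply/cl_eq; rewrite e; apply: teq_refl; exact: dim_tv. Qed.

Lemma cl_irr (t u : term A) (h : wf t) (h' : wf u) : t = u -> cl h = cl h'.
Proof. by move=> e; apply/cl_eq; rewrite e; apply: teq_refl; rewrite -e. Qed.

(** The hypotheses on [op] are the defining relations of [teq], so that the evaluation of formal
    composites passes to classes. The target is no category: [op] may consult the cells being
    composed, and its laws are only asked of values tied to their cells by the invariant [good].
    Both contractions and brackets are obtained in this way. *)
Lemma ext_rec (V : Type) (good : Y -> V -> Prop) (fU : X -> V)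
      (fG fI : A -> V) (op : nat -> Y -> Y -> V -> V -> V) :
    (forall x, good (ext_io x) (fU x)) ->
    (forall a, good (ext_gn a) (fG a)) ->
    (forall a, good (ext_gi a) (fI a)) ->
    (forall i x y a b, i <= k -> tt i x = ss i y -> good x a -> good y b ->
      good (x *[i] y) (op i x y a b)) ->
    (forall i x a z, i <= k -> good x a -> ext_io z = ss i x ->
      op i (ext_io z) x (fU z) a = a) ->
    (forall i x a z, i <= k -> good x a -> ext_io z = tt i x ->
      op i x (ext_io z) a (fU z) = a) ->
    (forall i x y z a b c, i <= k -> tt i x = ss i y -> tt i y = ss i z ->
      good x a -> good y b -> good z c ->
      op i (x *[i] y) z (op i x y a b) c = op i x (y *[i] z) a (op i y z b c)) ->
    (forall i x y, i < k -> tt i x = ss i y ->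
      fU (x *[i] y) = op i (ext_io x) (ext_io y) (fU x) (fU y)) ->
    (forall i j x y z w a b c d, i < j -> j <= k ->
      tt j x = ss j y -> tt j z = ss j w -> tt i x = ss i z ->
      good x a -> good y b -> good z c -> good w d ->
      op i (x *[j] y) (z *[j] w) (op j x y a b) (op j z w c d) =
      op j (x *[i] z) (y *[i] w) (op i x z a c) (op i y w b d)) ->
    (forall a, op k (ext_gn a) (ext_gi a) (fG a) (fI a) = fU (ext_bs a)) ->
    (forall a, op k (ext_gi a) (ext_gn a) (fI a) (fG a) = fU (ext_bt a)) ->
    exists F : Y -> V,
      [/\ forall x, F (ext_io x) = fU x,
          forall a, F (ext_gn a) = fG a,
          forall a, F (ext_gi a) = fI a,
          forall i x y, i <= k -> tt i x = ss i y ->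
            F (x *[i] y) = op i x y (F x) (F y) &
          forall x, good x (F x)].
Proof.
move=> gU gG gI gC u1 u2 as_ uc int_ iv1 iv2.
(* A cell [y0] serves as value for ill-formed terms; if there is no top cell at all, the empty
   function will do. *)
have [[y0]|noY] := pselect (inhabited Y); last first.
  exists (fun y => False_rect V (noY (inhabits y))); split=> [x|a|a|i x|x]; exfalso.
  - exact: noY (inhabits (ext_io x)).
  - exact: noY (inhabits (ext_gn a)).
  - exact: noY (inhabits (ext_gi a)).
  - exact: noY (inhabits x).
  - exact: noY (inhabits x).
pose clt (t : term A) : Y := if pselect (wf t) is left h then cl h else y0.
pose topC (x : C) : X := if pselect (dim x = k) is left h then Top h else ext_sf y0.
pose ev := fix ev (t : term A) : V := match t with
  | Gen a => fG a | Inv a => fI a | Unit x => fU (topC x)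
  | Comp i t u => op i (clt t) (clt u) (ev t) (ev u) end.
have cltE t (h : wf t) : clt t = cl h.
  by rewrite /clt; case: pselect => // h'; exact: cl_irr.
have topCE (x : X) : topC (tv x) = x.
  rewrite /topC; case: pselect => [h|[]]; last exact: dim_tv.
  exact: top_eq.
have cltU x : dim x = k -> clt (Unit A x) = ext_io (topC x).
  move=> d; have w : wf (Unit A x) by [].
  by rewrite (cltE _ w) -[x in topC x]/(tv (Top d)) topCE; exact: cl_irr.
have cltC i t u : wf (Comp i t u) ->
    [/\ clt (Comp i t u) = clt t *[i] clt u, i <= k & tt i (clt t) = ss i (clt u)].
  move=> w; have [ht hu [ik _]] := w; rewrite (cltE _ w) (cltE _ ht) (cltE _ hu).
  by split; rewrite ?(cp_cl ht hu w) //; apply/comp_clP.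
have goodev t : wf t -> good (clt t) (ev t).
  elim: t => [a|a|x|i t IHt u IHu] w.
  - by rewrite (cltE _ w) (@cl_irr _ (Gen a) _ I) //; exact: gG.
  - by rewrite (cltE _ w) (@cl_irr _ (Inv a) _ I) //; exact: gI.
  - by rewrite cltU //; exact: gU.
  have [-> ik c] := cltC _ _ _ w; have [ht hu _] := w.
  by apply: gC; [| |exact: IHt|exact: IHu].
have clteq t u : teq t u -> clt t = clt u.
  by move=> e; have [ht hu _ _] := teq_wf e; rewrite (cltE _ ht) (cltE _ hu); apply/cl_eq.
have evteq t u : teq t u -> ev t = ev u.
  elim=> {t u} //.
  - by move=> t u v _ -> _ ->.
  - move=> i t t' u u' w tt' IHt uu' IHu /=.
    by rewrite IHt IHu (clteq _ _ tt') (clteq _ _ uu').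
  - move=> i t wt ik /=; rewrite cltU; last exact: wf_ssU wt ik.
    apply: u1 => //; first exact: goodev.
    rewrite (cltE _ wt) ss_cl -cltU; first exact: cltE.
    exact: wf_ssU wt ik.
  - move=> i t wt ik /=; rewrite cltU; last exact: wf_ttU wt ik.
    apply: u2 => //; first exact: goodev.
    rewrite (cltE _ wt) tt_cl -cltU; first exact: cltE.
    exact: wf_ttU wt ik.
  - move=> i t u v w1 w2 /=; have [ht hu _] := w1; have [_ hv _] := w2.
    have [e1 ik c1] := cltC _ _ _ w1; have [e2 _ c2] := cltC _ _ _ w2.
    by rewrite e1 e2; apply: as_ => //; exact: goodev.
  - move=> i x y c d /=; have [xy ix e] := c; have d' : dim y = k by rewrite -xy.
    rewrite !cltU //; rewrite d in ix.
    have cc' : tt i (Top d : X) = ss i (Top d' : X) by apply: top_eq; rewrite /= e.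
    rewrite -uc //; first by congr fU; rewrite -[x]/(tv (Top d)) -[y]/(tv (Top d')) -tv_tcp // !topCE.
    by rewrite -[x]/(tv (Top d)) -[y]/(tv (Top d')) !topCE.
  - move=> i j t u v w ij w1 w2 w3 /=; have [ht hu _] := w1; have [hv hw _] := w2.
    have [e1 jk c1] := cltC _ _ _ w1; have [e2 _ c2] := cltC _ _ _ w2.
    have [e3 ik c3] := cltC _ _ _ w3.
    have [_ w6 _ _] := teq_wf (teq_interchange ij w1 w2 w3); have [_ w4 _] := w6.
    have [e4 _ c4] := cltC _ _ _ w4.
    by rewrite e1 e2 e3 e4; apply: int_ => //; exact: goodev.
  - move=> a /=; rewrite (cltE (Gen a) I) (cltE (Inv a) I).
    by rewrite -[gsrc a]/(tv (ext_bs a)) topCE -iv1.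
  - move=> a /=; rewrite (cltE (Gen a) I) (cltE (Inv a) I).
    by rewrite -[gtgt a]/(tv (ext_bt a)) topCE -iv2.
have tm (y : Y) : exists t, forall u (h : wf u), y = cl h -> teq t u.
  by have [t [h ->]] := clP y; exists t => u h' /cl_eq.
pose F y := ev (projT1 (cid (tm y))).
have FE t (h : wf t) : F (cl h) = ev t.
  by rewrite /F; case: cid => u /= /(_ _ _ erefl)/evteq.
exists F; split.
- by move=> x; rewrite FE /= topCE.
- by move=> a; rewrite FE.
- by move=> a; rewrite FE.
- move=> i x y ik; have [t [ht ->]] := clP x; have [u [hu ->]] := clP y.
  move=> /(comp_clP _ _ ik) w.
  by rewrite (cp_cl ht hu w) !FE /= (cltE _ ht) (cltE _ hu).
- by move=> x; have [t [ht ->]] := clP x; rewrite FE -cltE; exact: goodev.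
Qed.

Definition ext_free_over : @free_over k X Y A ext_bs ext_bt.
Proof.
apply: (@FreeOver _ _ _ _ _ _ ext_io ext_sf ext_tf ext_gn ext_gi); last exact: ext_rec.
- by move=> x; apply: top_eq; rewrite tv_sf.
- by move=> x; apply: top_eq; rewrite tv_tf.
- move=> z; have [t [h ->]] := clP z; rewrite (ss_cl h (leqnn k)).
  apply: ext_io_eq; rewrite tv_sf /unit_from subnn bsrc_id //.
  by case: (wf_dim h).
- move=> z; have [t [h ->]] := clP z; rewrite (tt_cl h (leqnn k)).
  apply: ext_io_eq; rewrite tv_tf /unit_from subnn btgt_id //.
  by case: (wf_dim h).
- move=> i x; have [ik|ki] := leqP i k; first by rewrite (ss_cl _ ik); exact: ext_io_eq.
  by rewrite !ss_id // ltnW.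
- move=> i x; have [ik|ki] := leqP i k; first by rewrite (tt_cl _ ik); exact: ext_io_eq.
  by rewrite !tt_id // ltnW.
- move=> i x y ik c; have c' := tcomposable_top ik c.
  have e := teq_unit_comp A c' (dim_tv x).
  have [wl wr _ _] := teq_wf e; rewrite (cp_cl _ _ wr).
  transitivity (cl wl); last exact/cl_eq.
  by apply: ext_io_eq; rewrite -tv_tcp.
- by move=> a; apply: top_eq; rewrite tv_sf.
- by move=> a; apply: top_eq; rewrite tv_tf.
- by move=> a; apply: top_eq; rewrite tv_sf.
- by move=> a; apply: top_eq; rewrite tv_tf.
- move=> a; have e := teq_invr a; have [wl wr _ _] := teq_wf e.
  by rewrite (cp_cl _ _ wl); apply/cl_eq.
- move=> a; have e := teq_invl a; have [wl wr _ _] := teq_wf e.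
  by rewrite (cp_cl _ _ wl); apply/cl_eq.
move=> P pU pG pI pC z; have [t [h ->]] := clP z.
elim: t h => [a|a|x|i t IHt u IHu] h.
- by rewrite (@cl_irr _ (Gen a) _ I) //; exact: pG.
- by rewrite (@cl_irr _ (Inv a) _ I) //; exact: pI.
- by rewrite -(@ext_io_eq (Top (h : dim x = k))) //; exact: pU.
have [ht hu [ik _]] := h; rewrite -(cp_cl ht hu h).
by apply: pC => //; apply/comp_clP.
Defined.

Lemma src_top (y : Y) : src (tv y) = inl (tv (sf ext_free_over y)) :> free_ext A.
Proof.
have [t [h ->]] := clP y; have [_ _ e _] := teq_wf (rep_cl h).
by rewrite (tv_sf h) /= e.
Qed.

Lemma tgt_top (y : Y) : tgt (tv y) = inl (tv (tf ext_free_over y)) :> free_ext A.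
Proof.
have [t [h ->]] := clP y; have [_ _ _ e] := teq_wf (rep_cl h).
by rewrite (tv_tf h) /= e.
Qed.
End FreeExt.
#[global] Opaque ext_free_over.

(** * Inverses and conjugation *)

Section Inverses.
Context (n : nat) (X : ocat n).
Implicit Types x y z a b : X.

Definition isinv i x y : Prop :=
  [/\ ss i y = tt i x, tt i y = ss i x, x *[i] y = ss i x & y *[i] x = tt i x].

Definition inv i x : X :=
  if pselect (exists y, isinv i x y) is left h then projT1 (cid h) else x.

Lemma isinv_sym i x y : isinv i x y -> isinv i y x.
Proof. by case=> e1 e2 e3 e4; split; rewrite ?e1 ?e2. Qed.

Lemma isinv_uniq i x y z : i < n -> isinv i x y -> isinv i x z -> y = z.
Proof.
move=> hi [s1 t1 e1 e1'] [s2 t2 e2 e2'].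
by rewrite -(cpx1 y hi) t1 -e2 cpA ?e1' // -s2 cp1x.
Qed.

Lemma inv_eq i x y : i < n -> isinv i x y -> inv i x = y.
Proof.
move=> hi h; rewrite /inv; case: pselect => [h'|[]]; last by exists y.
by case: cid => z /= hz; exact: isinv_uniq hz h.
Qed.

Lemma invP i x : (exists y, isinv i x y) -> isinv i x (inv i x).
Proof. by move=> h; rewrite /inv; case: pselect => // h'; case: cid. Qed.

Lemma isinv_id i x : i < n -> ss i x = x -> isinv i x x.
Proof.
move=> hi e; have e' : tt i x = x by rewrite -e tssK.
by split; rewrite ?e ?e' // -{1}e cp1x.
Qed.

Lemma ss0_lt i j x y : tt i x = ss i y -> j < i -> ss j x = ss j y /\ tt j x = tt j y.
Proof.
move=> e ji; have h1 := ssss x (ltnW ji); have h2 := ssss y (ltnW ji).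
have h3 := tttt x (ltnW ji); have h4 := tttt y (ltnW ji).
by split; [rewrite -(sstt x ji) e h2|rewrite -h3 e ttss].
Qed.

Lemma ss_eq_lt i j x y : ss i x = ss i y -> j < i ->
  ss j x = ss j y /\ tt j x = tt j y.
Proof.
move=> e ji; have h1 := ssss x (ltnW ji); have h2 := ssss y (ltnW ji).
by rewrite -h1 e h2 -(ttss x ji) e ttss.
Qed.

Lemma ss_cp_lt i j x y : i < n -> tt i x = ss i y -> j < i ->
  ss j (x *[i] y) = ss j x /\ tt j (x *[i] y) = tt j x.
Proof.
move=> hi e ji; have [e1 e2] := ss0_lt e ji.
rewrite -(ssss (x *[i] y) (ltnW ji)) ss_cp // ssss ?(ltnW ji) //; split=> //.
by rewrite -(tttt (x *[i] y) (ltnW ji)) tt_cp // tttt ?(ltnW ji).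
Qed.

Lemma isinv_cp i x x' y y' : i < n -> tt i x = ss i y ->
  isinv i x x' -> isinv i y y' -> isinv i (x *[i] y) (y' *[i] x').
Proof.
move=> hi e [sx tx ex ex'] [sy ty ey ey'].
have c : tt i y' = ss i x' by rewrite ty sx.
split.
- by rewrite ss_cp // sy tt_cp.
- by rewrite tt_cp // tx ss_cp.
- rewrite ss_cp // -cpA ?ss_cp ?sy // [y *[i] _]cpA // ey -e -sx cp1x //.
have c' : tt i x' = ss i (x *[i] y) by rewrite ss_cp.
by rewrite tt_cp // -cpA // [x' *[i] _]cpA // ex' e cp1x.
Qed.

Lemma isinv_cp_lt i j x x' y y' : i < n -> j < i -> tt j x = ss j y ->
  isinv i x x' -> isinv i y y' -> isinv i (x *[j] y) (x' *[j] y').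
Proof.
move=> hi ji e [sx tx ex ex'] [sy ty ey ey'].
have hj := ltn_trans ji hi.
have [a1 a2] := ss0_lt (esym sx) ji; have [b1 b2] := ss0_lt (esym sy) ji.
have c : tt j x' = ss j y' by rewrite -a2 -b1.
split; rewrite ?(ss_cp_gt hj e ji) ?(tt_cp_gt hj e ji) ?(ss_cp_gt hj c ji) ?(tt_cp_gt hj c ji).
- by rewrite sx sy.
- by rewrite tx ty.
- by rewrite -(@cp_inter _ _ j i) // ex ey.
- by rewrite -(@cp_inter _ _ j i) // ex' ey'.
Qed.

(** The j-source of [y] is another inverse of [x], and inverses are unique. *)
Lemma isinv_fix i j x y : i < j -> i < n -> isinv i x y -> ss j x = x -> ss j y = y.
Proof.
move=> ij hi [sx tx ex ex'] e.
have e2 : tt j x = x by rewrite -e tssK.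
apply: (@isinv_uniq i x) => //; split.
- by rewrite ssss ?(ltnW ij).
- by rewrite ttss.
- by rewrite -[X in X *[i] _]e -ss_cp_gt // ex ssK // ltnW.
- by rewrite -[X in _ *[i] X]e -ss_cp_gt // ex' sttK // ltnW.
Qed.

Lemma fix_tt j x : ss j x = x -> tt j x = x.
Proof. by move=> e; rewrite -e tssK. Qed.

Lemma fix_le i j x : i <= j -> ss i x = x -> ss j x = x.
Proof. by move=> ij e; rewrite -e ssK. Qed.

Lemma cp_fix i x : i < n -> ss i x = x -> x *[i] x = x.
Proof. by move=> hi e; rewrite -{1}e cp1x. Qed.
End Inverses.
Arguments fix_le {n X} i {j x}.
Arguments fix_tt {n X j x}.

(** * Conjugation by invertible 2-cells *)

Section Conjugation.
Context (N : nat) (X : ocat N).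
Hypothesis N2 : 1 < N.
Hypothesis inv2 : forall a : X, ss 2 a = a -> exists y, isinv 1 a y.
Implicit Types x y z a b c : X.

Definition cj a b x : X := (inv 1 a *[1] x) *[1] b.

Lemma inv2P a : ss 2 a = a ->
  [/\ isinv 1 a (inv 1 a), ss 1 (inv 1 a) = tt 1 a, tt 1 (inv 1 a) = ss 1 a,
      a *[1] inv 1 a = ss 1 a & inv 1 a *[1] a = tt 1 a].
Proof. by move=> /inv2/invP h; have [] := h. Qed.

Lemma inv2_fix a j : ss 2 a = a -> 1 < j -> ss j (inv 1 a) = inv 1 a.
Proof.
move=> ha j1; have [h _ _ _ _] := inv2P ha.
by apply: isinv_fix h _ => //; exact: fix_le ha.
Qed.

Section Fits.
Context (a b x : X).
Hypotheses (ha : ss 2 a = a) (hb : ss 2 b = b).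
Hypotheses (xa : ss 1 x = ss 1 a) (xb : tt 1 x = ss 1 b).

Lemma cj_c1 : tt 1 (inv 1 a) = ss 1 x.
Proof. by have [_ _ -> _ _] := inv2P ha. Qed.

Lemma cj_c2 : tt 1 (inv 1 a *[1] x) = ss 1 b.
Proof. by rewrite tt_cp // cj_c1. Qed.

Lemma ss1_cj : ss 1 (cj a b x) = tt 1 a.
Proof.
by have [_ e _ _ _] := inv2P ha; rewrite !ss_cp ?cj_c1 ?cj_c2.
Qed.

Lemma tt1_cj : tt 1 (cj a b x) = tt 1 b.
Proof. by rewrite tt_cp ?cj_c2. Qed.

Lemma ss_cj j : 1 < j -> ss j (cj a b x) = cj a b (ss j x).
Proof.
move=> j1; have c1 := cj_c1; have c2 := cj_c2.
rewrite /cj ss_cp_gt // ss_cp_gt // inv2_fix //.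
by rewrite (fix_le 2 j1 hb).
Qed.

Lemma tt_cj j : 1 < j -> tt j (cj a b x) = cj a b (tt j x).
Proof.
move=> j1; have c1 := cj_c1; have c2 := cj_c2.
rewrite /cj tt_cp_gt // tt_cp_gt // (fix_tt (inv2_fix ha j1)).
by rewrite (fix_tt (fix_le 2 j1 hb)).
Qed.
End Fits.

Lemma cj_cp1 a b c x y : ss 2 a = a -> ss 2 b = b -> ss 2 c = c ->
  ss 1 x = ss 1 a -> tt 1 x = ss 1 b -> ss 1 y = ss 1 b -> tt 1 y = ss 1 c ->
  cj a b x *[1] cj b c y = cj a c (x *[1] y).
Proof.
move=> ha hb hc xa xb yb yc; have [_ sb tb eb _] := inv2P hb.
have [_ sa ta ea _] := inv2P ha.
have c1 := cj_c1 ha xa; have c2 := cj_c2 ha xa xb.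
have d1 := cj_c1 hb yb; have d2 := cj_c2 hb yb yc.
have xy : tt 1 x = ss 1 y by rewrite xb.
have e1 : tt 1 b = ss 1 (inv 1 b *[1] y) by rewrite ss_cp.
have e2 : tt 1 b = ss 1 (inv 1 b *[1] y *[1] c) by rewrite ss_cp.
have e3 : ss 1 (y *[1] c) = ss 1 y by rewrite ss_cp.
have e4 : tt 1 b = ss 1 (inv 1 b) by rewrite sb.
rewrite /cj -cpA // [b *[1] _]cpA // [b *[1] _]cpA // eb -yb cp1x //.
rewrite cpA // -?[_ *[1] x *[1] y]cpA //.
by rewrite tt_cp // xb yb.
Qed.

(** For the composition i > 1, the 2-cells [inv 1 a] and [b] are units, hence equal to their own
    i-composites; in this form the interchange of 1 and i applies. The same trick proves [cp_wh] and
    [wh_cp]. *)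
Lemma cj_cp i a b x y : 1 < i -> i < N -> ss 2 a = a -> ss 2 b = b ->
  ss 1 x = ss 1 a -> tt 1 x = ss 1 b -> tt i x = ss i y ->
  cj a b (x *[i] y) = cj a b x *[i] cj a b y.
Proof.
move=> i1 iN ha hb xa xb xy; have [sxy txy] := ss0_lt xy i1.
have ya : ss 1 y = ss 1 a by rewrite -sxy.
have yb : tt 1 y = ss 1 b by rewrite -txy.
have c1 := cj_c1 ha xa; have c2 := cj_c2 ha xa xb.
have d1 := cj_c1 ha ya; have d2 := cj_c2 ha ya yb.
have fa := inv2_fix ha i1; have fa' := fix_tt fa.
have fb := fix_le 2 i1 hb; have fb' := fix_tt fb.
rewrite /cj -{1}(cp_fix iN fa) (@cp_inter _ _ 1 i) // ?fa ?fa' //.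
rewrite -{1}(cp_fix iN fb) (@cp_inter _ _ 1 i) // ?fb ?fb' //.
by rewrite tt_cp_gt // ss_cp_gt // fa fa' xy.
Qed.

Lemma inv_cp a b : ss 2 a = a -> ss 2 b = b -> tt 1 a = ss 1 b ->
  inv 1 (a *[1] b) = inv 1 b *[1] inv 1 a.
Proof.
move=> ha hb ab; have [h1 _ _ _ _] := inv2P ha; have [h2 _ _ _ _] := inv2P hb.
by apply: inv_eq => //; exact: isinv_cp.
Qed.

Lemma cj_cj a b a' b' x : ss 2 a = a -> ss 2 b = b -> ss 2 a' = a' -> ss 2 b' = b' ->
  ss 1 x = ss 1 a' -> tt 1 x = ss 1 b' -> tt 1 a' = ss 1 a -> tt 1 b' = ss 1 b ->
  cj a b (cj a' b' x) = cj (a' *[1] a) (b' *[1] b) x.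
Proof.
move=> ha hb ha' hb' xa xb aa bb; have [_ sa ta _ _] := inv2P ha.
have [_ sa' ta' _ _] := inv2P ha'.
have c1 := cj_c1 ha' xa; have c2 := cj_c2 ha' xa xb.
have aa' : tt 1 (inv 1 a) = ss 1 (inv 1 a') by rewrite ta sa'.
have e1 : tt 1 (inv 1 a) = ss 1 (inv 1 a' *[1] x) by rewrite ss_cp.
have e2 : tt 1 (inv 1 a *[1] inv 1 a') = ss 1 x by rewrite tt_cp.
rewrite /cj (inv_cp ha' ha) // (@cpA N X 1 (inv 1 a)) // (@cpA N X 1 (inv 1 a)) //.
by rewrite -cpA // tt_cp // tt_cp.
Qed.

Lemma inv_fix1 (p : X) : ss 1 p = p -> inv 1 p = p.
Proof. by move=> hp; apply: inv_eq => //; exact: isinv_id. Qed.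

Lemma cj_id (p q : X) x : ss 1 p = p -> ss 1 q = q -> ss 1 x = p -> tt 1 x = q ->
  cj p q x = x.
Proof.
by move=> hp hq xp xq; rewrite /cj inv_fix1 // -{1}xp cp1x // -xq cpx1.
Qed.

Lemma cp_wh i x y (q : X) : 0 < i -> i < N -> ss 1 q = q -> tt i x = ss i y ->
  tt 0 x = ss 0 q -> (x *[i] y) *[0] q = (x *[0] q) *[i] (y *[0] q).
Proof.
move=> i0 iN /(fix_le _ i0) hq xy xq; have hq' := fix_tt hq.
by rewrite -{1}(cp_fix iN hq) cp_inter // hq.
Qed.

Lemma wh_cp i x y (q : X) : 0 < i -> i < N -> ss 1 q = q -> tt i x = ss i y ->
  tt 0 q = ss 0 x -> q *[0] (x *[i] y) = (q *[0] x) *[i] (q *[0] y).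
Proof.
move=> i0 iN /(fix_le _ i0) hq xy xq; have hq' := fix_tt hq.
by rewrite -{1}(cp_fix iN hq) cp_inter // hq.
Qed.

Lemma cj_wh a b x (q : X) : ss 2 a = a -> ss 2 b = b -> ss 1 x = ss 1 a -> tt 1 x = ss 1 b ->
  ss 1 q = q -> tt 0 x = ss 0 q ->
  cj a b x *[0] q = cj (a *[0] q) (b *[0] q) (x *[0] q).
Proof.
move=> ha hb xa xb hq xq; have N0 : 0 < N by lia.
have [h sa ta ea ea'] := inv2P ha.
have [_ tax] := ss_eq_lt xa (ltn0Sn 0).
have [_ taa] := ss0_lt (esym sa) (ltn0Sn 0).
have hq2 : tt 1 q = q by exact: fix_tt.
have aq : tt 0 a = ss 0 q by rewrite -tax.
have ei : inv 1 (a *[0] q) = inv 1 a *[0] q.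
  apply: inv_eq => //; apply: isinv_cp_lt => //; exact: isinv_id.
have c1 := cj_c1 ha xa; have c2 := cj_c2 ha xa xb.
have [s3 t3] := ss_cp_lt N2 c1 (ltn0Sn 0).
by rewrite /cj ei !cp_wh // ?t3 -taa.
Qed.
End Conjugation.

(** * Sections of the projection onto the presented category *)

(* [cls] is the projection of cells onto the arrows of the presented category;
   [lft u] is a normal form of u, and the 2-cell [sg u p] reduces the composite
   of [lft u] and of the 1-cell p to the normal form of their product. *)
Record cstr (C : category) (N : nat) (X : ocat N) := Cstr {
  cls : X -> arrow C;
  lft : arrow C -> X;
  sg : arrow C -> X -> X;
  N_gt1 : 1 < N;
  cls_ss : forall i x, 0 < i -> cls (ss i x) = cls x;
  cls_tt : forall i x, 0 < i -> cls (tt i x) = cls x;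
  cls_ss0 : forall x, cls (ss 0 x) = aid (asrc (cls x));
  cls_tt0 : forall x, cls (tt 0 x) = aid (atgt (cls x));
  cls_cp0 : forall x y, tt 0 x = ss 0 y ->
    cls (x *[0] y) = arrow_cmp (cls x) (cls y);
  cls_cc : forall x y, tt 0 x = ss 0 y <-> cc (cls x) (cls y);
  ss_lft : forall u, ss 1 (lft u) = lft u;
  cls_lft : forall u, cls (lft u) = u;
  ss2_sg : forall u x, ss 1 x = x -> cc u (cls x) -> ss 2 (sg u x) = sg u x;
  ss1_sg : forall u x, ss 1 x = x -> cc u (cls x) ->
    ss 1 (sg u x) = lft u *[0] x;
  tt1_sg : forall u x, ss 1 x = x -> cc u (cls x) ->
    tt 1 (sg u x) = lft (arrow_cmp u (cls x));
  sg_id : forall u x, ss 0 x = x -> cc u (cls x) -> sg u x = lft u;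
  sg_cp : forall u x y, ss 1 x = x -> ss 1 y = y -> cc u (cls x) ->
    tt 0 x = ss 0 y ->
    sg u (x *[0] y) = (sg u x *[0] y) *[1] sg (arrow_cmp u (cls x)) y;
  invertible : forall i (x : X), 0 < i < N -> ss i.+1 x = x -> exists y, isinv i x y
}.

Section CstrTheory.
Context (C : category) (N : nat) (X : ocat N) (S : cstr C X).
Implicit Types (x y z f g p q r : X) (u v w : arrow C).
Let N2 : 1 < N := N_gt1 S.
Let N0 : 0 < N := ltnW N2.

Lemma inv2 x : ss 2 x = x -> exists y, isinv 1 x y.
Proof. by apply: (invertible S); rewrite N2. Qed.

(** Conjugation makes this a loop: its 1-source and its 1-target are both the normal form of [u]
    followed by the class of [x]. *)
Definition rho u x : X :=
  cj (sg S u (ss 1 x)) (sg S u (tt 1 x)) (lft S u *[0] x).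

(** The right action of the 1-cell [q] on loops over the normal form of [w]: whiskering by [q], then
    conjugation by a reduction, which leads to loops over the normal form of [w] followed by [q]. *)
Definition act w q x : X := cj (sg S w q) (sg S w q) (x *[0] q).

Lemma tt_lft u : tt 1 (lft S u) = lft S u.
Proof. exact/fix_tt/ss_lft. Qed.

Lemma lft_comp u x : cc u (cls S x) -> tt 0 (lft S u) = ss 0 x.
Proof. by move=> ux; apply/(cls_cc S); rewrite cls_lft. Qed.

Lemma cls_cp i x y : 0 < i -> i < N -> tt i x = ss i y -> cls S (x *[i] y) = cls S x.
Proof. by move=> i0 iN e; rewrite -(cls_ss S _ i0) ss_cp // cls_ss. Qed.

Lemma ss1_ss1 x : ss 1 (ss 1 x) = ss 1 x. Proof. exact: ssss. Qed.
Lemma ss1_tt1 x : ss 1 (tt 1 x) = tt 1 x. Proof. exact: sttK. Qed.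

Section RhoBoundary.
Context (u : arrow C) (x : X).
Hypothesis ux : cc u (cls S x).

Lemma cc_ss1 : cc u (cls S (ss 1 x)). Proof. by rewrite cls_ss. Qed.
Lemma cc_tt1 : cc u (cls S (tt 1 x)). Proof. by rewrite cls_tt. Qed.

Lemma rho_fits : [/\ ss 2 (sg S u (ss 1 x)) = sg S u (ss 1 x),
  ss 2 (sg S u (tt 1 x)) = sg S u (tt 1 x),
  ss 1 (lft S u *[0] x) = ss 1 (sg S u (ss 1 x)) &
  tt 1 (lft S u *[0] x) = ss 1 (sg S u (tt 1 x))].
Proof.
have h1 := cc_ss1; have h2 := cc_tt1; have e := lft_comp ux.
split; rewrite ?ss2_sg ?ss1_sg ?ss1_ss1 ?ss1_tt1 //.
  by rewrite ss_cp_gt // ss_lft.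
by rewrite tt_cp_gt // tt_lft.
Qed.

Lemma ss1_rho : ss 1 (rho u x) = lft S (arrow_cmp u (cls S x)).
Proof.
have [h1 h2 h3 h4] := rho_fits.
by rewrite (ss1_cj N2 inv2) // tt1_sg ?cls_ss ?ss1_ss1.
Qed.

Lemma tt1_rho : tt 1 (rho u x) = lft S (arrow_cmp u (cls S x)).
Proof.
have [h1 h2 h3 h4] := rho_fits.
by rewrite (tt1_cj N2 inv2) // tt1_sg ?cls_tt ?ss1_tt1.
Qed.

Lemma ss_rho j : 1 < j -> ss j (rho u x) = rho u (ss j x).
Proof.
move=> j1; have [h1 h2 h3 h4] := rho_fits; have e := lft_comp ux.
rewrite (ss_cj N2 inv2) // /rho ss_cp_gt ?(ltnW j1) //.
by rewrite (fix_le 1 _ (ss_lft S u)) ?(ltnW j1) // ssss ?ttss // ltnW.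
Qed.

Lemma tt_rho j : 1 < j -> tt j (rho u x) = rho u (tt j x).
Proof.
move=> j1; have [h1 h2 h3 h4] := rho_fits; have e := lft_comp ux.
rewrite (tt_cj N2 inv2) // /rho tt_cp_gt ?(ltnW j1) //.
by rewrite (fix_tt (fix_le 1 _ (ss_lft S u))) ?(ltnW j1) // sstt ?tttt // ltnW.
Qed.
End RhoBoundary.

(** For i = 1 the two inner reductions cancel; for i > 1 both factors are conjugated by the same
    2-cells. *)
Lemma rho_cp i u x y : 0 < i -> i < N -> cc u (cls S x) -> tt i x = ss i y ->
  rho u (x *[i] y) = rho u x *[i] rho u y.
Proof.
move=> i0 iN ux xy; have uy : cc u (cls S y) by rewrite -(cls_ss S y i0) -xy cls_tt.
have [h1 h2 h3 h4] := rho_fits ux; have [g1 g2 g3 g4] := rho_fits uy.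
have ex := lft_comp ux; have ey := lft_comp uy.
move: i0; rewrite leq_eqVlt => /predU1P[e1|i1].
  subst i; rewrite /rho wh_cp ?ss_lft // ss_cp // tt_cp //.
  rewrite xy in h2 h4 *.
  by rewrite -(cj_cp1 N2 inv2 h1 h2 g2).
have [e1 e2] := ss0_lt xy i1; have [e3 e4] := ss_cp_lt iN xy i1.
rewrite /rho -e1 -e2 e3 e4.
have fi : ss i (lft S u) = lft S u by apply: (fix_le 1 _ (ss_lft S u)); exact: ltnW.
rewrite wh_cp ?ss_lft ?(ltnW i1) //.
by rewrite (cj_cp N2 inv2) // tt_cp_gt ?ss_cp_gt ?(ltnW i1) // fi (fix_tt fi) xy.
Qed.

Lemma cj_self (a : X) : ss 2 a = a -> cj a a (ss 1 a) = tt 1 a.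
Proof.
move=> ha; have [_ _ ta _ e] := inv2P inv2 ha.
by rewrite /cj -ta cpx1.
Qed.

Lemma rho_fix1 u p : ss 1 p = p -> cc u (cls S p) ->
  rho u p = lft S (arrow_cmp u (cls S p)).
Proof.
move=> hp up; rewrite /rho hp (fix_tt hp) -(ss1_sg hp up) cj_self ?ss2_sg //.
exact: tt1_sg.
Qed.

Section Act.
Context (w : arrow C) (q : X).
Hypotheses (hq : ss 1 q = q) (wq : cc w (cls S q)).

Definition loop v x : Prop := ss 1 x = lft S v /\ tt 1 x = lft S v.

Lemma loop_comp x : loop w x -> tt 0 x = ss 0 q.
Proof. by move=> [sx tx]; rewrite -(tttt x (leq0n 1)) tx (lft_comp wq). Qed.

Lemma act_fits x : loop w x ->
  [/\ ss 2 (sg S w q) = sg S w q, ss 1 (x *[0] q) = ss 1 (sg S w q) &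
      tt 1 (x *[0] q) = ss 1 (sg S w q)].
Proof.
move=> lx; have e := loop_comp lx; have [sx tx] := lx.
by rewrite ss2_sg // ss_cp_gt // tt_cp_gt // sx tx hq (fix_tt hq) ss1_sg.
Qed.

Lemma act_loop x : loop w x -> loop (arrow_cmp w (cls S q)) (act w q x).
Proof.
move=> lx; have [h1 h2 h3] := act_fits lx.
by split; rewrite ?(ss1_cj N2 inv2) ?(tt1_cj N2 inv2) // tt1_sg.
Qed.

Lemma ss_act x j : loop w x -> 1 < j -> ss j (act w q x) = act w q (ss j x).
Proof.
move=> lx j1; have [h1 h2 h3] := act_fits lx; have e := loop_comp lx.
rewrite (ss_cj N2 inv2) // /act ss_cp_gt ?(ltnW j1) //.
by rewrite (fix_le 1 _ hq) ?(ltnW j1).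
Qed.

Lemma tt_act x j : loop w x -> 1 < j -> tt j (act w q x) = act w q (tt j x).
Proof.
move=> lx j1; have [h1 h2 h3] := act_fits lx; have e := loop_comp lx.
rewrite (tt_cj N2 inv2) // /act tt_cp_gt ?(ltnW j1) //.
by rewrite (fix_tt (fix_le 1 _ hq)) ?(ltnW j1).
Qed.

Lemma act_cp i x y : 0 < i -> i < N -> loop w x -> loop w y -> tt i x = ss i y ->
  act w q (x *[i] y) = act w q x *[i] act w q y.
Proof.
move=> i0 iN lx ly xy; have [h1 h2 h3] := act_fits lx; have [g1 g2 g3] := act_fits ly.
have ex := loop_comp lx; have ey := loop_comp ly.
have fi : ss i q = q by exact: (fix_le 1 _ hq).
rewrite /act cp_wh //.
move: i0; rewrite leq_eqVlt => /predU1P[e1|i1].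
  by subst i; rewrite (cj_cp1 N2 inv2).
by rewrite (cj_cp N2 inv2) // tt_cp_gt ?ss_cp_gt ?(ltnW i1) // fi (fix_tt fi) xy.
Qed.

Lemma act_lft : act w q (lft S w) = lft S (arrow_cmp w (cls S q)).
Proof. by rewrite /act -ss1_sg // cj_self ?ss2_sg // tt1_sg. Qed.
End Act.

Lemma lft_loop w : loop w (lft S w).
Proof. by rewrite /loop ss_lft tt_lft. Qed.

Lemma rho_loop u x : cc u (cls S x) -> loop (arrow_cmp u (cls S x)) (rho u x).
Proof. by move=> ux; split; [exact: ss1_rho|exact: tt1_rho]. Qed.

Lemma act_id w q x : ss 0 q = q -> cc w (cls S q) -> loop w x -> act w q x = x.
Proof.
move=> hq wq lx; have e := loop_comp wq lx; have [sx tx] := lx.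
have h1 : ss 1 q = q by exact: (fix_le 0 _ hq).
rewrite /act sg_id //.
have -> : x *[0] q = x by rewrite -{1}hq -e cpx1.
by rewrite cj_id ?ss_lft.
Qed.

(** This is the cocycle identity [sg_cp] of the reductions, read through nested conjugations. *)
Lemma act_cmp w q r x : ss 1 q = q -> ss 1 r = r -> cc w (cls S q) -> tt 0 q = ss 0 r ->
  loop w x -> act (arrow_cmp w (cls S q)) r (act w q x) = act w (q *[0] r) x.
Proof.
move=> hq hr wq qr lx; have [h1 h2 h3] := act_fits hq wq lx; have e := loop_comp wq lx.
have wr : cc (arrow_cmp w (cls S q)) (cls S r) by apply/cc_cmpl => //; exact/(cls_cc S).
have lx' := act_loop hq wq lx; have e' := loop_comp wr lx'.
have [g1 g2 g3] := act_fits hr wr lx'.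
have hqr : ss 1 (q *[0] r) = q *[0] r by rewrite ss_cp_gt // hq hr.
have wqr : cc w (cls S (q *[0] r)).
  by rewrite cls_cp0 //; apply/cc_cmpr => //; exact/(cls_cc S).
have xqr : tt 0 (x *[0] q) = ss 0 r by rewrite tt_cp.
have sqr : tt 0 (sg S w q) = ss 0 r.
  have [_ <-] := ss_eq_lt h2 (ltn0Sn 0); exact: xqr.
have sqr2 : ss 2 (sg S w q *[0] r) = sg S w q *[0] r.
  by rewrite ss_cp_gt // h1 (fix_le 1 _ hr).
have f1 : ss 1 (x *[0] q *[0] r) = ss 1 (sg S w q *[0] r).
  by rewrite !ss_cp_gt // -?h2 ss_cp_gt.
have f2 : tt 1 (x *[0] q *[0] r) = ss 1 (sg S w q *[0] r).
  by rewrite tt_cp_gt // h3 ss_cp_gt // hr (fix_tt hr).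
have f3 : tt 1 (sg S w q *[0] r) = ss 1 (sg S (arrow_cmp w (cls S q)) r).
  by rewrite tt_cp_gt // tt1_sg // ss1_sg // (fix_tt hr).
rewrite {1}/act [in X in cj _ _ X]/act (cj_wh N2 inv2) // (cj_cj N2 inv2) // /act sg_cp //.
by rewrite cpA.
Qed.

Lemma cp0_splitl x y : tt 0 x = ss 0 y ->
  x *[0] y = (x *[0] ss 1 y) *[1] (tt 1 x *[0] y).
Proof.
move=> xy; have c : tt 0 x = ss 0 (ss 1 y) by rewrite ssss.
by rewrite -cp_inter ?cpx1 ?cp1x ?ss1_tt1 ?tssK.
Qed.

Lemma cp0_splitr x y : tt 0 x = ss 0 y ->
  x *[0] y = (ss 1 x *[0] y) *[1] (x *[0] tt 1 y).
Proof.
move=> xy; have c : tt 0 (ss 1 x) = ss 0 y by rewrite ttss.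
have c' : tt 1 (ss 1 x) = ss 1 x by exact: tssK.
by rewrite -cp_inter ?cpx1 ?cp1x ?ss1_tt1.
Qed.

(** The product of [a] and [y] can be cut with either factor first. Conjugation by [a], whiskered
    with the ends of [y], therefore moves [y] from the source of [a] to its target. *)
Lemma cj_slide (a : X) y : ss 2 a = a -> tt 0 a = ss 0 y ->
  cj (a *[0] ss 1 y) (a *[0] tt 1 y) (ss 1 a *[0] y) = tt 1 a *[0] y.
Proof.
move=> ha ay.
have c1 : tt 0 a = ss 0 (ss 1 y) by rewrite ssss.
have c2 : tt 0 (tt 1 a) = ss 0 y by rewrite tttt.
have c3 : tt 0 (ss 1 a) = ss 0 y by rewrite ttss.
have c4 : tt 0 a = ss 0 (tt 1 y) by rewrite sstt.
have h : ss 2 (a *[0] ss 1 y) = a *[0] ss 1 y by rewrite ss_cp_gt // ha ssK.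
have [_ si ti _ e] := inv2P inv2 h.
have s1 : ss 1 (a *[0] ss 1 y) = ss 1 a *[0] ss 1 y by rewrite ss_cp_gt // ssK.
have t1 : tt 1 (a *[0] ss 1 y) = tt 1 a *[0] ss 1 y by rewrite tt_cp_gt // tssK.
have f1 : tt 1 (inv 1 (a *[0] ss 1 y)) = ss 1 (ss 1 a *[0] y).
  by rewrite ti s1 ss_cp_gt // ssK.
have f2 : tt 1 (ss 1 a *[0] y) = ss 1 (a *[0] tt 1 y).
  by rewrite tt_cp_gt // ss_cp_gt // tssK // sttK.
have f3 : tt 1 (a *[0] ss 1 y) = ss 1 (tt 1 a *[0] y).
  by rewrite t1 ss_cp_gt // sttK.
have f4 : tt 1 (a *[0] ss 1 y) *[1] (tt 1 a *[0] y) = tt 1 a *[0] y.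
  by rewrite f3 cp1x.
by rewrite /cj -cpA // -cp0_splitr // (@cp0_splitl a y) // cpA // e f4.
Qed.

(** The product is cut into [x] followed by the source of [y], then the target of [x] followed by
    [y]. The reductions split accordingly by [sg_cp], and in the second piece [cj_slide] replaces
    the target of the composite of [lft S u] and [x] by a normal form. *)
Lemma rho_cp0 u x y : cc u (cls S x) -> tt 0 x = ss 0 y ->
  rho u (x *[0] y) = act (arrow_cmp u (cls S x)) (ss 1 y) (rho u x) *[1]
                     rho (arrow_cmp u (cls S x)) y.
Proof.
move=> ux xy; set v := arrow_cmp u (cls S x).
have vy : cc v (cls S y) by apply/cc_cmpl => //; exact/(cls_cc S).
have [h1 h2 h3 h4] := rho_fits ux; have [g1 g2 g3 g4] := rho_fits vy.
have ex := lft_comp ux; have ey := lft_comp vy.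
have us := cc_ss1 ux; have ut := cc_tt1 ux.
have xs : tt 0 (ss 1 x) = ss 0 (ss 1 y) by rewrite ttss // ssss.
have xt : tt 0 (tt 1 x) = ss 0 (tt 1 y) by rewrite tttt // sstt.
have sgs : sg S u (ss 1 (x *[0] y)) = (sg S u (ss 1 x) *[0] ss 1 y) *[1] sg S v (ss 1 y).
  by rewrite ss_cp_gt // sg_cp ?ss1_ss1 // cls_ss.
have sgt : sg S u (tt 1 (x *[0] y)) = (sg S u (tt 1 x) *[0] tt 1 y) *[1] sg S v (tt 1 y).
  by rewrite tt_cp_gt // sg_cp ?ss1_tt1 // cls_tt.
have ts : tt 0 (sg S u (ss 1 x)) = ss 0 (ss 1 y).
  by have [_ <-] := ss_eq_lt h3 (ltn0Sn 0); rewrite tt_cp // xy ssss.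
have tT : tt 0 (sg S u (tt 1 x)) = ss 0 (ss 1 y).
  by have [_ <-] := ss0_lt h4 (ltn0Sn 0); rewrite tt_cp // xy ssss.
have tT' : tt 0 (sg S u (tt 1 x)) = ss 0 (tt 1 y) by rewrite tT ssss // sstt.
have k1 : ss 2 (sg S u (ss 1 x) *[0] ss 1 y) = sg S u (ss 1 x) *[0] ss 1 y.
  by rewrite ss_cp_gt // h1 ssK.
have k2 : ss 2 (sg S u (tt 1 x) *[0] tt 1 y) = sg S u (tt 1 x) *[0] tt 1 y.
  by rewrite ss_cp_gt // h2 sttK.
have k3 : ss 2 (sg S u (tt 1 x) *[0] ss 1 y) = sg S u (tt 1 x) *[0] ss 1 y.
  by rewrite ss_cp_gt // h2 ssK.
have xy2 : tt 0 (lft S u *[0] x) = ss 0 y by rewrite tt_cp.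
have xy3 : tt 0 (lft S u *[0] x) = ss 0 (ss 1 y) by rewrite xy2 ssss.
have xy4 : tt 0 (tt 1 (lft S u *[0] x)) = ss 0 y by rewrite tttt.
have b1 : ss 1 (lft S u *[0] x *[0] y) = ss 1 (sg S u (ss 1 x) *[0] ss 1 y).
  by rewrite ss_cp_gt // h3 ss_cp_gt // ss1_ss1.
have b2 : tt 1 (lft S u *[0] x *[0] y) = ss 1 (sg S u (tt 1 x) *[0] tt 1 y).
  by rewrite tt_cp_gt // h4 ss_cp_gt // sttK.
have c1 : tt 1 (sg S u (ss 1 x) *[0] ss 1 y) = ss 1 (sg S v (ss 1 y)).
  by rewrite tt_cp_gt // tt1_sg ?ss1_ss1 // tssK // ss1_sg ?ss1_ss1 ?cls_ss.
have c2 : tt 1 (sg S u (tt 1 x) *[0] tt 1 y) = ss 1 (sg S v (tt 1 y)).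
  by rewrite tt_cp_gt // tt1_sg ?ss1_tt1 // ttK // ss1_sg ?ss1_tt1 ?cls_tt.
rewrite /rho sgs sgt cpA // -(cj_cj N2 inv2) //.
have E1 : cj (sg S u (ss 1 x) *[0] ss 1 y) (sg S u (tt 1 x) *[0] ss 1 y)
    (lft S u *[0] x *[0] ss 1 y) = rho u x *[0] ss 1 y.
  by rewrite /rho (cj_wh N2 inv2) ?ss1_ss1.
have E2 : cj (sg S u (tt 1 x) *[0] ss 1 y) (sg S u (tt 1 x) *[0] tt 1 y)
    (tt 1 (lft S u *[0] x) *[0] y) = lft S v *[0] y.
  by rewrite h4 cj_slide // ?tT ?ssss // tt1_sg ?ss1_tt1 // cls_tt.
have E : cj (sg S u (ss 1 x) *[0] ss 1 y) (sg S u (tt 1 x) *[0] tt 1 y)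
    (lft S u *[0] x *[0] y) = (rho u x *[0] ss 1 y) *[1] (lft S v *[0] y).
  rewrite (@cp0_splitl (lft S u *[0] x) y) // -(cj_cp1 N2 inv2 k1 k3 k2) ?E1 ?E2 //.
  - by rewrite ss_cp_gt // h3 ss_cp_gt // ss1_ss1.
  - by rewrite tt_cp_gt // h4 ss_cp_gt // ssK // tssK.
  - by rewrite ss_cp_gt // h4 ss_cp_gt // ssK // ssss.
  - by rewrite tt_cp_gt // h4 ss_cp_gt // sttK // tssK.
have lr := rho_loop ux.
have ccq : cc v (cls S (ss 1 y)) by exact: cc_ss1.
have [m1 m2 m3] := act_fits (ss1_ss1 y) ccq lr.
by rewrite E /act /rho -(cj_cp1 N2 inv2 m1 m1 g2).
Qed.

(** Both sides are conjugates, by the same reductions, of one product of [x] and [g], cut along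
    [cp0_splitl] or along [cp0_splitr]. *)
Lemma act_rho_comm w x g : cc w (cls S g) -> loop w x ->
  act w (ss 1 g) x *[1] rho w g = rho w g *[1] act w (tt 1 g) x.
Proof.
move=> wg lx; have [h1 h2 h3 h4] := rho_fits wg; have [sx tx] := lx.
have e := lft_comp wg.
have [m1 m2 m3] := act_fits (ss1_ss1 g) (cc_ss1 wg) lx.
have [m4 m5 m6] := act_fits (ss1_tt1 g) (cc_tt1 wg) lx.
have xg : tt 0 x = ss 0 g by rewrite -(tttt x (leq0n 1)) tx.
rewrite /act /rho (cj_cp1 N2 inv2 m1 m1 h2) // (cj_cp1 N2 inv2 h1 h2 m4) //.
by rewrite -{1}tx -cp0_splitl // -{1}sx -cp0_splitr.
Qed.
End CstrTheory.

(** * Transport of the structure along a free extension *)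

Section FreeOver.
Context (n : nat) (X : ocat n) (Y : ocat n.+1) (A : Type) (bs bt : A -> X).
Context (F : free_over Y bs bt).
Implicit Types (x : X) (y z : Y).

Lemma io_inj : injective (io F).
Proof. by move=> x x' e; rewrite -(sf_io F x) e sf_io. Qed.

Lemma io_sfK i y : i <= n -> ss i y = y -> io F (sf F y) = y.
Proof. by move=> ik e; rewrite io_sf; exact: fix_le e. Qed.

Lemma sf_ss i y : i <= n -> sf F (ss i y) = ss i (sf F y).
Proof. by move=> ik; apply: io_inj; rewrite io_sf io_ss io_sf ssK // ssss. Qed.

Lemma tf_tt i y : i <= n -> tf F (tt i y) = tt i (tf F y).
Proof. by move=> ik; apply: io_inj; rewrite io_tf io_tt io_tf ttK // tttt. Qed.

Lemma sf_tt i y : i < n -> sf F (tt i y) = tt i (sf F y).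
Proof. by move=> ik; apply: io_inj; rewrite io_sf io_tt io_sf ttss // sttK // ltnW. Qed.

Lemma tf_ss i y : i < n -> tf F (ss i y) = ss i (tf F y).
Proof. by move=> ik; apply: io_inj; rewrite io_tf io_ss io_tf sstt // tssK // ltnW. Qed.

Lemma sf_comp i y z : i < n -> tt i y = ss i z -> tt i (sf F y) = ss i (sf F z).
Proof. by move=> ik e; rewrite -sf_tt // e sf_ss // ltnW. Qed.

Lemma tf_comp i y z : i < n -> tt i y = ss i z -> tt i (tf F y) = ss i (tf F z).
Proof. by move=> ik e; rewrite -tf_ss // -e tf_tt // ltnW. Qed.

Lemma io_comp i x x' : tt i x = ss i x' -> tt i (io F x) = ss i (io F x').
Proof. by move=> e; rewrite -io_tt e io_ss. Qed.

Lemma sf_cp i y z : i < n -> tt i y = ss i z -> sf F (y *[i] z) = sf F y *[i] sf F z.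
Proof.
move=> ik e; apply: io_inj; rewrite io_sf io_cp //; last exact: sf_comp.
by rewrite !io_sf ss_cp_gt // ltnW.
Qed.

Lemma tf_cp i y z : i < n -> tt i y = ss i z -> tf F (y *[i] z) = tf F y *[i] tf F z.
Proof.
move=> ik e; apply: io_inj; rewrite io_tf io_cp //; last exact: tf_comp.
by rewrite !io_tf tt_cp_gt // ltnW.
Qed.

Lemma sf_cpn y z : tt n y = ss n z -> sf F (y *[n] z) = sf F y.
Proof. by move=> e; apply: io_inj; rewrite !io_sf ss_cp. Qed.

Lemma tf_cpn y z : tt n y = ss n z -> tf F (y *[n] z) = tf F z.
Proof. by move=> e; apply: io_inj; rewrite !io_tf tt_cp. Qed.

Lemma sftf_comp y z : (tf F y = sf F z) <-> (tt n y = ss n z).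
Proof.
by rewrite -(io_tf F) -(io_sf F); split=> [->|/io_inj].
Qed.

Lemma ssn_io x : ss n (io F x) = io F x.
Proof. by rewrite -(io_sf F) sf_io. Qed.

Lemma ttn_io x : tt n (io F x) = io F x.
Proof. by rewrite -(io_tf F) tf_io. Qed.

Lemma ssn_gn a : ss n (gn F a) = io F (bs a). Proof. by rewrite -(io_sf F) sf_gn. Qed.
Lemma ttn_gn a : tt n (gn F a) = io F (bt a). Proof. by rewrite -(io_tf F) tf_gn. Qed.
Lemma ssn_gi a : ss n (gi F a) = io F (bt a). Proof. by rewrite -(io_sf F) sf_gi. Qed.
Lemma ttn_gi a : tt n (gi F a) = io F (bs a). Proof. by rewrite -(io_tf F) tf_gi. Qed.

Lemma isinv_gn a : isinv n (gn F a) (gi F a).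
Proof. by split; rewrite ?ssn_gn ?ttn_gn ?ssn_gi ?ttn_gi ?gn_gi ?gi_gn. Qed.

Lemma isinv_io i x x' : i < n -> isinv i x x' -> isinv i (io F x) (io F x').
Proof.
move=> ik [e1 e2 e3 e4]; split; rewrite -?io_ss -?io_tt ?e1 ?e2 //.
  by rewrite -io_cp // e3.
by rewrite -io_cp // e4.
Qed.

(** At the top level, units and generators are invertible, and composites inherit this property; for
    i < n, the cell comes from [X]. *)
Lemma free_invertible : 0 < n ->
  (forall i x, 0 < i < n -> ss i.+1 x = x -> exists x', isinv i x x') ->
  forall i y, 0 < i < n.+1 -> ss i.+1 y = y -> exists y', isinv i y y'.
Proof.
move=> n0 IH i y /andP[i0]; rewrite ltnS leq_eqVlt => /predU1P[->|ik] e.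
  elim/(@fo_ind _ _ _ _ _ _ F): y {e} => [x|a|a|j x y jn c [x' hx] [y' hy]].
  - by exists (io F x); apply: isinv_id; rewrite ?ssn_io.
  - by exists (gi F a); exact: isinv_gn.
  - by exists (gn F a); apply/isinv_sym/isinv_gn.
  move: jn; rewrite leq_eqVlt => /predU1P[ej|jn]; last first.
    by exists (x' *[j] y'); apply: isinv_cp_lt.
  by subst j; exists (y' *[n] x'); apply: isinv_cp.
have [x' hx'] : exists x', isinv i (sf F y) x'.
  by apply: IH; rewrite ?i0 // -sf_ss // e.
by exists (io F x'); rewrite -(@io_sfK i.+1 y) //; exact: isinv_io.
Qed.
End FreeOver.

Section CstrFree.
Context (C : category) (n : nat) (X : ocat n) (Y : ocat n.+1).
Context (A : Type) (bs bt : A -> X) (F : free_over Y bs bt) (S : cstr C X).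
Let n1 : 1 < n := N_gt1 S.
Let n0 : 0 < n := ltnW n1.

(** Classes, normal forms and reductions live in dimensions at most 2, hence already in [X]; the new
    top cells only call for [free_invertible]. *)
Definition cstr_free : cstr C Y.
Proof.
apply: (@Cstr C n.+1 Y (fun y => cls S (sf F y)) (fun u => io F (lft S u))
  (fun u y => io F (sg S u (sf F y)))).
- exact: ltnW.
- move=> i y i0; have [ik|ki] := leqP i n; last by rewrite ss_id.
  by rewrite sf_ss // cls_ss.
- move=> i y i0; have [ik|ki] := ltnP i n; first by rewrite sf_tt // cls_tt.
  move: ki; rewrite leq_eqVlt => /predU1P[<-|ki]; last by rewrite tt_id.
  have n2 : 1 < n.-1.+1 by lia.
  rewrite -(cls_ss S (sf F (tt n y)) (ltn0Sn 0)) -sf_ss; last exact: ltnW.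
  rewrite sstt // sf_ss ?cls_ss //; exact: ltnW.
- by move=> y; rewrite sf_ss // cls_ss0.
- by move=> y; rewrite sf_tt ?cls_tt0.
- by move=> y z e; rewrite sf_cp ?cls_cp0 //; exact: sf_comp.
- move=> y z; rewrite -cls_cc; split=> [e|e].
    exact: sf_comp.
  by rewrite -(ttss y n0) -(io_sf F) -(io_tt F) e (io_ss F) io_sf ssss.
- by move=> u; rewrite -io_ss ss_lft.
- by move=> u; rewrite sf_io cls_lft.
- move=> u y e c; rewrite -io_ss ss2_sg // -sf_ss ?e //; exact: ltnW.
- move=> u y e c; rewrite -io_ss ss1_sg //; last by rewrite -sf_ss ?e //; exact: ltnW.
  rewrite io_cp ?(@io_sfK _ _ _ _ _ _ F 1) // ?(ltnW n1) //.
  exact: lft_comp.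
- by move=> u y e c; rewrite -io_tt tt1_sg // -sf_ss ?e //; exact: ltnW.
- by move=> u y e c; rewrite sg_id // -sf_ss ?e.
- move=> u y z hy hz c e.
  have hy' : ss 1 (sf F y) = sf F y by rewrite -sf_ss ?hy.
  have hz' : ss 1 (sf F z) = sf F z by rewrite -sf_ss ?hz.
  have e' := sf_comp F n0 e.
  have s1 := ss1_sg hy' c; have t1 := tt1_sg hy' c.
  have cz : cc (arrow_cmp u (cls S (sf F y))) (cls S (sf F z)).
    by apply/cc_cmpl => //; exact/(cls_cc S).
  have c0 : tt 0 (sg S u (sf F y)) = ss 0 (sf F z).
    by rewrite -(tttt _ (leq0n 1)) t1 (lft_comp cz).
  rewrite sf_cp // sg_cp // io_cp //; last first.
    by rewrite tt_cp_gt // t1 ss1_sg // (fix_tt hz').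
  by rewrite io_cp // (@io_sfK _ _ _ _ _ _ F 1 z).
- by apply: (free_invertible F); [exact: ltnW|exact: (invertible S)].
Defined.

Let S' := cstr_free.

Lemma cls_io x : cls S' (io F x) = cls S x.
Proof. by rewrite /= sf_io. Qed.

Lemma sg_io u x : sg S' u (io F x) = io F (sg S u x).
Proof. by rewrite /= sf_io. Qed.

Lemma lft_io u : lft S' u = io F (lft S u).
Proof. by []. Qed.

Lemma cj_io (a b x : X) : ss 2 a = a -> ss 2 b = b -> ss 1 x = ss 1 a ->
  tt 1 x = ss 1 b -> cj (io F a) (io F b) (io F x) = io F (cj a b x).
Proof.
move=> ha hb xa xb; have [h sa ta _ _] := inv2P (inv2 S) ha.
have e : inv 1 (io F a) = io F (inv 1 a).
  by apply: inv_eq; [exact: ltnW|exact: isinv_io].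
rewrite /cj e io_cp // ?io_cp // ?tt_cp ?ta //.
Qed.

Lemma rho_io u x : cc u (cls S x) -> rho S' u (io F x) = io F (rho S u x).
Proof.
move=> ux; have [h1 h2 h3 h4] := rho_fits ux.
rewrite /rho -io_ss -io_tt !sg_io lft_io -io_cp; first exact: cj_io.
  exact: ltnW.
exact: lft_comp.
Qed.

Lemma act_io w q x : ss 1 q = q -> cc w (cls S q) -> loop S w x ->
  act S' w (io F q) (io F x) = io F (act S w q x).
Proof.
move=> hq wq lx; have [h1 h2 h3] := act_fits hq wq lx.
rewrite /act !sg_io -io_cp; first exact: cj_io.
  exact: ltnW.
exact: (loop_comp wq lx).
Qed.

Lemma loop_io w x : loop S w x -> loop S' w (io F x).
Proof. by move=> [e1 e2]; rewrite /loop -io_ss -io_tt e1 e2. Qed.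
End CstrFree.

(** * Commutation of loops *)

Section Commutation.
Context (C : category) (N : nat) (X : ocat N) (S : cstr C X).
Hypothesis N3 : 2 < N.
Implicit Types (x y z c e : X).
Let N2 : 1 < N := ltnW N3.

(* Eckmann-Hilton: z and b act in complementary directions. *)
Lemma act_comm0 v z b c : loop S v z -> tt 2 z = lft S v ->
  cc v (cls S c) -> ss 2 b = rho S v c ->
  act S v (ss 1 c) z *[1] b = b *[1] act S v (tt 1 c) z.
Proof.
move=> lz tz vc sb; set v' := arrow_cmp v (cls S c).
have ccq := cc_ss1 vc; have ccq' := cc_tt1 vc.
have hq := ss1_ss1 c; have hq' := ss1_tt1 c.
have lq := act_loop hq ccq lz; have lq' := act_loop hq' ccq' lz.
rewrite cls_ss // in lq; rewrite cls_tt // in lq'.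
have [lq1 lq2] := lq; have [lq1' lq2'] := lq'.
have t2 : tt 2 (act S v (ss 1 c) z) = lft S v'.
  by rewrite tt_act // tz act_lft // cls_ss.
have t2' : tt 2 (act S v (tt 1 c) z) = lft S v'.
  by rewrite tt_act // tz act_lft // cls_tt.
have [r1 r2] := rho_loop vc.
have [b1 b2] : ss 1 b = lft S v' /\ tt 1 b = lft S v'.
  by rewrite -(ssss b (leqnSn 1)) -(ttss b (ltnSn 1)) sb.
have s2b : tt 2 (ss 2 b) = ss 2 b by exact: tssK.
have L2 : ss 2 (lft S v') = lft S v' by exact: (fix_le 1 _ (ss_lft S _)).
have eb : rho S v c *[2] b = b by rewrite -sb cp1x.
have ez : act S v (ss 1 c) z *[2] lft S v' = act S v (ss 1 c) z by rewrite -t2 cpx1.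
have ez' : act S v (tt 1 c) z *[2] lft S v' = act S v (tt 1 c) z by rewrite -t2' cpx1.
have cr : tt 2 (rho S v c) = ss 2 b by rewrite -sb s2b.
(* Both sides are padded with units of the composition 2. Interchange then leaves the commutation of
   [z] with the 2-cell [rho S v c], which is [act_rho_comm]. *)
transitivity ((act S v (ss 1 c) z *[2] lft S v') *[1] (rho S v c *[2] b)).
  by rewrite ez eb.
transitivity ((rho S v c *[2] b) *[1] (act S v (tt 1 c) z *[2] lft S v')); last first.
  by rewrite ez' eb.
rewrite !(@cp_inter _ _ 1 2) ?L2 ?t2 ?t2' ?lq2 ?lq1' ?r1 ?r2 // act_rho_comm //.
by rewrite -{1}b1 cp1x // -b2 cpx1.
Qed.

Lemma isinv_act i v q z z' : 1 < i -> i < N -> ss 1 q = q -> cc v (cls S q) ->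
  loop S v z -> isinv i z z' -> isinv i (act S v q z) (act S v q z').
Proof.
move=> i1 iN hq vq lz [e1 e2 e3 e4].
have lz' : loop S v z'.
  have [sz tz] := lz; have [a1 a2] := ss0_lt (esym e1) i1.
  by rewrite /loop -a1 -a2.
have i0 : 0 < i by exact: ltnW.
split.
- by rewrite ss_act // e1 tt_act.
- by rewrite tt_act // e2 ss_act.
- by rewrite -act_cp // e3 ss_act.
- by rewrite -act_cp // e4 tt_act.
Qed.

(** The loop [k] leads from the 2-target of [z] to an identity, so [act_comm0] applies to [z *[2]
    k]. As the 2-target of [b] is [rho S v e], the loop [k] itself commutes with it by
    [act_rho_comm]; the resulting factor [Z] is invertible and is cancelled. *)
Lemma act_comm v z b c e k : loop S v z ->
  loop S v k -> tt 2 z = ss 2 k -> tt 2 k = lft S v -> (exists k', isinv 2 k k') ->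
  cc v (cls S c) -> ss 2 b = rho S v c -> ss 2 e = e ->
  ss 1 e = ss 1 c -> tt 1 e = tt 1 c -> tt 2 b = rho S v e ->
  act S v (ss 1 c) z *[1] b = b *[1] act S v (tt 1 c) z.
Proof.
move=> lz lk zk tk [k' hk] vc sb he e1 e2 tb.
have ve : cc v (cls S e) by rewrite -(cls_ss S e (ltn0Sn 0)) e1 cls_ss.
have ccq := cc_ss1 vc; have ccq' := cc_tt1 vc.
have hq := ss1_ss1 c; have hq' := ss1_tt1 c.
have [z1 z2] := lz; have [k1 k2] := lk.
have lzk : loop S v (z *[2] k).
  by have [a1 a2] := ss_cp_lt N3 zk (ltnSn 1); rewrite /loop a1 a2.
have tzk : tt 2 (z *[2] k) = lft S v by rewrite tt_cp.
have K := act_comm0 lzk tzk vc sb.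
have re : act S v (ss 1 c) k *[1] rho S v e = rho S v e *[1] act S v (tt 1 c) k.
  by rewrite -e1 -e2 act_rho_comm.
have lq := act_loop hq ccq lz; have lq' := act_loop hq' ccq' lz.
have lk1 := act_loop hq ccq lk; have lk1' := act_loop hq' ccq' lk.
rewrite cls_ss // in lq lk1; rewrite cls_tt // in lq' lk1'.
have [lq1 lq2] := lq; have [lq1' lq2'] := lq'.
have [lk2 lk3] := lk1; have [lk2' lk3'] := lk1'.
have [r1 r2] := rho_loop vc.
have [b1 b2] : ss 1 b = lft S (arrow_cmp v (cls S c)) /\ tt 1 b = lft S (arrow_cmp v (cls S c)).
  by rewrite -(ssss b (leqnSn 1)) -(ttss b (ltnSn 1)) sb.
have s2e : ss 2 (rho S v e) = rho S v e by rewrite ss_rho // he.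
have [re1 re2] := rho_loop ve.
have clse : cls S e = cls S c by rewrite -(cls_ss S e (ltn0Sn 0)) e1 cls_ss.
rewrite clse in re1 re2.
have cz : tt 2 (act S v (ss 1 c) z) = ss 2 (act S v (ss 1 c) k).
  by rewrite tt_act // ss_act // zk.
have cz' : tt 2 (act S v (tt 1 c) z) = ss 2 (act S v (tt 1 c) k).
  by rewrite tt_act // ss_act // zk.
have cb : b *[2] rho S v e = b by rewrite -tb cpx1.
have P : (act S v (ss 1 c) z *[1] b) *[2] (act S v (ss 1 c) k *[1] rho S v e) =
         (b *[1] act S v (tt 1 c) z) *[2] (rho S v e *[1] act S v (tt 1 c) k).
  rewrite -cp_inter // ?s2e // ?lq2 ?b1 // cb -act_cp //.
  by rewrite -cp_inter // ?s2e // ?b2 // cb -act_cp.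
rewrite re in P.
have hk' := isinv_act (ltnSn 1) N3 hq' ccq' lk hk.
have hr := isinv_id N3 s2e.
have crk : tt 1 (rho S v e) = ss 1 (act S v (tt 1 c) k) by rewrite re2 lk2'.
have hz := isinv_cp_lt N3 (ltnSn 1) crk hr hk'.
set Z := rho S v e *[1] act S v (tt 1 c) k in P hz.
have cP : tt 2 (act S v (ss 1 c) z *[1] b) = ss 2 Z.
  by rewrite /Z -re tt_cp_gt // ?lq2 // ss_cp_gt // ?lk3 // tb s2e cz.
have cQ : tt 2 (b *[1] act S v (tt 1 c) z) = ss 2 Z.
  by rewrite /Z tt_cp_gt // ?b2 // ss_cp_gt // tb s2e cz'.
have [Z' [g1 g2 g3 g4]] : exists Z', isinv 2 Z Z' by eexists; exact: hz.
have cZ : tt 2 Z = ss 2 Z' by rewrite g1.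
transitivity ((act S v (ss 1 c) z *[1] b) *[2] Z *[2] Z').
  by rewrite -cpA // g3 -cP cpx1.
by rewrite P -cpA // g3 -cQ cpx1.
Qed.
End Commutation.

(** * Contracting strategies *)

Section Strategy.
Context (C : category) (N : nat) (X : ocat N) (S : cstr C X).
Implicit Types (x y z : X) (u v w : arrow C).
Let N2 : 1 < N := N_gt1 S.

(** The prescribed target of the contraction of a d-cell: the contraction of its source followed by
    the inverse of that of its target. In dimension 2 there is nothing below to contract, and the
    target is the identity of a normal form. *)
Definition hat (tau : nat -> arrow C -> X -> X) d u x : X :=
  if d == 2 then lft S (arrow_cmp u (cls S x)) else
  tau d.-1 u (ss d.-1 x) *[d.-1] inv d.-1 (tau d.-1 u (tt d.-1 x)).

(* [tau d u x] is a (d+1)-cell from the d-cell [rho S u x] to a d-cell that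
   depends only on the boundary of x. *)
Record strategy (tau : nat -> arrow C -> X -> X) : Prop := Strategy {
  tau_ssS : forall d u x, 1 < d < N -> ss d x = x -> cc u (cls S x) ->
    ss d.+1 (tau d u x) = tau d u x;
  tau_ss : forall d u x, 1 < d < N -> ss d x = x -> cc u (cls S x) ->
    ss d (tau d u x) = rho S u x;
  tau_tt : forall d u x, 1 < d < N -> ss d x = x -> cc u (cls S x) ->
    tt d (tau d u x) = hat tau d u x;
  tau_cp : forall d i u x y, 1 < d < N -> ss d x = x -> ss d y = y ->
    cc u (cls S x) -> 0 < i < d -> tt i x = ss i y ->
    tau d u (x *[i] y) = tau d u x *[i] tau d u y;
  tau_cp0 : forall d u x y, 1 < d < N -> ss d x = x -> ss d y = y ->
    cc u (cls S x) -> tt 0 x = ss 0 y ->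
    tau d u (x *[0] y) =
    act S (arrow_cmp u (cls S x)) (ss 1 y) (tau d u x) *[1]
    tau d (arrow_cmp u (cls S x)) y;
  tau_unit : forall d u x, 1 < d < N -> ss d.-1 x = x -> cc u (cls S x) ->
    tau d u x = rho S u x
}.

Lemma cls_comp i x y : 0 < i -> tt i x = ss i y -> cls S x = cls S y.
Proof. by move=> i0 e; rewrite -(cls_tt S x i0) e cls_ss. Qed.

Lemma rho_comp i u x y : 0 < i -> cc u (cls S x) -> tt i x = ss i y ->
  tt i (rho S u x) = ss i (rho S u y).
Proof.
move=> i0 ux e; have exy := cls_comp i0 e.
have uy : cc u (cls S y) by rewrite -exy.
move: i0; rewrite leq_eqVlt => /predU1P[<-|i1].
  by rewrite tt1_rho // ss1_rho // exy.
by rewrite tt_rho // ss_rho // e.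
Qed.

Context (tau : nat -> arrow C -> X -> X) (H : strategy tau).

Lemma hat_boundary d u x : 1 < d ->
  hat tau d u (ss d x) = hat tau d u x /\ hat tau d u (tt d x) = hat tau d u x.
Proof.
move=> d1; rewrite /hat; case: eqP => [_|d2]; first by rewrite cls_ss ?cls_tt // ltnW.
have d' : d.-1 < d by lia.
by rewrite ssss ?ttss ?sstt ?tttt // ltnW.
Qed.

Section Level.
Context (d : nat).
Hypothesis dN : 1 < d < N.

Lemma tau_loop u x : ss d x = x -> cc u (cls S x) ->
  loop S (arrow_cmp u (cls S x)) (tau d u x).
Proof.
case/andP: (dN) => d1 _ hx ux; have [r1 r2] := rho_loop ux.
by rewrite /loop -(ssss _ (ltnW d1)) -(ttss _ d1) (tau_ss H).
Qed.

Lemma tau_lt i u x : i < d -> ss d x = x -> cc u (cls S x) ->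
  ss i (tau d u x) = ss i (rho S u x) /\ tt i (tau d u x) = tt i (rho S u x).
Proof.
move=> id hx ux.
by rewrite -(ssss _ (ltnW id)) -(ttss _ id) (tau_ss H).
Qed.

Lemma tau_comp i u x y : 0 < i < d -> ss d x = x -> ss d y = y -> cc u (cls S x) ->
  tt i x = ss i y -> tt i (tau d u x) = ss i (tau d u y).
Proof.
move=> /andP[i0 id] hx hy ux e.
have uy : cc u (cls S y) by rewrite -(cls_comp i0 e).
have [_ ->] := tau_lt id hx ux; have [-> _] := tau_lt id hy uy.
exact: rho_comp.
Qed.

Lemma tau_inv u x : ss d x = x -> cc u (cls S x) ->
  isinv d (tau d u x) (inv d (tau d u x)).
Proof.
case/andP: (dN) => d1 d2 hx ux; apply: invP; apply: (invertible S).
  by rewrite d2 (ltnW d1).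
exact: (tau_ssS H).
Qed.

(** The contractions of the source and of the target of [x] end at the same cell by [hat_boundary],
    so that [hat] in the next dimension is a genuine composite. *)
Lemma hat_comp u x : cc u (cls S x) ->
  let a := tau d u (ss d x) in let b := tau d u (tt d x) in
  [/\ ss d a = rho S u (ss d x), isinv d b (inv d b),
      tt d a = ss d (inv d b) & tt d (inv d b) = rho S u (tt d x)].
Proof.
case/andP: (dN) => d1 _ ux a b; have d0 := ltnW d1.
have us : cc u (cls S (ss d x)) by rewrite cls_ss.
have ut : cc u (cls S (tt d x)) by rewrite cls_tt.
have hs : ss d (ss d x) = ss d x by exact: ssss.
have ht : ss d (tt d x) = tt d x by exact: sttK.
have h := tau_inv ht ut; have [e1 e2 _ _] := h.
have [b1 b2] := hat_boundary u x d1.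
split=> //; first by rewrite /a (tau_ss H).
  by rewrite e1 /a !(tau_tt H) // b1 b2.
by rewrite e2 (tau_ss H).
Qed.
End Level.

Lemma hatS d u x : 1 < d ->
  hat tau d.+1 u x = tau d u (ss d x) *[d] inv d (tau d u (tt d x)).
Proof. by move=> d1; rewrite /hat eqSS; case: eqP d1 => [->|]. Qed.

Section Hat.
Context (d : nat).
Hypothesis dN : 1 < d <= N.

(** In dimension d, [hat] involves [tau] in dimension d - 1 only, whence the bound d <= N instead of
    d < N. *)
Lemma hat_case : d = 2 \/ exists2 e, d = e.+1 & 1 < e < N.
Proof.
case/andP: dN; case: d => [//|e]; rewrite ltnS leq_eqVlt => /predU1P[<-|e1] eN; first by left.
by right; exists e; rewrite ?e1.
Qed.

Lemma hat_ss u x : cc u (cls S x) ->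
  ss d.-1 (hat tau d u x) = ss d.-1 (rho S u x) /\
  tt d.-1 (hat tau d u x) = tt d.-1 (rho S u x).
Proof.
move=> ux; case: hat_case => [->|[e -> eN]].
  by rewrite /hat /= ss_lft tt_lft ss1_rho // tt1_rho.
have /andP[e1 e2] := eN; rewrite hatS //=.
have [h1 h2 h3 h4] := hat_comp eN ux.
by rewrite ss_cp ?tt_cp // h1 h4 ss_rho // tt_rho.
Qed.

Lemma hat_loop u x : cc u (cls S x) ->
  loop S (arrow_cmp u (cls S x)) (hat tau d u x).
Proof.
move=> ux; case: hat_case => [->|[e -> eN]]; first exact: lft_loop.
have /andP[e1 e2] := eN; rewrite hatS //=.
have [h1 h2 h3 h4] := hat_comp eN ux.
have [h5 h6] := ss_cp_lt e2 h3 e1.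
have us : cc u (cls S (ss e x)) by rewrite cls_ss // ltnW.
have hs : ss e (ss e x) = ss e x by exact: ssss.
by rewrite /loop h5 h6; have := tau_loop eN hs us; rewrite cls_ss // ltnW.
Qed.

Lemma hat_unit u x : cc u (cls S x) -> ss d.-1 x = x -> hat tau d u x = rho S u x.
Proof.
move=> ux; case: hat_case => [->|[e -> eN]] /= hx.
  by rewrite rho_fix1.
have /andP[e1 e2] := eN; rewrite hatS //=.
have [h1 [_ _ h2 _] h3 h4] := hat_comp eN ux.
by move: h1 h2; rewrite (fix_tt hx) hx => h1 ->.
Qed.

(** For d > 2 and i = d - 1, the contraction of the common face cancels against its inverse; for
    smaller i, the lower contraction is compatible with the composition and interchange
    concludes. *)
Lemma hat_cp i u x y : 0 < i < d -> cc u (cls S x) -> tt i x = ss i y ->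
  hat tau d u (x *[i] y) = hat tau d u x *[i] hat tau d u y.
Proof.
move=> /andP[i0 id] ux c; have exy := cls_comp i0 c.
have /andP[_ dN'] := dN; have iN : i < N by lia.
case: hat_case => [ed|[e ed eN]].
  rewrite ed /hat /= (cls_cp S) // -exy cp_fix //.
  by apply: (fix_le 1 _ (ss_lft S _)).
have /andP[e1 e2] := eN; have e0 := ltnW e1; rewrite ed !hatS //=.
have uy : cc u (cls S y) by rewrite -exy.
have [h1 h2 h3 h4] := hat_comp eN ux; have [g1 g2 g3 g4] := hat_comp eN uy.
have := id; rewrite ed ltnS leq_eqVlt => /predU1P[ei|ie].
  subst i; rewrite ss_cp // tt_cp // c.
  have [k1 k2 k3 k4] := h2; rewrite c in h3 h4 k1 k2 k3 k4 *.
  have b1 : tt e (inv e (tau e u (ss e y))) = ss e (tau e u (ss e y)) by rewrite h4 g1.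
  rewrite cpA // ?tt_cp // -?[_ *[e] _ *[e] tau _ _ _]cpA // k4.
  by rewrite -k1 -h3 cpx1.
rewrite ss_cp_gt // tt_cp_gt //.
have us : cc u (cls S (ss e x)) by rewrite cls_ss.
have ut : cc u (cls S (tt e x)) by rewrite cls_tt.
have cs : tt i (ss e x) = ss i (ss e y) by rewrite ttss // ssss // ltnW.
have ct : tt i (tt e x) = ss i (tt e y) by rewrite sstt // tttt // ltnW.
have hs z : ss e (ss e z) = ss e z by exact: ssss.
have ht z : ss e (tt e z) = tt e z by exact: sttK.
have ie0 : 0 < i < e by rewrite i0.
have cc1 := tau_comp eN ie0 (hs x) (hs y) us cs.
have cc2 := tau_comp eN ie0 (ht x) (ht y) ut ct.
rewrite !(tau_cp H) //.
have -> : inv e (tau e u (tt e x) *[i] tau e u (tt e y)) =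
    inv e (tau e u (tt e x)) *[i] inv e (tau e u (tt e y)).
  by apply: inv_eq => //; exact: isinv_cp_lt.
by rewrite (@cp_inter _ _ i e).
Qed.

Lemma hat_cp0 u x y : cc u (cls S x) -> tt 0 x = ss 0 y ->
  hat tau d u (x *[0] y) =
  act S (arrow_cmp u (cls S x)) (ss 1 y) (hat tau d u x) *[1]
  hat tau d (arrow_cmp u (cls S x)) y.
Proof.
move=> ux c; set v := arrow_cmp u (cls S x).
have xy : cc (cls S x) (cls S y) by apply/(cls_cc S).
have vy : cc v (cls S y) by apply/cc_cmpl.
have vq := cc_ss1 vy; have hq := ss1_ss1 y.
case: hat_case => [ed|[e ed eN]].
  rewrite ed /hat /= cls_cp0 // arrow_cmpA // act_lft // cls_ss //.
  by rewrite cp_fix // ss_lft.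
have /andP[e1 e2] := eN; have e0 := ltnW e1; rewrite ed !hatS //=.
have [h1 h2 h3 h4] := hat_comp eN ux; have [g1 g2 g3 g4] := hat_comp eN vy.
have us : cc u (cls S (ss e x)) by rewrite cls_ss.
have ut : cc u (cls S (tt e x)) by rewrite cls_tt.
have vs : cc v (cls S (ss e y)) by rewrite cls_ss.
have vt : cc v (cls S (tt e y)) by rewrite cls_tt.
have hs z : ss e (ss e z) = ss e z by exact: ssss.
have ht z : ss e (tt e z) = tt e z by exact: sttK.
have cs : tt 0 (ss e x) = ss 0 (ss e y) by rewrite ttss // ssss.
have ct : tt 0 (tt e x) = ss 0 (tt e y) by rewrite sstt // tttt.
have N0 : 0 < N by lia.
have ls := tau_loop eN (hs x) us; have lt := tau_loop eN (ht x) ut.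
rewrite cls_ss // in ls; rewrite cls_tt // in lt.
have ms := tau_loop eN (hs y) vs; have mt := tau_loop eN (ht y) vt.
rewrite cls_ss // in ms; rewrite cls_tt // in mt.
have ex1 : ss 1 (ss e y) = ss 1 y by rewrite ssss.
have ey1 : ss 1 (tt e y) = ss 1 y by rewrite sstt.
rewrite ss_cp_gt // tt_cp_gt // !(tau_cp0 H) // !cls_ss // !cls_tt // ex1 ey1 -/v.
have ls' := act_loop hq vq ls; have lt' := act_loop hq vq lt.
rewrite cls_ss // in ls' lt'.
have [i1 i2 i3 i4] := g2; have [j1 j2 j3 j4] := h2.
have c1 : tt 1 (act S v (ss 1 y) (tau e u (tt e x))) = ss 1 (tau e v (tt e y)).
  by have [_ ->] := lt'; have [->] := mt.
have c2 : tt 1 (act S v (ss 1 y) (tau e u (ss e x))) = ss 1 (tau e v (ss e y)).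
  by have [_ ->] := ls'; have [->] := ms.
have h2' := isinv_act e1 e2 hq vq lt h2.
have -> : inv e (act S v (ss 1 y) (tau e u (tt e x)) *[1] tau e v (tt e y)) =
    act S v (ss 1 y) (inv e (tau e u (tt e x))) *[1] inv e (tau e v (tt e y)).
  by apply: inv_eq => //; exact: isinv_cp_lt.
have li : loop S v (inv e (tau e u (tt e x))).
  have [l1 l2] := lt; have [a1 a2] := ss0_lt (esym j1) e1.
  by rewrite /loop -a1 -a2.
rewrite act_cp // -(@cp_inter _ _ 1 e) //.
by rewrite tt_act // ss_act // h3.
Qed.
End Hat.
End Strategy.

Definition acyclic_over (n : nat) (X : ocat n) (Y : ocat n.+1) (A : Type)
    (bs bt : A -> X) (F : free_over Y bs bt) : Prop :=
  forall x x' : X, ss n.-1 x = ss n.-1 x' -> tt n.-1 x = tt n.-1 x' ->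
    exists y, sf F y = x /\ tf F y = x'.

(* The inverse of x for a lower composition: from the inverse y of x for the
   n-composition and the m-inverses p' and q' of the n-source and n-target. *)
Lemma isinv_horiz (N m n : nat) (Y : ocat N) (x y p' q' : Y) : m < n -> n < N ->
  isinv n x y -> isinv m (ss n x) p' -> isinv m (tt n x) q' ->
  ss n p' = p' -> ss n q' = q' ->
  isinv m x ((p' *[m] y) *[m] q').
Proof.
move=> mn nN [k1 k2 k3 k4] [p1 p2 p3 p4] [q1 q2 q3 q4] fp fq.
have mN := ltn_trans mn nN.
have sx := ssss x (ltnW mn); have tx := ttss x mn.
have sx' := sstt x mn; have tx' := tttt x (ltnW mn).
have sy : ss m y = ss m x by rewrite -(ssss _ (ltnW mn)) k1 sx'.
have ty : tt m y = tt m x by rewrite -(ttss _ mn) k1 tx'.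
rewrite sx tx in p1 p2 p3 p4; rewrite sx' tx' in q1 q2 q3 q4.
have c1 : tt m p' = ss m y by rewrite p2.
have c2 : tt m (p' *[m] y) = ss m q' by rewrite tt_cp // ty q1.
have c3 : tt m y = ss m q' by rewrite ty q1.
have c4 : tt m x = ss m p' by rewrite p1.
have c5 : tt m x = ss m (p' *[m] y) by rewrite ss_cp.
have c6 : tt m q' = ss m x by [].
have c7 : tt m (y *[m] q') = ss m x by rewrite tt_cp.
have c8 : tt m p' = ss m (y *[m] q') by rewrite ss_cp.
(* Once both factors are padded with n-units, interchange cancels the n-source of [x] against [p']
   and leaves [y *[n] x]. The identity [E2] is dual. *)
have E1 : x *[m] (p' *[m] y) = tt n x.
  have e1 : ss n x *[n] x = x by exact: cp1x.
  have e2 : (p' *[m] y) *[n] tt m x = p' *[m] y.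
    have <- : tt n (p' *[m] y) = tt m x by rewrite tt_cp_gt // k2 (fix_tt fp) p4.
    exact: cpx1.
  rewrite -{1}e1 -{1}e2 cp_inter //.
  - by rewrite cpA // ?tx // p3 -sy cp1x // cpx1.
  - by rewrite tssK.
  - by rewrite tt_cp_gt // k2 (fix_tt fp) p4 sttK // ltnW.
  - by rewrite tx c5.
have E2 : (y *[m] q') *[m] x = ss n x.
  have e1 : x *[n] tt n x = x by exact: cpx1.
  have e2 : ss m x *[n] (y *[m] q') = y *[m] q'.
    have <- : ss n (y *[m] q') = ss m x by rewrite ss_cp_gt // k1 fq q3.
    exact: cp1x.
  rewrite -{1}e1 -{1}e2 cp_inter //.
  - rewrite cp1x // -cpA // ?sx' // q4 -ty cpx1 //.
  - by rewrite ss_cp_gt // k1 fq q3 tssK // ltnW.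
  - by rewrite sttK.
  - by rewrite tssK.
split.
- by rewrite ss_cp // ss_cp.
- by rewrite tt_cp.
- by rewrite cpA // E1 q3.
- by rewrite -(@cpA _ _ m p') // -cpA // E2 p4.
Qed.

(** * Extension of a strategy by one dimension *)

Section Step.
Context (C : category) (m : nat) (W : ocat m) (X : ocat m.+1) (Y : ocat m.+2).
Context (B A : Type) (cs ct : B -> W) (bs bt : A -> X).
Context (G : free_over X cs ct) (F : free_over Y bs bt).
Context (S : cstr C X) (tau : nat -> arrow C -> X -> X) (H : strategy S tau).
Hypothesis acy : acyclic_over F.
Let S' := cstr_free F S.
Let n := m.+1.
Implicit Types (x y z : X) (u v w : arrow C).

Let n1 : 1 < n := N_gt1 S.
Let n0 : 0 < n := ltnW n1.
Let m0 : 0 < m := n1.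
Let nN : 1 < n <= n. Proof. by rewrite n1 leqnn. Qed.

Let r u x : Y := io F (rho S u x).
Let h u x : Y := io F (hat S tau n u x).
Let dflt u : Y := io F (lft S u).

Lemma fill_gen u b : cc u (cls S (gn G b)) ->
  exists y : Y, ss n y = r u (gn G b) /\ tt n y = h u (gn G b).
Proof.
move=> ub; have [e1 e2] := hat_ss H nN ub.
have [y [e3 e4]] := acy (esym e1) (esym e2).
by exists y; rewrite -(io_sf F) -(io_tf F) e3 e4.
Qed.

Definition filler u b : Y :=
  if pselect (cc u (cls S (gn G b))) is left e then projT1 (cid (fill_gen e))
  else dflt u.

(** The recursion takes its values in families indexed by all arrows, because the rule for the
    composition 0 evaluates the second factor at [u] followed by the class of [x]. The default
    [dflt], imposed on arrows that are not composable, allows the laws to hold as equalities of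
    functions. *)
Definition fop i x y (a b : arrow C -> Y) (u : arrow C) : Y :=
  if pselect (cc u (cls S x)) then
    if i is 0 then
      act S' (arrow_cmp u (cls S x)) (io F (ss 1 y)) (a u) *[1]
      b (arrow_cmp u (cls S x))
    else a u *[i] b u
  else dflt u.

Definition good x (a : arrow C -> Y) : Prop := forall u,
  (cc u (cls S x) -> ss n (a u) = r u x /\ tt n (a u) = h u x) /\
  (~ cc u (cls S x) -> a u = dflt u).

Definition fU (x : W) u : Y :=
  if pselect (cc u (cls S (io G x))) then r u (io G x) else dflt u.
Definition fG b u := filler u b.
(** The value on an inverse generator is forced: it is the m-inverse of the value on the generator,
    written out as in [isinv_horiz]. *)
Definition fI b u :=
  if pselect (cc u (cls S (gi G b))) then
    (r u (gi G b) *[m] inv n (filler u b)) *[m] h u (gi G b)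
  else dflt u.

Lemma fop0 x y a b u : cc u (cls S x) ->
  fop 0 x y a b u =
  act S' (arrow_cmp u (cls S x)) (io F (ss 1 y)) (a u) *[1]
      b (arrow_cmp u (cls S x)).
Proof. by rewrite /fop; case: pselect. Qed.

Lemma fopS i x y a b u : cc u (cls S x) -> 0 < i ->
  fop i x y a b u = a u *[i] b u.
Proof. by rewrite /fop; case: pselect => //; case: i. Qed.

Lemma fopN i x y a b u : ~ cc u (cls S x) -> fop i x y a b u = dflt u.
Proof. by rewrite /fop; case: pselect. Qed.

Lemma fUE (x : W) u : cc u (cls S (io G x)) -> fU x u = r u (io G x).
Proof. by rewrite /fU; case: pselect. Qed.

Lemma good_ss x a i u : good x a -> cc u (cls S x) -> i <= n ->
  ss i (a u) = ss i (r u x).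
Proof.
by move=> /(_ u)[+ _] ux iN => /(_ ux)[e _]; rewrite -(ssss (a u) iN) e.
Qed.

Lemma good_tt x a i u : good x a -> cc u (cls S x) -> i < n ->
  tt i (a u) = tt i (r u x).
Proof.
by move=> /(_ u)[+ _] ux iN => /(_ ux)[e _]; rewrite -(ttss (a u) iN) e.
Qed.

Lemma good_loop x a u : good x a -> cc u (cls S x) ->
  loop S' (arrow_cmp u (cls S x)) (a u).
Proof.
move=> ga ux; rewrite /loop (good_ss ga ux n0) (good_tt ga ux n1).
exact: (loop_io F (rho_loop ux)).
Qed.

Lemma r_comp i u x y : 0 < i -> cc u (cls S x) -> tt i x = ss i y ->
  tt i (r u x) = ss i (r u y).
Proof. by move=> i0 ux e; apply: io_comp; exact: rho_comp. Qed.

Lemma good_comp x y a b i u : good x a -> good y b -> cc u (cls S x) ->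
  0 < i < n -> tt i x = ss i y -> tt i (a u) = ss i (b u).
Proof.
move=> ga gb ux /andP[i0 iN] e; have uy : cc u (cls S y) by rewrite -(cls_comp S i0 e).
by rewrite (good_tt ga) // (good_ss gb) ?(ltnW iN) //; exact: r_comp.
Qed.

Lemma cc_next u x y : cc u (cls S x) -> tt 0 x = ss 0 y ->
  cc (arrow_cmp u (cls S x)) (cls S y).
Proof. by move=> ux e; apply/cc_cmpl => //; exact/(cls_cc S). Qed.

Lemma good_U (x : W) : good (io G x) (fU x).
Proof.
move=> u; split=> ux; last by rewrite /fU; case: pselect.
rewrite fUE // /r /h ssn_io ttn_io; split=> //.
by rewrite (hat_unit H nN) //= ssn_io.
Qed.

Lemma good_G b : good (gn G b) (fG b).
Proof.
move=> u; rewrite /fG /filler; case: pselect => // e; split=> // _.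
by case: cid.
Qed.

Lemma cls_gi b : cls S (gi G b) = cls S (gn G b).
Proof. by apply: (cls_comp S m0); rewrite ttn_gi ssn_gn. Qed.

Lemma ss_rho1 j u x : 0 < j -> cc u (cls S x) ->
  ss j (rho S u x) = rho S u (ss j x) /\ tt j (rho S u x) = rho S u (tt j x).
Proof.
rewrite leq_eqVlt => /predU1P[<-|j1] ux; last by rewrite ss_rho ?tt_rho.
have e1 := ss1_ss1 x; have e2 := ss1_tt1 x.
by rewrite ss1_rho // tt1_rho // !rho_fix1 ?cls_ss ?cls_tt.
Qed.

Lemma isinv_r x x' u : cc u (cls S x) -> isinv m x x' ->
  isinv m (r u x) (r u x').
Proof.
move=> ux [e1 e2 e3 e4]; apply: (isinv_io F) => //.
have ux' : cc u (cls S x') by rewrite -(cls_comp S m0 (esym e1)).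
have [a1 a2] := ss_rho1 m0 ux; have [b1 b2] := ss_rho1 m0 ux'.
by split; rewrite ?a1 ?a2 ?b1 ?b2 ?e1 ?e2 // -rho_cp // ?e3 ?e4.
Qed.

Lemma isinv_h x x' u : cc u (cls S x) -> isinv m x x' ->
  isinv m (h u x) (h u x').
Proof.
move=> ux [e1 e2 e3 e4]; apply: (isinv_io F) => //.
have ux' : cc u (cls S x') by rewrite -(cls_comp S m0 (esym e1)).
have [a1 a2] := ss_rho1 m0 ux; have [b1 b2] := ss_rho1 m0 ux'.
have [c1 c2] := hat_ss H nN ux; have [d1 d2] := hat_ss H nN ux'.
have mn : 0 < m < n by rewrite m0 /=.
have us : cc u (cls S (ss m x)) by rewrite cls_ss.
have ut : cc u (cls S (tt m x)) by rewrite cls_tt.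
have hs : ss m (ss m x) = ss m x by exact: ssss.
have ht : ss m (tt m x) = tt m x by exact: sttK.
rewrite /= in c1 c2 d1 d2.
split; rewrite ?c1 ?c2 ?d1 ?d2 ?a1 ?a2 ?b1 ?b2 ?e1 ?e2 //.
  by rewrite -(hat_cp H nN) // e3 (hat_unit H nN).
by rewrite -(hat_cp H nN) // e4 (hat_unit H nN).
Qed.

Lemma fIE b u : cc u (cls S (gi G b)) ->
  fI b u = (r u (gi G b) *[m] inv n (filler u b)) *[m] h u (gi G b).
Proof. by rewrite /fI; case: (pselect (cc u (cls S (gi G b)))). Qed.

Lemma isinv_fI b u : cc u (cls S (gn G b)) -> isinv m (fG b u) (fI b u).
Proof.
move=> ub; rewrite fIE ?cls_gi //; have [g1 g2] := (good_G b u).1 ub.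
apply: (@isinv_horiz _ m n) => //; rewrite ?ssn_io //.
- apply: invP; apply: (invertible S') => //; first by rewrite n0 /=.
  by rewrite ss_id.
- by rewrite g1; apply: isinv_r => //; exact: isinv_gn.
- by rewrite g2; apply: isinv_h => //; exact: isinv_gn.
Qed.

(** The n-source and n-target maps, [r] and [h] all preserve m-inverses; uniqueness of inverses
    identifies the boundaries. *)
Lemma good_I b : good (gi G b) (fI b).
Proof.
move=> u; split=> ub; last by rewrite /fI; case: pselect.
have ub' : cc u (cls S (gn G b)) by rewrite -cls_gi.
have [g1 g2] := (good_G b u).1 ub'.
have mn : m < n.+1 by [].
have h1 := isinv_fI ub'; have [e1 e2 e3 e4] := h1.
have [g3 g4] : ss n (fI b u) = inv m (ss n (fG b u)) /\ tt n (fI b u) = inv m (tt n (fG b u)).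
  have k1 (y : Y) : ss m (ss n y) = ss m y by rewrite ssss.
  have k2 (y : Y) : tt m (ss n y) = tt m y by rewrite ttss.
  have k3 (y : Y) : ss m (tt n y) = ss m y by rewrite sstt.
  have k4 (y : Y) : tt m (tt n y) = tt m y by rewrite tttt.
  split; apply/esym; apply: inv_eq => //; split; rewrite ?k1 ?k2 ?k3 ?k4 //.
  - by rewrite -(@ss_cp_gt _ _ m n) // e3 ssK.
  - by rewrite -(@ss_cp_gt _ _ m n) // e4 sttK.
  - by rewrite -(@tt_cp_gt _ _ m n) // e3 tssK.
  - by rewrite -(@tt_cp_gt _ _ m n) // e4 ttK.
rewrite g3 g4 g1 g2; split; apply: inv_eq => //.
  by apply: isinv_r => //; exact: isinv_gn.
by apply: isinv_h => //; exact: isinv_gn.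
Qed.

Lemma inv_laws b : fop m (gn G b) (gi G b) (fG b) (fI b) = fU (cs b) /\
  fop m (gi G b) (gn G b) (fI b) (fG b) = fU (ct b).
Proof.
have cls1 : cls S (io G (cs b)) = cls S (gn G b) by rewrite -ssn_gn cls_ss.
have cls2 : cls S (io G (ct b)) = cls S (gn G b) by rewrite -ttn_gn cls_tt.
split; apply/funext => u; have [ub|ub] := pselect (cc u (cls S (gn G b))).
- have [e1 e2 e3 e4] := isinv_fI ub; have [g1 g2] := (good_G b u).1 ub.
  rewrite fopS // e3 fUE ?cls1 // -(ssss _ (leqnSn m)) g1 -io_ss.
  by rewrite (ss_rho1 m0 ub).1 ssn_gn.
- by rewrite fopN // /fU; case: pselect => //; rewrite cls1.
- have [e1 e2 e3 e4] := isinv_fI ub; have [g1 g2] := (good_G b u).1 ub.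
  rewrite fopS ?cls_gi // e4 fUE ?cls2 // -(ttss _ (ltnSn m)) g1 -io_tt.
  by rewrite (ss_rho1 m0 ub).2 ttn_gn.
- by rewrite fopN ?cls_gi // /fU; case: pselect => //; rewrite cls2.
Qed.

Lemma cc_cp i u x y : i <= m -> tt i x = ss i y ->
  cc u (cls S (x *[i] y)) <-> cc u (cls S x).
Proof.
case: i => [_ e|i im e]; last by rewrite (cls_cp S).
by rewrite cls_cp0 //; apply: cc_cmpr; exact/(cls_cc S).
Qed.

(** The formulas of [rho] and of [hat] on composites have the same shape as [fop], so sources and
    targets match. *)
Lemma good_op i x y a b : i <= m -> tt i x = ss i y -> good x a -> good y b ->
  good (x *[i] y) (fop i x y a b).
Proof.
move=> im e ga gb u; split=> [/(cc_cp u im e) ux|nux]; last first.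
  by rewrite fopN // => /(cc_cp u im e).
case: i im e => [_|i im] e; last first.
  have uy : cc u (cls S y) by rewrite -(cls_comp S _ e).
  have [a1 a2] := (ga u).1 ux; have [b1 b2] := (gb u).1 uy.
  have e' : tt i.+1 (a u) = ss i.+1 (b u) by apply: good_comp e => //; rewrite ltnS.
  have iN : i.+1 < n.+1 by rewrite ltnS ltnW.
  have e1 := rho_comp (ltn0Sn i) ux e.
  have e2 : tt i.+1 (hat S tau n u x) = ss i.+1 (hat S tau n u y).
    have := im; rewrite leq_eqVlt => /predU1P[em|im'].
      have [_ k1] := hat_ss H nN ux; have [k2 _] := hat_ss H nN uy.
      by move: k1 k2 e1; rewrite /= em => -> ->.
    have im2 : i.+1 < m by [].
    have [_ k1] := hat_ss H nN ux; have [k2 _] := hat_ss H nN uy.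
    by rewrite -(tttt _ (ltnW im2)) -(ssss _ (ltnW im2)) k1 k2 tttt ?ssss // ltnW.
  rewrite fopS // ss_cp_gt // tt_cp_gt // a1 a2 b1 b2; split.
    by rewrite /r /h rho_cp // io_cp.
  by rewrite /h (hat_cp H nN) // ?io_cp.
have uv := cc_next ux e; set v := arrow_cmp u (cls S x) in uv *.
have [a1 a2] := (ga u).1 ux; have [b1 b2] := (gb v).1 uv.
have la := good_loop ga ux; have lb := good_loop gb uv.
have vq := cc_ss1 uv; have hq := ss1_ss1 y.
have hq' : ss 1 (io F (ss 1 y)) = io F (ss 1 y) by rewrite -io_ss hq.
have vq' : cc v (cls S' (io F (ss 1 y))) by rewrite (cls_io F).
have la' := act_loop hq' vq' la.
have lr := rho_loop ux; have lh := hat_loop H nN ux.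
have lra := act_loop hq vq lr; have lha := act_loop hq vq lh.
have n11 : 1 < n.+1 by exact: ltnW.
have cls' : cls S' (io F (ss 1 y)) = cls S y by rewrite (cls_io F) cls_ss.
have c1 : tt 1 (act S' v (io F (ss 1 y)) (a u)) = ss 1 (b v).
  by have [_ ->] := la'; have [-> _] := lb; rewrite cls'.
have [l1 l2] := rho_loop uv; have [l3 l4] := hat_loop H nN uv.
have cr : tt 1 (act S v (ss 1 y) (rho S u x)) = ss 1 (rho S v y).
  by have [_ ->] := lra; rewrite l1 cls_ss.
have ch : tt 1 (act S v (ss 1 y) (hat S tau n u x)) = ss 1 (hat S tau n v y).
  by have [_ ->] := lha; rewrite l3 cls_ss.
rewrite fop0 // -/v ss_cp_gt // tt_cp_gt // ss_act // tt_act // a1 a2 b1 b2.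
rewrite /r /h (act_io F hq vq lr) (act_io F hq vq lh) -!io_cp //.
by rewrite -rho_cp0 // -(hat_cp0 H nN).
Qed.

Lemma good_ext x a a' : good x a -> good x a' ->
  (forall u, cc u (cls S x) -> a u = a' u) -> a = a'.
Proof.
move=> ga ga' e; apply/funext => u; have [/e//|nu] := pselect (cc u (cls S x)).
by rewrite (ga u).2 // (ga' u).2.
Qed.

Lemma fop_unitl i x a (z : W) : i <= m -> good x a -> io G z = ss i x ->
  fop i (io G z) x (fU z) a = a.
Proof.
move=> im ga ez; have gz := good_U z.
have cz : tt i (io G z) = ss i x by rewrite ez tssK.
have ex : io G z *[i] x = x by rewrite ez cp1x.
have g := good_op im cz gz ga; rewrite ex in g.
apply: (good_ext g ga) => u ux.
have uz : cc u (cls S (io G z)) by apply/(cc_cp _ im cz); rewrite ex.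
case: i im ez cz ex {g} => [_|i im] ez cz ex; last first.
  rewrite fopS // fUE // ez /r -(ss_rho1 (ltn0Sn i) ux).1 io_ss.
  by rewrite -(good_ss ga ux) ?cp1x // ltnW // ltnS.
have exz : arrow_cmp u (cls S (io G z)) = u.
  rewrite ez cls_ss0 arrow_cmpid //; exact: esym.
have z1 : ss 1 (io G z) = io G z by rewrite ez ssK.
rewrite fop0 // exz fUE // /r rho_fix1 // exz.
have hq' : ss 1 (io F (ss 1 x)) = io F (ss 1 x) by rewrite -io_ss ss1_ss1.
have ux' : cc u (cls S' (io F (ss 1 x))) by rewrite (cls_io F); exact: cc_ss1.
rewrite -[io F (lft S u)]/(lft S' u) act_lft // (cls_io F) cls_ss //.
by have [<- _] := good_loop ga ux; rewrite cp1x // ltnW.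
Qed.

Lemma fop_unitr i x a (z : W) : i <= m -> good x a -> io G z = tt i x ->
  fop i x (io G z) a (fU z) = a.
Proof.
move=> im ga ez; have gz := good_U z.
have cz : tt i x = ss i (io G z) by rewrite ez sttK.
have ex : x *[i] io G z = x by rewrite ez cpx1.
have g := good_op im cz ga gz; rewrite ex in g.
apply: (good_ext g ga) => u ux.
case: i im ez cz ex {g} => [_|i im] ez cz ex; last first.
  have uz : cc u (cls S (io G z)) by rewrite -(cls_comp S _ cz).
  rewrite fopS // fUE // ez /r -(ss_rho1 (ltn0Sn i) ux).2 io_tt.
  by rewrite -(good_tt ga ux) ?cpx1 // ltnW // ltnS.
have uz := cc_next ux cz; set v := arrow_cmp u (cls S x) in uz *.
have exz : arrow_cmp v (cls S (io G z)) = v.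
  by rewrite ez cls_tt0 arrow_cmpid // /v atgt_cmp.
have z0 : ss 0 (io G z) = io G z by rewrite ez sttK.
have z1 : ss 1 (io G z) = io G z by exact: (fix_le 0).
rewrite fop0 // -/v z1 act_id; first last.
- exact: good_loop.
- by rewrite (cls_io F).
- by rewrite -io_ss z0.
rewrite fUE // /r rho_fix1 // exz.
by have [_ e] := good_loop ga ux; rewrite -[io F (lft S v)]/(lft S' v) -e cpx1 // ltnW.
Qed.

Lemma fop_assoc i x y z a b c : i <= m -> tt i x = ss i y -> tt i y = ss i z ->
  good x a -> good y b -> good z c ->
  fop i (x *[i] y) z (fop i x y a b) c = fop i x (y *[i] z) a (fop i y z b c).
Proof.
move=> im xy yz ga gb gc.
have in' : i < n by rewrite ltnS.
have xyz : tt i (x *[i] y) = ss i z by rewrite tt_cp.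
have xyz' : tt i x = ss i (y *[i] z) by rewrite ss_cp.
have gab := good_op im xy ga gb; have gbc := good_op im yz gb gc.
have g1 := good_op im xyz gab gc; have g2 := good_op im xyz' ga gbc.
rewrite -cpA // in g1; apply: (good_ext g1 g2) => u /(cc_cp u im xyz') ux.
case: i im xy yz in' xyz xyz' gab gbc {g1 g2} => [_|i im] xy yz in' xyz xyz' gab gbc; last first.
  have uxy : cc u (cls S (x *[i.+1] y)) by apply/cc_cp.
  have uy : cc u (cls S y) by rewrite -(cls_comp S _ xy).
  rewrite !fopS // cpA //; first exact: ltnW.
    exact: (good_comp ga gb).
  exact: (good_comp gb gc).
have uxy : cc u (cls S (x *[0] y)) by apply/cc_cp.
have uy := cc_next ux xy; set v := arrow_cmp u (cls S x) in uy *.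
have ex : arrow_cmp u (cls S (x *[0] y)) = arrow_cmp v (cls S y).
  by rewrite cls_cp0 // arrow_cmpA //; exact/(cls_cc S).
have uz := cc_next uy yz; set w := arrow_cmp v (cls S y) in ex uz *.
rewrite !fop0 // ex -/v -/w.
have vq := cc_ss1 uy; have wq := cc_ss1 uz.
have Y1 : ss 1 (io F (ss 1 y)) = io F (ss 1 y) by rewrite -io_ss ss1_ss1.
have Z1 : ss 1 (io F (ss 1 z)) = io F (ss 1 z) by rewrite -io_ss ss1_ss1.
have vq' : cc v (cls S' (io F (ss 1 y))) by rewrite (cls_io F).
have wq' : cc w (cls S' (io F (ss 1 z))) by rewrite (cls_io F).
have ly : cls S' (io F (ss 1 y)) = cls S y by rewrite (cls_io F) cls_ss.
have lz : cls S' (io F (ss 1 z)) = cls S z by rewrite (cls_io F) cls_ss.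
have la := good_loop ga ux; have lb := good_loop gb uy; have lc := good_loop gc uz.
have la' := act_loop Y1 vq' la; rewrite ly -/w in la'.
have cab : tt 1 (act S' v (io F (ss 1 y)) (a u)) = ss 1 (b v).
  by have [_ ->] := la'; have [->] := lb.
have la'' := act_loop Z1 wq' la'; have lb' := act_loop Z1 wq' lb.
have ew : w = arrow_cmp v (cls S' (io F (ss 1 y))) by rewrite ly.
have yz' : tt 0 (ss 1 y) = ss 0 (ss 1 z) by rewrite ttss // ssss.
have E : act S' v (io F (ss 1 (y *[0] z))) (a u) =
    act S' w (io F (ss 1 z)) (act S' v (io F (ss 1 y)) (a u)).
  rewrite ss_cp_gt // io_cp // -act_cmp //; first by rewrite -ew.
  by rewrite -io_tt -io_ss yz'.
have N1 : 1 < n.+1 by exact: ltnW.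
have f1 : tt 1 (act S' w (io F (ss 1 z)) (act S' v (io F (ss 1 y)) (a u))) =
    ss 1 (act S' w (io F (ss 1 z)) (b v)).
  by have [_ ->] := la''; have [-> _] := lb'.
have f2 : tt 1 (act S' w (io F (ss 1 z)) (b v)) = ss 1 (c w).
  by have [_ ->] := lb'; have [-> _] := lc; rewrite lz.
by rewrite E act_cp // cpA.
Qed.

Lemma fU_cp i (x y : W) : i < m -> tt i x = ss i y ->
  fU (x *[i] y) = fop i (io G x) (io G y) (fU x) (fU y).
Proof.
move=> im xy; have e := io_comp G xy.
have g := good_op (ltnW im) e (good_U x) (good_U y).
rewrite -io_cp // in g; apply: (good_ext (good_U _) g) => u.
rewrite io_cp // => ux; have {}ux := (cc_cp u (ltnW im) e).1 ux.
have uxy : cc u (cls S (io G (x *[i] y))) by rewrite io_cp //; apply/cc_cp => //; exact: ltnW.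
rewrite fUE // /r io_cp //.
case: i im xy e {g uxy} => [_|i im] xy e; last first.
  have uy : cc u (cls S (io G y)) by rewrite -(cls_comp S _ e).
  have iN : i.+1 < n by exact: ltnW im.
  have e1 := rho_comp (ltn0Sn i) ux e.
  by rewrite fopS // !fUE // rho_cp // /r io_cp.
have uy := cc_next ux e.
have lr := rho_loop ux; have vq := cc_ss1 uy; have hq := ss1_ss1 (io G y).
have lra := act_loop hq vq lr.
rewrite fop0 // !fUE // rho_cp0 // /r (act_io F hq vq lr) io_cp //.
by have [_ ->] := lra; have [-> _] := rho_loop uy; rewrite cls_ss.
Qed.

(* For n > 2 the 2-target of a good cell is connected to an identity. *)
Lemma good_comm x y a b u : good x a -> good y b -> cc u (cls S x) ->
  tt 0 x = ss 0 y -> let v := arrow_cmp u (cls S x) in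
  act S' v (io F (ss 1 y)) (a u) *[1] b v = b v *[1] act S' v (io F (tt 1 y)) (a u).
Proof.
move=> ga gb ux xy v; have vy := cc_next ux xy.
have la := good_loop ga ux; have [a1 a2] := (ga u).1 ux.
have N3 : 2 < n.+1 by [].
have vy' : cc v (cls S' (io F y)) by rewrite (cls_io F).
have sb : ss 2 (b v) = rho S' v (ss 2 (io F y)).
  by rewrite (good_ss gb vy) // /r -ss_rho // (rho_io F).
have vc : cc v (cls S' (ss 2 (io F y))) by rewrite cls_ss.
rewrite io_ss io_tt -(ssss (io F y) (leqnSn 1)) -(ttss (io F y) (ltnSn 1)).
move: (n1); rewrite leq_eqVlt => /predU1P[n2|n3].
  apply: (act_comm0 N3) => //.
  have en : n == 2 by apply/eqP/esym.
  have -> : tt 2 (a u) = tt n (a u) by congr tt.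
  by rewrite a2 /h /hat en.
have k2 : 1 < 2 < n by [].
have us : cc u (cls S (tt 2 x)) by rewrite cls_tt.
have hs : ss 2 (tt 2 x) = tt 2 x by exact: sttK.
have lk := tau_loop H k2 hs us; rewrite cls_tt // in lk.
(* The given strategy contracts the 2-cell [tt 2 x]: its value there is an invertible 3-cell that
   ends at the identity of a normal form, as required of the connecting loop. *)
apply: (act_comm N3 (k := io F (tau 2 u (tt 2 x))) (e := tt 2 (io F y))) => //.
- exact: (loop_io F lk).
- by rewrite (good_tt ga ux) // -io_tt -io_ss tt_rho // (tau_ss H).
- by rewrite -io_tt (tau_tt H) // /hat /= cls_tt.
- by exists (io F (inv 2 (tau 2 u (tt 2 x)))); apply: isinv_io => //; exact: (tau_inv H k2 hs us).
- by rewrite sttK.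
- by rewrite sstt // ssss.
- by rewrite tttt // ttss.
- by rewrite (good_tt gb vy) // /r -tt_rho // (rho_io F).
Qed.

(** For i > 0 this is interchange in [Y]. For i = 0 the loops are composed at level 1: the case j >
    1 is again an interchange, of 1 and j, whereas for j = 1 two loops have to exchange places, by
    [good_comm]. *)
Lemma fop_inter i j x y z (w : X) a b c d : i < j -> j <= m ->
  tt j x = ss j y -> tt j z = ss j w -> tt i x = ss i z ->
  good x a -> good y b -> good z c -> good w d ->
  fop i (x *[j] y) (z *[j] w) (fop j x y a b) (fop j z w c d) =
  fop j (x *[i] z) (y *[i] w) (fop i x z a c) (fop i y w b d).
Proof.
move=> ij jm xy zw xz ga gb gc gd.
have im : i <= m by rewrite ltnW // (leq_trans ij).
have jn : j < n by rewrite ltnS.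
have in' : i < n by rewrite ltnS.
have j0 : 0 < j by apply: leq_ltn_trans ij.
have [t1 t2] := ss0_lt xy ij; have [t3 t4] := ss0_lt zw ij.
have yw : tt i y = ss i w by rewrite -t2 xz t3.
have c1 : tt i (x *[j] y) = ss i (z *[j] w).
  by have [_ ->] := ss_cp_lt jn xy ij; have [-> _] := ss_cp_lt jn zw ij.
have c2 : tt j (x *[i] z) = ss j (y *[i] w) by rewrite tt_cp_gt // ss_cp_gt // xy zw.
have gab := good_op jm xy ga gb; have gcd := good_op jm zw gc gd.
have gac := good_op im xz ga gc; have gbd := good_op im yw gb gd.
have g1 := good_op im c1 gab gcd; have g2 := good_op jm c2 gac gbd.
rewrite -cp_inter // in g2; apply: (good_ext g1 g2) => u /(cc_cp u im c1)/(cc_cp u jm xy) ux.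
have uxz : cc u (cls S (x *[i] z)) by apply/cc_cp.
have uxy : cc u (cls S (x *[j] y)) by apply/cc_cp.
have clxy := cls_comp S j0 xy; have clzw := cls_comp S j0 zw.
have uy : cc u (cls S y) by rewrite -clxy.
have ab := good_comp ga gb ux.
case: i ij im in' xz yw c1 c2 t1 t2 t3 t4 gac gbd uxz {g1 g2} => [|i] ij im in' xz yw c1 c2 t1 t2 t3 t4 gac gbd uxz; last first.
  have uz : cc u (cls S z) by rewrite -(cls_comp S (ltn0Sn i) xz).
  rewrite !fopS // cp_inter //.
  - exact: ltnW.
  - by apply: ab => //; rewrite j0.
  - by apply: (good_comp gc gd) => //; rewrite j0.
  - by apply: (good_comp ga gc).
have vz := cc_next ux xz.
have clx : cls S (x *[j] y) = cls S x by exact: (cls_cp S).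
rewrite fop0 // (@fopS j _ _ _ _ _ uxz) // fop0 // fop0 // clx (@fopS j _ _ _ _ _ ux) // -clxy.
set v := arrow_cmp u (cls S x) in vz *; rewrite (@fopS j _ _ _ _ _ vz) //.
have vw : cc v (cls S w) by rewrite -clzw.
have la := good_loop ga ux; have lb := good_loop gb uy; rewrite -clxy in lb.
have lc := good_loop gc vz; have ld := good_loop gd vw; rewrite -clzw in ld.
have cz : cls S' (io F (ss 1 z)) = cls S z by rewrite (cls_io F) cls_ss.
have cw : cls S' (io F (ss 1 w)) = cls S z by rewrite (cls_io F) cls_ss.
have hz : ss 1 (io F (ss 1 z)) = io F (ss 1 z) by rewrite -io_ss ss1_ss1.
have hw : ss 1 (io F (ss 1 w)) = io F (ss 1 w) by rewrite -io_ss ss1_ss1.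
have vz' : cc v (cls S' (io F (ss 1 z))) by rewrite cz.
have vw' : cc v (cls S' (io F (ss 1 w))) by rewrite cw.
have cab : tt j (a u) = ss j (b u) by apply: ab => //; rewrite j0.
have ccd : tt j (c v) = ss j (d v) by apply: (good_comp gc gd) => //; rewrite j0.
have [A1 A2] := act_loop hz vz' la; have [B1 B2] := act_loop hz vz' lb.
have [A1' A2'] := act_loop hw vw' la; have [B1' B2'] := act_loop hw vw' lb.
rewrite cz in A1 A2 B1 B2; rewrite cw in A1' A2' B1' B2'.
have [C1 C2] := lc; have [D1 D2] := ld.
have N1 : 1 < n.+1 by exact: ltnW.
move: (j0); rewrite leq_eqVlt => /predU1P[j1|j1]; last first.
  have e1 : ss 1 (z *[j] w) = ss 1 z by have [] := ss_cp_lt jn zw j1.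
  have e2 : ss 1 w = ss 1 z by have [] := ss0_lt zw j1.
  have jn1 : j < n.+1 by exact: ltnW jn.
  rewrite e1 e2 act_cp // cp_inter //.
  - by rewrite tt_act // ss_act // cab.
  - by rewrite A2 C1.
subst j; have e1 : ss 1 (z *[1] w) = ss 1 z by rewrite ss_cp.
rewrite e1 act_cp // -zw.
have K := good_comm gb gc uy; rewrite /= -clxy -/v in K; have {}K := K (etrans (esym t2) xz).
have hB3 := act_loop hw vw' lb; rewrite cw in hB3; have [B3 B4] := hB3.
rewrite zw in K *.
move: A2 B1 B2 B3 B4 C1 C2 D1 K.
set p := act _ _ _ (a u); set q := act _ _ _ (b u); set q' := act _ _ _ (b u).
move=> A2 B1 B2 B3 B4 C1 C2 D1 K.
have d1 : tt 1 p = ss 1 q by rewrite A2.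
have d2 : tt 1 q = ss 1 (c v) by rewrite B2.
have d3 : tt 1 (c v) = ss 1 (d v) by rewrite C2.
have d4 : tt 1 (c v) = ss 1 q' by rewrite C2.
have d5 : tt 1 q' = ss 1 (d v) by rewrite B4.
have d6 : tt 1 p = ss 1 (c v) by rewrite A2.
have d7 : tt 1 q = ss 1 (c v *[1] d v) by rewrite ss_cp.
have d8 : tt 1 (c v) = ss 1 (q' *[1] d v) by rewrite ss_cp.
by rewrite -cpA // (@cpA _ _ 1 q) // K -(@cpA _ _ 1 (c v)) // cpA.
Qed.

Lemma strategy_top : exists T : arrow C -> X -> Y,
  [/\ forall u (x : W), cc u (cls S (io G x)) -> T u (io G x) = r u (io G x),
      forall u x, cc u (cls S x) -> ss n (T u x) = r u x /\ tt n (T u x) = h u x,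
      forall i u x y, cc u (cls S x) -> 0 < i < n -> tt i x = ss i y ->
        T u (x *[i] y) = T u x *[i] T u y &
      forall u x y, cc u (cls S x) -> tt 0 x = ss 0 y ->
        T u (x *[0] y) = act S' (arrow_cmp u (cls S x)) (io F (ss 1 y)) (T u x) *[1]
                         T (arrow_cmp u (cls S x)) y].
Proof.
have [T [TU TG TI TC Tgood]] := fo_rec good_U good_G good_I good_op fop_unitl
  fop_unitr fop_assoc fU_cp fop_inter (fun b => (inv_laws b).1) (fun b => (inv_laws b).2).
exists (fun u x => T x u); split.
- by move=> u x ux; rewrite TU fUE.
- by move=> u x ux; have [h1 _] := Tgood x u; exact: h1.
- by move=> i u x y ux /andP[i0 iN] e; rewrite TC // fopS.
- by move=> u x y ux e; rewrite TC // fop0.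
Qed.

(** The old contractions are kept below dimension n, and the new one is added in dimension n. The
    second clause expresses its target through the old strategy, the form in which brackets are
    compared later. *)
Lemma strategy_step : exists tau' : nat -> arrow C -> Y -> Y, strategy S' tau' /\
  forall u x, cc u (cls S x) ->
    tt n (tau' n u (io F x)) = io F (hat S tau n u x).
Proof.
have [T [TU TB TC TC0]] := strategy_top.
pose tau' d u (y : Y) := if d < n then io F (tau d u (sf F y)) else T u (sf F y).
have n2 : 1 < n.+1 by exact: ltnW.
have lo d u (y : Y) : d < n -> tau' d u y = io F (tau d u (sf F y)).
  by rewrite /tau' => ->.
have hi u (y : Y) : tau' n u y = T u (sf F y) by rewrite /tau' ltnn.
have sfix d (y : Y) : d <= n -> ss d y = y -> ss d (sf F y) = sf F y.
  by move=> dn e; rewrite -sf_ss // e.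
have hatE d u (y : Y) : 1 < d <= n -> cc u (cls S' y) ->
    hat S' tau' d u y = io F (hat S tau d u (sf F y)).
  move=> /andP[d1 dn] uy; rewrite /hat; case: eqP => // d2.
  have e1 : 1 < d.-1 < n by lia.
  have e2 : d.-1 < n by lia.
  have us : cc u (cls S (ss d.-1 (sf F y))) by rewrite cls_ss //; lia.
  have ut : cc u (cls S (tt d.-1 (sf F y))) by rewrite cls_tt //; lia.
  have fs : ss d.-1 (ss d.-1 (sf F y)) = ss d.-1 (sf F y) by exact: ssss.
  have ft : ss d.-1 (tt d.-1 (sf F y)) = tt d.-1 (sf F y) by exact: sttK.
  have [_ i2 i3 _] := hat_comp H e1 uy.
  rewrite !lo // sf_ss ?sf_tt // ?(ltnW e2) // io_cp //; congr (_ *[_] _).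
  by apply: inv_eq; [exact: ltnW|exact: isinv_io].
exists tau'; split; last by move=> u x ux; rewrite hi sf_io (TB _ _ ux).2.
split.
- move=> d u y /andP[d1]; rewrite ltnS leq_eqVlt => /predU1P[->|dn] hy uy.
    by rewrite ss_id.
  rewrite lo // -io_ss (tau_ssS H) ?d1 //; exact: sfix (ltnW dn) hy.
- move=> d u y /andP[d1]; rewrite ltnS leq_eqVlt => /predU1P[->|dn] hy uy.
    by rewrite hi (TB _ _ uy).1 /r -(rho_io F) // io_sf hy.
  rewrite lo // -io_ss (tau_ss H) ?d1 //; last exact: sfix (ltnW dn) hy.
  by rewrite -(rho_io F) // (io_sfK F (ltnW dn)).
- move=> d u y /andP[d1]; rewrite ltnS leq_eqVlt => /predU1P[->|dn] hy uy.
    by rewrite hi (TB _ _ uy).2 hatE // n1 leqnn.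
  rewrite lo // -io_tt (tau_tt H) ?d1 ?hatE ?d1 ?(ltnW dn) //; exact: sfix (ltnW dn) hy.
- move=> d i u y z /andP[d1]; rewrite ltnS leq_eqVlt => /predU1P[->|dn] hy hz uy /andP[i0 id] e.
    by rewrite !hi sf_cp // TC ?i0 //; exact: sf_comp.
  have in' := ltn_trans id dn; have e' := sf_comp F in' e.
  have hy' := sfix _ _ (ltnW dn) hy; have hz' := sfix _ _ (ltnW dn) hz.
  have dn' : 1 < d < n by rewrite d1.
  have id' : 0 < i < d by rewrite i0.
  by rewrite !lo // sf_cp // (tau_cp H) // io_cp //; exact: (tau_comp H dn').
- move=> d u y z /andP[d1]; rewrite ltnS leq_eqVlt => /predU1P[->|dn] hy hz uy e.
    rewrite !hi sf_cp // TC0 //; last exact: sf_comp.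
    rewrite -sf_ss // io_sf ssK //.
  have e' := sf_comp F n0 e.
  have hy' := sfix _ _ (ltnW dn) hy; have hz' := sfix _ _ (ltnW dn) hz.
  have dn' : 1 < d < n by rewrite d1.
  rewrite !lo // sf_cp // (tau_cp0 H) //.
  have uz := cc_next uy e'; have lt := tau_loop H dn' hy' uy.
  have lz := tau_loop H dn' hz' uz.
  have vq := cc_ss1 uz; have hq := ss1_ss1 (sf F z).
  have la := act_loop hq vq lt.
  rewrite io_cp //; last by have [_ ->] := la; have [-> _] := lz; rewrite cls_ss.
  rewrite -(act_io F hq vq lt) -sf_ss // io_sf ssK //.
- move=> d u y /andP[d1]; rewrite ltnS leq_eqVlt => /predU1P[->|dn] hy uy.
    have e1 : io G (sf G (sf F y)) = sf F y.
      by rewrite io_sf; have := sfix m y (leqnSn m) hy.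
    by rewrite hi -e1 TU ?e1 // /r -(rho_io F) // io_sf (fix_le m _ hy).
  have hy' : ss d.-1 (sf F y) = sf F y by apply: sfix => //; lia.
  rewrite lo // (tau_unit H) ?d1 // -(rho_io F) // (io_sfK F _ hy) //; lia.
Qed.
End Step.

(** * Fox derivatives and exactness *)

(* Fox derivatives: additive for the higher compositions and satisfying the
   Leibniz rule for the composition of 1-cells. *)
Definition derivation (C : category) (n : nat) (X : ocat n) (c : X -> arrow C)
    (D : Type) (br : X -> fab (triples C D)) : Prop :=
  forall i x y, i < n -> tt i x = ss i y ->
    br (x *[i] y) =
    (if i is 0 then ract (c y) (br x) + lact (c x) (br y) else br x + br y)%R.

Section Bracket.
Context (C : category) (n : nat) (X : ocat n) (Y : ocat n.+1).
Context (A : Type) (bs bt : A -> X) (F : free_over Y bs bt) (S : cstr C Y).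
Let n0 : 0 < n := N_gt1 S.

Definition label (a : A) : arrow C := cls S (gn F a).

Definition bracket (br : Y -> fab (triples C A)) : Prop :=
  [/\ forall x, br (io F x) = 0%R,
      forall a, br (gn F a) = gena label a,
      derivation (cls S) br &
      forall y, homog label (cls S y) (br y)].

Lemma cls_cc0 (x y : Y) : tt 0 x = ss 0 y -> cc (cls S x) (cls S y).
Proof. by move/(cls_cc S). Qed.

(** In an abelian group, interchange is the rearrangement of a sum of four terms; when the
    composition 0 is involved, it also relies on [cls] being unchanged by compositions of positive
    index. *)
Lemma bracket_exists : exists br, bracket br.
Proof.
(* A generator and its inverse are composed at level n > 0, where brackets are added. *)
have matchn (T : Type) (p q : T) : (if n is 0 then p else q) = q by case: (n) n0.
pose op (i : nat) (x y : Y) (a b : fab (triples C A)) : fab (triples C A) :=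
  (if i is 0 then ract (cls S y) a + lact (cls S x) b else a + b)%R.
pose good (y : Y) z := homog label (cls S y) z.
have cls_gi a : cls S (gi F a) = label a.
  by apply: (cls_comp S n0); rewrite ttn_gi ssn_gn.
have gU x : good (io F x) 0%R by exact: supported0.
have gG a : good (gn F a) (gena label a) by exact: homog_gena.
have gI a : good (gi F a) (- gena label a)%R.
  rewrite /good cls_gi -sub0r; apply: supportedB; first exact: supported0.
  exact: homog_gena.
have gC i x y a b : i <= n -> tt i x = ss i y -> good x a -> good y b ->
    good (x *[i] y) (op i x y a b).
  case: i => [_ e|i im e] ga gb; rewrite /good.
    have xy := cls_cc0 e.
    rewrite cls_cp0 //; apply: supportedD; first exact: homog_ract.
    exact: homog_lact.
  rewrite (cls_cp S) //; apply: supportedD => //; rewrite (cls_comp S _ e) //.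
have u1 i x a z : i <= n -> good x a -> io F z = ss i x ->
    op i (io F z) x 0%R a = a.
  case: i => [|i] _ ga e; last by rewrite /op add0r.
  by rewrite /op raddf0 add0r e cls_ss0; apply: lact1 ga _.
have u2 i x a z : i <= n -> good x a -> io F z = tt i x ->
    op i x (io F z) a 0%R = a.
  case: i => [|i] _ ga e; last by rewrite /op addr0.
  by rewrite /op raddf0 addr0 e cls_tt0; apply: ract1 ga _.
have as_ i x y z a b c : i <= n -> tt i x = ss i y -> tt i y = ss i z ->
    good x a -> good y b -> good z c ->
    op i (x *[i] y) z (op i x y a b) c = op i x (y *[i] z) a (op i y z b c).
  case: i => [|i] _ xy yz ga gb gc; last by rewrite /op addrA.
  have cxy := cls_cc0 xy; have cyz := cls_cc0 yz.
  by rewrite /op !cls_cp0 // !raddfD /= ractM // lactM // lract addrA.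
have iv a : op n (gn F a) (gi F a) (gena label a) (- gena label a)%R = 0%R.
  by rewrite /op matchn subrr.
have iv' a : op n (gi F a) (gn F a) (- gena label a)%R (gena label a) = 0%R.
  by rewrite /op matchn addNr.
have uc i (x y : X) : i < n -> tt i x = ss i y ->
    0%R = op i (io F x) (io F y) 0%R 0%R.
  by case: i => [|i] _ _; rewrite /op ?raddf0 addr0.
have int_ i j x y z w a b c d : i < j -> j <= n ->
    tt j x = ss j y -> tt j z = ss j w -> tt i x = ss i z ->
    good x a -> good y b -> good z c -> good w d ->
    op i (x *[j] y) (z *[j] w) (op j x y a b) (op j z w c d) =
    op j (x *[i] z) (y *[i] w) (op i x z a c) (op i y w b d).
  case: j => // j ij jn xy zw xz ga gb gc gd.
  case: i ij xz => [|i] ij xz; last by rewrite /op addrACA.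
  rewrite /op !(cls_cp S) // (cls_comp S _ xy) // (cls_comp S _ zw) //.
  by rewrite !raddfD /= addrACA.
have [br [b1 b2 _ b3 b4]] := fo_rec gU gG gI gC u1 u2 as_ uc int_ iv iv'.
by exists br; split.
Qed.

Section BracketTheory.
Context (br : Y -> fab (triples C A)) (Hb : bracket br).
Implicit Types (x y z : Y) (u v w : arrow C).

Lemma br_homog y : homog label (cls S y) (br y).
Proof. by case: Hb. Qed.

Lemma br_cp0 x y : tt 0 x = ss 0 y ->
  br (x *[0] y) = (ract (cls S y) (br x) + lact (cls S x) (br y))%R.
Proof. by case: Hb => _ _ d _ /(d 0 x y (ltn0Sn n)). Qed.

Lemma br_cpS i x y : 0 < i <= n -> tt i x = ss i y ->
  br (x *[i] y) = (br x + br y)%R.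
Proof. by case: i => // i iN; case: Hb => _ _ d _ /(d i.+1 x y); apply. Qed.

Lemma br_fix i y : i <= n -> ss i y = y -> br y = 0%R.
Proof. by move=> im /(io_sfK F im) <-; case: Hb. Qed.

Lemma br_isinv i x y : 0 < i <= n -> isinv i x y -> br y = (- br x)%R.
Proof.
move=> /andP[i0 im] [e1 e2 e3 e4]; have := br_cpS (x := x) (y := y) (i := i).
rewrite i0 im => /(_ isT (esym e1)) /eqP; rewrite e3 (@br_fix i) //; last exact: ssss.
by rewrite eq_sym addrC addr_eq0 => /eqP.
Qed.

Lemma br_lft u : br (lft S u) = 0%R.
Proof. by apply: (@br_fix 1) => //; exact: ss_lft. Qed.

Lemma br_cj_lft a b u x : cc u (cls S x) -> ss 2 a = a -> ss 2 b = b ->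
  ss 1 (lft S u *[0] x) = ss 1 a -> tt 1 (lft S u *[0] x) = ss 1 b ->
  br (cj a b (lft S u *[0] x)) = (lact u (br x) - br a + br b)%R.
Proof.
move=> ux ha hb xa xb; have N1 : 1 < n.+1 by [].
have [h e1 e2 _ _] := inv2P (@inv2 _ _ _ S) ha.
have c1 : tt 1 (inv 1 a) = ss 1 (lft S u *[0] x) by rewrite e2.
have c2 : tt 1 (inv 1 a *[1] (lft S u *[0] x)) = ss 1 b by rewrite tt_cp.
have n01 : 0 < 1 <= n by [].
rewrite /cj br_cpS // br_cpS // (br_isinv n01 h) br_cp0 ?br_lft ?cls_lft; last exact: lft_comp.
by rewrite raddf0 add0r [(- _ + _)%R]addrC.
Qed.

Lemma br_rho u x : cc u (cls S x) ->
  br (rho S u x) =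
  (lact u (br x) - br (sg S u (ss 1 x)) + br (sg S u (tt 1 x)))%R.
Proof. by move=> ux; have [] := rho_fits ux; exact: br_cj_lft. Qed.

Hypothesis n2 : 1 < n.

(** For n > 1 the reductions, being 2-cells, come from [X] and have bracket 0. For n = 1 they are
    top cells, and the terms that [br_rho] keeps are those that make up [base_K]. *)
Lemma br_rho2 u x : cc u (cls S x) -> br (rho S u x) = lact u (br x).
Proof.
move=> ux; have [h1 h2 _ _] := rho_fits ux.
rewrite br_rho // (@br_fix 2 (sg S u (ss 1 x))) // (@br_fix 2 (sg S u (tt 1 x))) //.
by rewrite subr0 addr0.
Qed.

Lemma br_act w q x : ss 1 q = q -> cc w (cls S q) -> loop S w x ->
  br (act S w q x) = ract (cls S q) (br x).
Proof.
move=> hq wq lx; have [h1 h2 h3] := act_fits hq wq lx.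
have [h e1 e2 _ _] := inv2P (@inv2 _ _ _ S) h1.
have n01 : 0 < 1 <= n by [].
have N1 : 1 < n.+1 by [].
have c1 : tt 1 (inv 1 (sg S w q)) = ss 1 (x *[0] q) by rewrite e2.
have c2 : tt 1 (inv 1 (sg S w q) *[1] (x *[0] q)) = ss 1 (sg S w q) by rewrite tt_cp.
rewrite /act /cj br_cpS // br_cpS // (br_isinv n01 h) br_cp0; last exact: (loop_comp wq lx).
rewrite (@br_fix 2 (sg S w q)) // (@br_fix 1 q) //.
by rewrite oppr0 raddf0 add0r !addr0.
Qed.
End BracketTheory.

Context (D : Type) (l0 : D -> arrow C).
Context (c0 : X -> arrow C) (br0 : X -> fab (triples C D)).
Hypothesis c0E : forall x, c0 x = cls S (io F x).
Hypothesis h0 : forall x, homog l0 (c0 x) (br0 x).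
Hypothesis d0 : derivation c0 br0.

Definition bdry (a : A) : fab (triples C D) := (br0 (bs a) - br0 (bt a))%R.

Lemma bdry_homog a : homog l0 (label a) (bdry a).
Proof.
have e1 : c0 (bs a) = label a by rewrite c0E -ssn_gn cls_ss.
have e2 : c0 (bt a) = label a by rewrite c0E -ttn_gn cls_tt.
by rewrite /bdry; apply: supportedB; [rewrite -e1|rewrite -e2]; exact: h0.
Qed.

(** Both sides follow the same composition rules. At level n the bracket of the common face
    cancels. *)
Lemma bdry_bracket br y : bracket br ->
  bilin bdry (br y) = (br0 (sf F y) - br0 (tf F y))%R.
Proof.
move=> Hb; have := Hb => -[b1 b2 b3 _].
have cs z : c0 (sf F z) = cls S z by rewrite c0E io_sf cls_ss.
have ct z : c0 (tf F z) = cls S z by rewrite c0E io_tf cls_tt.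
have g a : bilin bdry (br (gn F a)) = (br0 (bs a) - br0 (bt a))%R.
  by rewrite b2 (bilin_gena bdry_homog).
elim/(@fo_ind _ _ _ _ _ _ F): y => [x|a|a|i x y im e ex ey].
- by rewrite b1 raddf0 sf_io tf_io subrr.
- by rewrite g sf_gn tf_gn.
- have nn : 0 < n <= n by rewrite n0 leqnn.
  by rewrite (br_isinv Hb nn (isinv_gn F a)) raddfN /= g sf_gi tf_gi opprB.
have := im; rewrite leq_eqVlt => /predU1P[ein|im'].
  subst i; rewrite (br_cpS Hb) ?n0 ?leqnn // raddfD /= ex ey sf_cpn // tf_cpn //.
  have -> : sf F y = tf F x by apply/esym/sftf_comp.
  by rewrite addrA subrK.
rewrite sf_cp // tf_cp // !d0 //; try exact: sf_comp; try exact: tf_comp.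
case: i im e im' => [|i] im e im'.
  rewrite (br_cp0 Hb) // raddfD /= bilin_ract bilin_lact ex ey !cs !ct.
  by rewrite !raddfB /= opprD addrACA.
by rewrite (br_cpS Hb) // raddfD /= ex ey opprD addrACA.
Qed.
End Bracket.

(** * Contracting homotopies from strategies *)

Section Contraction.
Context (C : category) (n : nat) (X : ocat n) (S : cstr C X).
Context (D B : Type) (tau : nat -> arrow C -> X -> X).
Context (br : X -> fab (triples C B)) (d : B -> fab (triples C D)).

(* The map K is the contracting homotopy in the degree just below that of X. *)
Definition contraction : Prop :=
  exists K : {additive fab (triples C D) -> fab (triples C B)},
    (forall v z, K (ract v z) = ract v (K z)) /\
    forall u f, cc u (cls S f) ->
      (br (rho S u f) - br (hat S tau n u f))%R =
      (lact u (br f) - K (lact u (bilin d (br f))))%R.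
End Contraction.

Section HomologyStep.
Context (C : category) (m : nat) (W : ocat m) (X : ocat m.+1) (Y : ocat m.+2).
Context (B A : Type) (cs ct : B -> W) (bs bt : A -> X).
Context (G : free_over X cs ct) (F : free_over Y bs bt).
Context (S : cstr C X) (tau : nat -> arrow C -> X -> X).
Let S' := cstr_free F S.
Let n := m.+1.
Context (tau' : nat -> arrow C -> Y -> Y).
Hypothesis H' : strategy S' tau'.
Hypothesis tau'_tt : forall u x, cc u (cls S x) ->
    tt n (tau' n u (io F x)) = io F (hat S tau n u x).
Context (brX : X -> fab (triples C B)) (brY : Y -> fab (triples C A)).
Hypotheses (HX : bracket G S brX) (HY : bracket F S' brY).
Context (D : Type) (d : B -> fab (triples C D)).
Hypothesis ctr : contraction S tau brX d.
Implicit Types (u v w : arrow C).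

Let n1 : 1 < n := N_gt1 S.
Let nN : 1 < n < n.+1. Proof. by rewrite n1 ltnSn. Qed.

Let T u (x : X) : Y := tau' n u (io F x).

Definition next_K : fab (triples C B) -> fab (triples C A) :=
  fab_lift (fun t => ract t.2 (brY (T t.1.1 (gn G t.1.2)))).
HB.instance Definition _ := GRing.Additive.on next_K.

Lemma next_K_ract v z : next_K (ract v z) = ract v (next_K z).
Proof.
elim/fab_ind: z => [|x y ex ey|[[u a] v']]; first by rewrite !raddf0.
  by rewrite !raddfB /= ex ey.
have [uv|uv] := pselect (cc v' v).
  by rewrite ractU // /next_K !fab_liftU /= ractM.
by rewrite ractU0 // /next_K fab_liftU /= ractM0 // !raddf0.
Qed.

Let io_fix (x : X) : ss n (io F x) = io F x := ssn_io F x.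

Lemma cls_ioF x : cls S' (io F x) = cls S x. Proof. exact: cls_io. Qed.

Lemma T_loop u x : cc u (cls S x) -> loop S' (arrow_cmp u (cls S x)) (T u x).
Proof.
move=> ux; rewrite -(cls_io F); apply: (tau_loop H') => //.
by rewrite (cls_io F).
Qed.

Lemma cls_T u x : cc u (cls S x) -> cls S' (T u x) = arrow_cmp u (cls S x).
Proof.
move=> ux; have [e _] := T_loop ux.
by rewrite -(cls_ss S' _ (ltn0Sn 0)) e cls_lft.
Qed.

Lemma T_cp i u x y : cc u (cls S x) -> 0 < i < n -> tt i x = ss i y ->
  T u (x *[i] y) = T u x *[i] T u y /\ tt i (T u x) = ss i (T u y).
Proof.
move=> ux /andP[i0 iN] e; have e' := io_comp F e.
rewrite -(cls_io F) in ux; split.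
  by rewrite /T io_cp // (tau_cp H') ?i0.
by apply: (tau_comp H') => //; rewrite i0.
Qed.

Lemma T_unit u (x : X) : cc u (cls S x) -> ss m x = x -> brY (T u x) = 0%R.
Proof.
move=> ux hx; have e1 : ss n.-1 (io F x) = io F x by rewrite -io_ss hx.
have e2 : cc u (cls S' (io F x)) by rewrite (cls_io F).
by rewrite /T (tau_unit H') // (rho_io F) //; case: HY.
Qed.

(** Both sides agree on generators by definition of [next_K] and obey the same rules on composites.
    The compatibility of the strategy with every composition is used here. *)
Lemma next_K_bracket x u : cc u (cls S x) ->
  next_K (lact u (brX x)) = brY (T u x).
Proof.
have m0 : 0 < m by exact: n1.
have n2 : 1 < n by [].
have gen b w : cc w (cls S (gn G b)) ->
    next_K (lact w (brX (gn G b))) = brY (T w (gn G b)).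
  move=> wb; have [_ -> _ _] := HX; rewrite /gena lactU //.
  rewrite arrow_cmpid; last by symmetry.
  rewrite /next_K fab_liftU /=; apply: ract1 (br_homog HY _) _.
  by rewrite cls_T // atgt_cmp.
have mn : 0 < m < n by rewrite m0 ltnSn.
have m01 : 0 < m <= m by rewrite m0 leqnn.
elim/(@fo_ind _ _ _ _ _ _ G): x u => [x|b|b|i x y im e IHx IHy] u ux.
- have [-> _ _ _] := HX; rewrite !raddf0 T_unit //; exact: ssn_io.
- exact: gen.
(* The composite of a generator and its inverse is a unit, whose contraction has bracket 0; the
   contractions of the two cells thus have opposite brackets. *)
- have cb : cls S (gi G b) = cls S (gn G b).
    by apply: (cls_comp S m0); rewrite ttn_gi ssn_gn.
  have ub : cc u (cls S (gn G b)) by rewrite -cb.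
  have e : tt m (gn G b) = ss m (gi G b) by rewrite ttn_gn ssn_gi.
  have [t1 t2] := T_cp ub mn e.
  have ucs : cc u (cls S (io G (cs b))) by rewrite -ssn_gn cls_ss.
  have e0 : brY (T u (io G (cs b))) = 0%R by apply: T_unit => //; exact: ssn_io.
  move: e0; rewrite -gn_gi t1 (br_cpS HY) //; last by rewrite m0 leqnSn.
  rewrite (br_isinv HX m01 (isinv_gn G b)) !raddfN /= gen // => /eqP.
  by rewrite addrC addr_eq0 => /eqP ->.
have in' : i < n by [].
case: i im e in' ux => [|i] im e in' ux; last first.
  have xi : 0 < i.+1 < n by [].
  have ux' : cc u (cls S x) by rewrite -(cls_cp S (ltn0Sn i) in' e).
  have uy : cc u (cls S y) by rewrite -(cls_comp S (ltn0Sn i) e).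
  have [t1 t2] := T_cp ux' xi e.
  rewrite t1 (br_cpS HY) //; last exact: ltnW.
  by rewrite (br_cpS HX) // !raddfD /= IHx // IHy.
have cxy : cc (cls S x) (cls S y) by apply/(cls_cc S).
have ux' : cc u (cls S x) by move: ux; rewrite cls_cp0 // => /(cc_cmpr u cxy).
have uy : cc (arrow_cmp u (cls S x)) (cls S y) by apply/cc_cmpl.
have e' := io_comp F e.
have ux'' : cc u (cls S' (io F x)) by rewrite (cls_io F).
rewrite (br_cp0 HX) // !raddfD /= lract next_K_ract lactM // IHx // IHy //.
have -> : T u (x *[0] y) =
    act S' (arrow_cmp u (cls S x)) (io F (ss 1 y)) (T u x) *[1] T (arrow_cmp u (cls S x)) y.
  by rewrite /T io_cp // (tau_cp0 H') // (cls_io F) io_ss.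
have vq : cc (arrow_cmp u (cls S x)) (cls S' (io F (ss 1 y))).
  by rewrite (cls_io F) cls_ss.
have hq : ss 1 (io F (ss 1 y)) = io F (ss 1 y) by rewrite -io_ss ss1_ss1.
have lx := T_loop ux'; have la := act_loop hq vq lx; have ly := T_loop uy.
have clq : cls S' (io F (ss 1 y)) = cls S y by rewrite (cls_io F) cls_ss.
rewrite (br_cpS HY) //; first by rewrite (br_act HY) // clq.
by have [_ ->] := la; have [-> _] := ly; rewrite clq.
Qed.

Let dY : A -> fab (triples C B) := bdry bs bt brX.

Lemma brX_der : derivation (cls S) brX. Proof. by case: HX. Qed.

Lemma dY_bracket y : bilin dY (brY y) = (brX (sf F y) - brX (tf F y))%R.
Proof.
apply: (@bdry_bracket _ _ _ _ _ _ _ F S' _ (label G S) (cls S)) => //.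
- by move=> x; rewrite cls_ioF.
- by move=> x; case: HX.
- exact: brX_der.
Qed.

(** The bracket of [hat] is the difference of the brackets of the contracted source and target of
    [f], that is, [next_K] of the boundary of the bracket of [f], acted upon by [u]. *)
Lemma contraction_step : contraction S' tau' brY dY.
Proof.
exists next_K; split=> [v z|u f uf]; first exact: next_K_ract.
have [h1 h2 h3 h4] := hat_comp H' nN uf.
have us : cc u (cls S (sf F f)) by [].
have ut : cc u (cls S (tf F f)) by rewrite -cls_ioF io_tf cls_tt // ltnW.
have nn : 0 < n <= n by rewrite leqnn.
rewrite (br_rho2 HY) // hatS // (br_cpS HY) // (br_isinv HY nn h2).
rewrite dY_bracket !raddfB /= !next_K_bracket // /T io_sf io_tf.
by [].
Qed.

Lemma exact_step w z : homog (label G S) w z -> bilin d z = 0%R ->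
  exists2 y, homog (label F S') w y & bilin dY y = z.
Proof.
have [K [Kr KE]] := ctr.
move=> hz dz; exists (next_K z).
  elim/homog_ind: hz {dz} => [|x y hx hy|u b v ub bv <-].
  - by rewrite raddf0; exact: supported0.
  - by rewrite raddfB; exact: supportedB.
  rewrite lract next_K_ract.
  have [_ <- _ _] := HX; rewrite next_K_bracket //.
  apply: homog_ract; last exact/cc_cmpl.
  by rewrite -cls_T //; exact: br_homog HY _.
(* The homotopy identity; on a cycle its last term vanishes. *)
suff : bilin dY (next_K z) = (z - K (bilin d z))%R by rewrite dz raddf0 subr0.
elim/homog_ind: hz {dz} => [|x y hx hy|u b v ub bv _].
- by rewrite !raddf0 addr0.
- by rewrite !raddfB /= hx hy opprD !opprK addrACA.
rewrite lract next_K_ract !bilin_ract Kr bilin_lact -raddfB /=; congr ract.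
have [_ <- _ _] := HX; rewrite next_K_bracket // dY_bracket -bilin_lact bilin_lact.
rewrite -KE //; congr (brX _ - brX _)%R; apply: (@io_inj _ _ _ _ _ _ F).
  rewrite io_sf (tau_ss H') //; last by rewrite (cls_io F).
  exact: (rho_io F).
by rewrite io_tf tau'_tt.
Qed.
End HomologyStep.

(** * The two-dimensional stage *)

Section Presentation.
Context (C : category) (G : graph) (R : cell_ext 1 (cat1 (free_cat G))).
Context (Phi : functor (free_cat G) C).
Hypothesis Phi_inj : injective (fob Phi).
Hypothesis Phi_surj : forall x : C, exists v, fob Phi v = x.
Hypothesis Phi_full : forall (v v' : vertex G) (f : hom (fob Phi v) (fob Phi v')),
  exists p : path v v', fhom Phi (p : @hom (free_cat G) v v') = f.

Let C1 := cat1 (free_cat G).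
Let X1 := top_ocat C1.
Let X2 := top_ocat (free_ext R).
Let F : @free_over 1 X1 X2 R (ext_bs (A := R)) (ext_bt (A := R)) := ext_free_over R.

Definition im x y (p : path x y) : arrow C :=
  Arrow (fhom Phi (p : @hom (free_cat G) x y)).

Definition mk x y (p : path x y) : X1 :=
  @Top 1 C1 (inr (Arrow (p : @hom (free_cat G) x y))) erefl.

Lemma mkP (a : X1) : exists x y (p : path x y), a = mk p.
Proof.
case: a => a; case: a => [v d|[x y p] d]; first by discriminate d.
by exists x, y, p; exact: top_eq.
Qed.

Lemma ss0_mk x y (p : path x y) : ss 0 (mk p) = mk (pnil x).
Proof. exact: top_eq. Qed.

Lemma tt0_mk x y (p : path x y) : tt 0 (mk p) = mk (pnil y).
Proof. exact: top_eq. Qed.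

Lemma mk_nil_inj x y : mk (pnil x) = mk (pnil y) -> x = y.
Proof.
exact: (congr1 (fun a : X1 => if tv a is inr f then asrc f else x)).
Qed.

Lemma cp0_mk x y z (p : path x y) (q : path y z) : mk p *[0] mk q = mk (pcat p q).
Proof.
apply: top_eq; rewrite tv_tcp //=; first by congr inr; exact: arrow_cmpE.
exact: top_eq.
Qed.

Lemma comp_mk x y y' z (p : path x y) (q : path y' z) :
  tt 0 (mk p) = ss 0 (mk q) <-> y = y'.
Proof.
rewrite tt0_mk ss0_mk; split=> [/mk_nil_inj //|->//].
Qed.

Definition cls1 (a : X1) : arrow C :=
  match tv a with inr f => im (amor f) | inl v => aid (fob Phi v) end.

Lemma cls1_mk x y (p : path x y) : cls1 (mk p) = im p. Proof. by []. Qed.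

Lemma im_cat x y z (p : path x y) (q : path y z) :
  im (pcat p q) = arrow_cmp (im p) (im q).
Proof. by rewrite /im arrow_cmpE -fhomM. Qed.

Lemma im_nil x : im (pnil x) = aid (fob Phi x).
Proof. by rewrite /im (fhom1 Phi x). Qed.

Lemma cls1_cc (a b : X1) : tt 0 a = ss 0 b <-> cc (cls1 a) (cls1 b).
Proof.
have [x [y [p ->]]] := mkP a; have [x' [y' [q ->]]] := mkP b.
by rewrite comp_mk /cc /=; split=> [->|/Phi_inj].
Qed.

Lemma cls1_cp (a b : X1) : tt 0 a = ss 0 b ->
  cls1 (a *[0] b) = arrow_cmp (cls1 a) (cls1 b).
Proof.
have [x [y [p ->]]] := mkP a; have [x' [y' [q ->]]] := mkP b.
by move/comp_mk=> e; subst x'; rewrite cp0_mk !cls1_mk im_cat.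
Qed.

Lemma cls1_ss (a : X1) : cls1 (ss 0 a) = aid (asrc (cls1 a)).
Proof. by have [x [y [p ->]]] := mkP a; rewrite ss0_mk cls1_mk im_nil. Qed.

Lemma cls1_tt (a : X1) : cls1 (tt 0 a) = aid (atgt (cls1 a)).
Proof. by have [x [y [p ->]]] := mkP a; rewrite tt0_mk cls1_mk im_nil. Qed.

Lemma im_surj (u : arrow C) : exists a : X1, cls1 a = u.
Proof.
case: u => x y f; have [v ev] := Phi_surj x; have [v' ev'] := Phi_surj y.
subst x y; have [p <-] := Phi_full f.
by exists (mk p).
Qed.

Definition lift1 (u : arrow C) : X1 := projT1 (cid (im_surj u)).

Lemma cls1_lift u : cls1 (lift1 u) = u.
Proof. by rewrite /lift1; case: cid. Qed.

(** Each rule of the congruence is realised by an operation on 2-cells; symmetry is the inversion of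
    2-cells. *)
Lemma congr_cell x y (p q : path x y) :
  congr (@ext_rel _ R) (p : @hom (free_cat G) x y) q ->
  exists z : X2, sf F z = mk p /\ tf F z = mk q.
Proof.
have inv1 : forall i (z : X2), 0 < i < 2 -> ss i.+1 z = z -> exists z', isinv i z z'.
  by apply: (free_invertible F) => // i z; case: i => [|[]].
elim=> {x y p q}.
- move=> x y f g [a [e1 e2]]; exists (gn F a); rewrite sf_gn tf_gn.
  by split; apply: top_eq.
- by move=> x y f; exists (io F (mk f)); rewrite sf_io tf_io.
- move=> x y f g _ [z [e1 e2]].
  have [z' [h1 h2 _ _]] := inv1 1 z isT (ss_id z (leqnn 2)).
  by exists z'; split; apply: (@io_inj _ _ _ _ _ _ F); rewrite ?io_sf ?io_tf
    ?h1 ?h2 -?(io_sf F) -?(io_tf F) ?e1 ?e2.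
- move=> x y f g h _ [z [e1 e2]] _ [z' [e3 e4]].
  have c : tt 1 z = ss 1 z' by apply/(sftf_comp F); rewrite e2 e3.
  by exists (z *[1] z'); rewrite sf_cpn // tf_cpn.
move=> x y z f f' g g' _ [a [e1 e2]] _ [b [e3 e4]].
have c0 : tt 0 (sf F a) = ss 0 (sf F b) by rewrite e1 e3; apply/comp_mk.
have c : tt 0 a = ss 0 b.
  by rewrite -(ttss a (ltn0Sn 0)) -(io_sf F) -(io_tt F) c0 (io_ss F) io_sf ssss.
exists (a *[0] b); rewrite sf_cp // tf_cp // e1 e2 e3 e4.
by split; exact: cp0_mk.
Qed.

Hypothesis Phi_rel : forall a : R, cls1 (ext_bs a) = cls1 (ext_bt a).
Hypothesis Phi_congr : forall x y (p q : path x y), im p = im q ->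
  congr (@ext_rel _ R) (p : @hom (free_cat G) x y) q.

Lemma cls1_tf (z : X2) : cls1 (sf F z) = cls1 (tf F z).
Proof.
elim/(@fo_ind _ _ _ _ _ _ F): z => [x|a|a|i x y]; rewrite ?sf_io ?tf_io //.
- by rewrite sf_gn tf_gn.
- by rewrite sf_gi tf_gi.
case: i => [_ e ex ey|[_ e ex ey|//]].
  by rewrite sf_cp // tf_cp // !cls1_cp ?ex ?ey //; [exact: tf_comp|exact: sf_comp].
rewrite sf_cpn // tf_cpn // ex -ey; congr cls1.
exact/sftf_comp.
Qed.

Lemma cell_exists (a b : X1) : cls1 a = cls1 b ->
  exists z : X2, sf F z = a /\ tf F z = b.
Proof.
have [x [y [p ->]]] := mkP a; have [x' [y' [q ->]]] := mkP b => e.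
have ex : x = x' by apply: Phi_inj; exact: (congr1 (@asrc C) e).
have ey : y = y' by apply: Phi_inj; exact: (congr1 (@atgt C) e).
by subst x' y'; apply: congr_cell; exact: Phi_congr.
Qed.

Definition edge_path (e : edge G) : path (esrc e) (etgt e) := pcons (pnil (etgt e)).
Definition elabel (e : edge G) : arrow C := im (edge_path e).

Lemma pcons_cat e y (p : path (etgt e) y) : pcons p = pcat (edge_path e) p.
Proof. by []. Qed.

Lemma red_exists u e : exists z : X2, cc u (elabel e) ->
  sf F z = lift1 u *[0] mk (edge_path e) /\ tf F z = lift1 (arrow_cmp u (elabel e)).
Proof.
have [ue|nue] := pselect (cc u (elabel e)); last by exists (io F (lift1 u)).
have c : tt 0 (lift1 u) = ss 0 (mk (edge_path e)) by apply/cls1_cc; rewrite cls1_lift.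
have [|z hz] := @cell_exists (lift1 u *[0] mk (edge_path e)) (lift1 (arrow_cmp u (elabel e))).
  by rewrite cls1_cp // !cls1_lift.
by exists z.
Qed.

Definition red u e : X2 := projT1 (cid (red_exists u e)).

Lemma redP u e : cc u (elabel e) ->
  sf F (red u e) = lift1 u *[0] mk (edge_path e) /\
  tf F (red u e) = lift1 (arrow_cmp u (elabel e)).
Proof. by rewrite /red; case: cid. Qed.

(** Reducing a path edge by edge makes [sg_cp] hold strictly, which independent choices of a
    reduction for each path would not ensure. *)
Fixpoint redp u x y (p : path x y) : X2 :=
  match p with
  | pnil _ => io F (lift1 u)
  | pcons e _ p' => (red u e *[0] io F (mk p')) *[1] redp (arrow_cmp u (elabel e)) p'
  end.

Lemma redp_nil u x : redp u (pnil x) = io F (lift1 u). Proof. by []. Qed.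

Lemma redp_cons u e y (p : path (etgt e) y) : redp u (pcons p) =
  (red u e *[0] io F (mk p)) *[1] redp (arrow_cmp u (elabel e)) p.
Proof. by []. Qed.

Lemma cc_edge u e y (p : path (etgt e) y) : cc u (im (pcons p)) -> cc u (elabel e).
Proof. by []. Qed.

Lemma cc_tail u e y (p : path (etgt e) y) : cc u (im (pcons p)) ->
  cc (arrow_cmp u (elabel e)) (im p).
Proof. by move=> h; apply/cc_cmpl. Qed.

Lemma cmp_edge u e y (p : path (etgt e) y) : cc u (elabel e) ->
  arrow_cmp (arrow_cmp u (elabel e)) (im p) = arrow_cmp u (im (pcons p)).
Proof. by move=> h; rewrite pcons_cat im_cat arrow_cmpA. Qed.

Lemma lift_comp1 u x y (p : path x y) : cc u (im p) -> tt 0 (lift1 u) = ss 0 (mk p).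
Proof. by move=> h; apply/cls1_cc; rewrite cls1_lift. Qed.

Lemma comp2 (a b : X2) : tt 0 (sf F a) = ss 0 (sf F b) -> tt 0 a = ss 0 b.
Proof.
by move=> c; rewrite -(ttss a (ltn0Sn 0)) -(io_sf F) -(io_tt F) c (io_ss F) io_sf ssss.
Qed.

Lemma red_comp u e y (p : path (etgt e) y) : cc u (elabel e) ->
  tt 0 (red u e) = ss 0 (io F (mk p)).
Proof.
move=> ue; have [e1 e2] := redP ue; apply: comp2.
rewrite e1 sf_io tt_cp //; first exact/comp_mk.
exact: lift_comp1.
Qed.

Lemma redpP u x y (p : path x y) : cc u (im p) ->
  sf F (redp u p) = lift1 u *[0] mk p /\ tf F (redp u p) = lift1 (arrow_cmp u (im p)).
Proof.
elim: p u => [z|e z p IH] u up.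
  rewrite redp_nil sf_io tf_io im_nil arrow_cmpid; last exact: esym.
  have c := lift_comp1 up.
  by rewrite -(ss0_mk (pnil z)) -c cpx1.
have ue := cc_edge up; have [e1 e2] := redP ue.
have [h1 h2] := IH _ (cc_tail up); have c1 := red_comp p ue.
have c2 := lift_comp1 ue.
have c3 : tt 1 (red u e *[0] io F (mk p)) = ss 1 (redp (arrow_cmp u (elabel e)) p).
  by apply/(sftf_comp F); rewrite tf_cp // e2 tf_io h1.
rewrite redp_cons sf_cpn // tf_cpn // sf_cp // e1 sf_io h2 cmp_edge //; split=> //.
rewrite pcons_cat -cp0_mk cpA //; exact/comp_mk.
Qed.

Definition sg2 u (x : X2) : X2 :=
  match tv (sf F x) with inr f => redp u (amor f) | inl _ => io F (lift1 u) end.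

Lemma sg2_mk u x y (p : path x y) : sg2 u (io F (mk p)) = redp u p.
Proof. by rewrite /sg2 sf_io. Qed.

Lemma cell1P (x : X2) : ss 1 x = x -> exists a b (p : path a b), x = io F (mk p).
Proof.
move=> e; have [a [b [p ep]]] := mkP (sf F x); exists a, b, p.
by rewrite -ep io_sf e.
Qed.

Lemma redp_cat u x y z (p : path x y) (q : path y z) : cc u (im p) ->
  redp u (pcat p q) = (redp u p *[0] io F (mk q)) *[1] redp (arrow_cmp u (im p)) q.
Proof.
elim: p u q => [a|e a p IH] u q up.
  rewrite redp_nil [pcat _ _]/=.
  have uq : cc u (im q) by exact: up.
  rewrite im_nil arrow_cmpid; last exact: esym.
  have [h1 _] := redpP uq.
  by rewrite -io_cp ?(lift_comp1 uq) // -h1 io_sf cp1x.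
have ue := cc_edge up; have ut := cc_tail up.
have [h1 h2] := redpP ut; have [e1 e2] := redP ue.
have pq : tt 0 (mk p) = ss 0 (mk q) by apply/comp_mk.
have upq : cc (arrow_cmp u (elabel e)) (im (pcat p q)) by exact: ut.
have uq : cc (arrow_cmp (arrow_cmp u (elabel e)) (im p)) (im q).
  by apply/cc_cmpl => //; exact/cls1_cc.
have [k1 k2] := redpP uq.
rewrite [pcat _ _]/= !redp_cons IH // -cmp_edge // -cp0_mk io_cp //.
have c1 := red_comp p ue; have c1' := red_comp (pcat p q) ue.
have c2 : tt 0 (redp (arrow_cmp u (elabel e)) p) = ss 0 (io F (mk q)).
  apply: comp2; rewrite h1 sf_io tt_cp //.
  exact: lift_comp1.
have c3 : tt 1 (red u e *[0] io F (mk p)) = ss 1 (redp (arrow_cmp u (elabel e)) p).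
  by apply/(sftf_comp F); rewrite tf_cp // e2 tf_io h1.
have c4 : tt 0 (red u e *[0] io F (mk p)) = ss 0 (io F (mk q)).
  by rewrite tt_cp // -io_tt -io_ss pq.
have f1 : tt 1 (red u e *[0] io F (mk p) *[0] io F (mk q)) =
    ss 1 (redp (arrow_cmp u (elabel e)) p *[0] io F (mk q)).
  by rewrite tt_cp_gt // ss_cp_gt // c3 ttn_io ssn_io.
rewrite (@cp_wh _ X2 1) // ?ssn_io // (@cpA _ X2 0) //.
  rewrite (@cpA _ X2 1) //.
  by apply/(sftf_comp F); rewrite tf_cp // h2 tf_io k1.
exact: io_comp.
Qed.

Definition cstr_base : cstr C X2.
Proof.
apply: (@Cstr C 2 X2 (fun x => cls1 (sf F x)) (fun u => io F (lift1 u)) sg2) => //.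
- move=> [|[|i]] x // _; last by rewrite ss_id.
  by rewrite sf_ss // ss_id.
- move=> [|[|i]] x // _; last by rewrite tt_id.
  rewrite [RHS]cls1_tf; congr cls1; apply: (@io_inj _ _ _ _ _ _ F).
  by rewrite io_sf sttK // io_tf.
- by move=> x; rewrite sf_ss // cls1_ss.
- by move=> x; rewrite sf_tt // cls1_tt.
- by move=> x y e; rewrite sf_cp // cls1_cp //; exact: sf_comp.
- by move=> x y; rewrite -cls1_cc; split=> [e|/comp2//]; exact: sf_comp.
- by move=> u; exact: ssn_io.
- by move=> u; rewrite sf_io cls1_lift.
- by move=> u x _ _; exact: ss_id.
- move=> u x /cell1P[a [b [p ->]]]; rewrite sf_io sg2_mk => up.
  have [h1 _] := redpP up.
  rewrite -(io_sf F) h1 io_cp //; exact: lift_comp1.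
- move=> u x /cell1P[a [b [p ->]]]; rewrite sf_io sg2_mk => up.
  by have [_ h1] := redpP up; rewrite -(io_tf F) h1.
- move=> u x hx ux.
  have [a [b [p ep]]] := cell1P (fix_le 0 (leq0n 1) hx).
  move: hx; rewrite ep -io_ss ss0_mk => /io_inj /esym e.
  by rewrite e sg2_mk.
- move=> u x y /cell1P[a [b [p ->]]] /cell1P[a' [b' [q ->]]].
  rewrite sf_io => up; rewrite -io_tt -io_ss => /io_inj /comp_mk e; subst a'.
  by rewrite -io_cp; [rewrite cp0_mk !sg2_mk redp_cat|by []|exact/comp_mk].
- move=> i x i0 e; apply: (free_invertible F) e => //.
  by move=> [|j] // y /andP[].
Defined.

Local Notation S := cstr_base.
Local Notation E := (edge G).
Implicit Types (u v w : arrow C) (e : E).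

Fixpoint brp x y (p : path x y) : fab (triples C E) :=
  match p with
  | pnil _ => 0
  | pcons e _ p' => ract (im p') (gena elabel e) + lact (elabel e) (brp p')
  end%R.

Definition br0 (a : X1) : fab (triples C E) :=
  match tv a with inr f => brp (amor f) | inl _ => 0%R end.

Lemma br0_mk x y (p : path x y) : br0 (mk p) = brp p. Proof. by []. Qed.

Lemma brp_cons e y (p : path (etgt e) y) :
  brp (pcons p) = (ract (im p) (gena elabel e) + lact (elabel e) (brp p))%R.
Proof. by []. Qed.

Lemma im_cons e y (p : path (etgt e) y) :
  im (pcons p) = arrow_cmp (elabel e) (im p).
Proof. by rewrite pcons_cat im_cat. Qed.

Lemma brp_homog x y (p : path x y) : homog elabel (im p) (brp p).
Proof.
elim: p => [a|e z p IH]; first exact: supported0.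
rewrite im_cons; apply: supportedD; first by apply: homog_ract => //; exact: homog_gena.
exact: homog_lact.
Qed.

Lemma brp_cat x y z (p : path x y) (q : path y z) :
  brp (pcat p q) = (ract (im q) (brp p) + lact (im p) (brp q))%R.
Proof.
elim: p q => [a|e a p IH] q.
  by rewrite raddf0 add0r im_nil (lact1 (brp_homog q)).
rewrite [pcat _ _]/= !brp_cons IH im_cons im_cat !raddfD /= lract.
by rewrite ractM // lactM // addrA.
Qed.

Lemma br0_homog (a : X1) : homog elabel (cls1 a) (br0 a).
Proof. by have [x [y [p ->]]] := mkP a; exact: brp_homog. Qed.

Lemma br0_derivation : derivation cls1 br0.
Proof.
move=> [|//] a b _; have [x [y [p ->]]] := mkP a; have [x' [y' [q ->]]] := mkP b.
by move/comp_mk=> e; subst x'; rewrite cp0_mk !br0_mk brp_cat.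
Qed.

(** No d satisfies 1 < d < 2, so every clause is vacuous and the identity is a mere placeholder. *)
Lemma strategy_base : strategy S (fun _ _ x => x).
Proof. by split=> d *; exfalso; lia. Qed.

(** The boundary, in degree 0, of the bracket of any path with value [u], as [bilin_brp] shows by
    telescoping along the edges. *)
Definition circ u : fab (triples C C) :=
  (fabU (u, atgt u, aid (atgt u)) - fabU (aid (asrc u), asrc u, u))%R.

Definition edge_bd e : fab (triples C C) := circ (elabel e).

Lemma circ_act u v w : cc u v -> cc v w -> lact u (ract w (circ v)) =
  (fabU (arrow_cmp u v, atgt v, w) - fabU (u, asrc v, arrow_cmp v w))%R.
Proof.
move=> uv vw; rewrite /circ !raddfB /= !ractU // !lactU //.
by rewrite arrow_cmp1 // arrow_cmpid.
Qed.

Lemma circ_ract v w : cc v w -> ract w (circ v) =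
  (fabU (v, atgt v, w) - fabU (aid (asrc v), asrc v, arrow_cmp v w))%R.
Proof. by move=> vw; rewrite /circ !raddfB /= !ractU // arrow_cmp1. Qed.

Lemma circ_homog u : homog (@aid C) u (circ u).
Proof.
by apply: supportedB; apply: supportedU; split=> //=; rewrite ?arrow_cmpid ?arrow_cmp1.
Qed.

Lemma edge_bd_homog e : homog (@aid C) (elabel e) (edge_bd e).
Proof. exact: circ_homog. Qed.

Lemma edge_bd_augm e u v : cc u (elabel e) -> cc (elabel e) v ->
  augm (lact u (ract v (edge_bd e))) = 0%R.
Proof. by move=> ue ev; rewrite circ_act // raddfB /= /augm !fab_liftU subrr. Qed.

Lemma bilin_brp x y (p : path x y) : bilin edge_bd (brp p) = circ (im p).
Proof.
elim: p => [a|e a p IH]; first by rewrite raddf0 im_nil /circ subrr.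
rewrite brp_cons raddfD /= bilin_ract bilin_lact IH (bilin_gena edge_bd_homog).
rewrite im_cons circ_ract // -{1}[circ (im p)](ract1 (circ_homog _) erefl).
rewrite circ_act // arrow_cmpid // /circ atgt_cmp // asrc_cmp //.
by rewrite addrC addrA subrK.
Qed.

Lemma bilin_br0 (a : X1) : bilin edge_bd (br0 a) = circ (cls1 a).
Proof. by have [x [y [p ->]]] := mkP a; exact: bilin_brp. Qed.

Definition base_h : fab (triples C C) -> fab (triples C E) :=
  fab_lift (fun t => ract t.2 (br0 (lift1 t.1.1))).
HB.instance Definition _ := GRing.Additive.on base_h.

Lemma base_hU u x v : base_h (fabU (u, x, v)) = ract v (br0 (lift1 u)).
Proof. by rewrite /base_h fab_liftU. Qed.

(** The homotopy [base_h] sends (u, x, v) to the bracket of the normal form of u, acted upon by v;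
    its boundary joins (u, x, v) to (1, s, uv), with s the source of u. *)
Lemma base_exact0 w (z : fab (triples C C)) : homog (@aid C) w z -> augm z = 0%R ->
  exists2 y, homog elabel w y & bilin edge_bd y = z.
Proof.
move=> hz az; exists (base_h z).
  elim/homog_ind: hz {az} => [|x y hx hy|u a v ua av <-].
  - by rewrite raddf0; exact: supported0.
  - by rewrite raddfB; exact: supportedB.
  rewrite gena_act // base_hU; apply: homog_ract; last exact/cc_cmpl.
  rewrite arrow_cmpid; last exact: esym.
  by rewrite -{1}(cls1_lift u); exact: br0_homog.
(* Up to a boundary, every triple over [w] equals the triple whose left arrow is an identity; the
   augmentation counts how many copies of it are collected. *)
suff -> : bilin edge_bd (base_h z) = (z - fabU (aid (asrc w), asrc w, w) *~ augm z)%R.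
  by rewrite az mulr0z subr0.
elim/homog_ind: hz {az} => [|x y hx hy|u a v ua av <-].
- by rewrite !raddf0 ?mulr0z ?subr0 ?addr0 ?oppr0.
- by rewrite !raddfB /= hx hy !opprD !opprK addrACA.
have uv : cc u v by rewrite /cc -av.
have ea : atgt u = a by exact: ua.
rewrite gena_act // base_hU bilin_ract bilin_br0 cls1_lift circ_ract //.
by rewrite /augm fab_liftU (arrow_cmpid (esym ea)) mulr1z ea asrc_cmp.
Qed.

Context (brX : X2 -> fab (triples C R)) (HX : bracket F S brX).

Definition rel_bd (a : R) : fab (triples C E) := bdry (ext_bs (A := R)) (ext_bt (A := R)) br0 a.

Lemma cls1_cls (x : X1) : cls1 x = cls S (io F x).
Proof. by rewrite /= sf_io. Qed.

Lemma rel_bd_bracket y : bilin rel_bd (brX y) = (br0 (sf F y) - br0 (tf F y))%R.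
Proof.
apply: (@bdry_bracket _ _ _ _ _ _ _ F S _ elabel cls1) => //.
- exact: cls1_cls.
- exact: br0_homog.
- exact: br0_derivation.
Qed.

Lemma edge_bd_rel_bd a : bilin edge_bd (rel_bd a) = 0%R.
Proof. by rewrite /rel_bd /bdry raddfB /= !bilin_br0 Phi_rel subrr. Qed.

Lemma br0_edge e : br0 (mk (edge_path e)) = gena elabel e.
Proof.
rewrite br0_mk brp_cons raddf0 addr0 im_nil.
exact: ract1 (homog_gena _ _) _.
Qed.

Definition base_K : fab (triples C E) -> fab (triples C R) :=
  fab_lift (fun t => ract t.2 (brX (red t.1.1 t.1.2))).
HB.instance Definition _ := GRing.Additive.on base_K.

Lemma base_KU u e v : base_K (fabU (u, e, v)) = ract v (brX (red u e)).
Proof. by rewrite /base_K fab_liftU. Qed.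

Lemma base_K_ract v z : base_K (ract v z) = ract v (base_K z).
Proof.
elim/fab_ind: z => [|x y ex ey|[[u a] v']]; first by rewrite !raddf0.
  by rewrite !raddfB /= ex ey.
have [uv|uv] := pselect (cc v' v); first by rewrite ractU // !base_KU ractM.
by rewrite ractU0 // base_KU ractM0 // raddf0.
Qed.

(** The recursion that defines [redp] mirrors the Leibniz rule that defines [brp]. *)
Lemma base_K_brp u x y (p : path x y) : cc u (im p) ->
  base_K (lact u (brp p)) = brX (redp u p).
Proof.
elim: p u => [a|e a p IH] u up.
  by rewrite redp_nil !raddf0; case: HX => ->.
have ue := cc_edge up; have ut := cc_tail up.
have [h1 h2] := redpP ut; have [e1 e2] := redP ue; have c1 := red_comp p ue.
have c3 : tt 1 (red u e *[0] io F (mk p)) = ss 1 (redp (arrow_cmp u (elabel e)) p).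
  by apply/(sftf_comp F); rewrite tf_cp // e2 tf_io h1.
rewrite redp_cons brp_cons !raddfD /= gena_act // base_KU lactM // IH //.
rewrite (br_cpS HX) // (br_cp0 HX) //.
by have [-> _ _ _] := HX; rewrite raddf0 addr0 /= sf_io.
Qed.

(** In dimension 2, [hat] is the identity of a normal form and has bracket 0. The conjugation in
    [rho] contributes the brackets of the reductions of the two boundary paths, which [base_K_brp]
    computes. *)
Lemma contraction_base : contraction S (fun _ _ x => x) brX rel_bd.
Proof.
exists base_K; split=> [v z|u f uf]; first exact: base_K_ract.
rewrite (br_rho HX) // rel_bd_bracket -(io_sf F) -(io_tf F) (br_lft HX) subr0.
have uS : cc u (cls1 (sf F f)) by exact: uf.
have uT : cc u (cls1 (tf F f)) by rewrite -cls1_tf.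
have [x [y [p ep]]] := mkP (sf F f); have [x' [y' [q eq]]] := mkP (tf F f).
rewrite ep eq in uS uT *.
rewrite [sg S u (io F (mk p))]sg2_mk [sg S u (io F (mk q))]sg2_mk !br0_mk.
by rewrite !raddfB /= !base_K_brp // opprK addrA.
Qed.

Lemma base_exact1 w z : homog elabel w z -> bilin edge_bd z = 0%R ->
  exists2 y, homog (label F S) w y & bilin rel_bd y = z.
Proof.
move=> hz dz; exists (base_K z).
  elim/homog_ind: hz {dz} => [|x y hx hy|u e v ue ev <-].
  - by rewrite raddf0; exact: supported0.
  - by rewrite raddfB; exact: supportedB.
  have [e1 e2] := redP ue.
  rewrite gena_act // base_KU; apply: homog_ract; last exact/cc_cmpl.
  suff <- : cls S (red u e) = arrow_cmp u (elabel e) by exact: br_homog HX _.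
  by rewrite /= cls1_tf e2 cls1_lift.
(* The homotopy identity in degree 1, between [base_K] and [base_h]. *)
suff -> : bilin rel_bd (base_K z) = (z - base_h (bilin edge_bd z))%R.
  by rewrite dz raddf0 subr0.
elim/homog_ind: hz {dz} => [|x y hx hy|u e v ue ev _].
- by rewrite !raddf0 ?subr0 ?oppr0 ?addr0.
- by rewrite !raddfB /= hx hy !opprD !opprK addrACA.
have [e1 e2] := redP ue.
rewrite gena_act // base_KU bilin_ract rel_bd_bracket e1 e2.
rewrite -(gena_act ue ev) !(bilin_lact, bilin_ract) (bilin_gena edge_bd_homog).
rewrite circ_act // !raddfB /= !base_hU.
(* The source of [red u e] is the normal form of [u] followed by the edge [e]: the Leibniz rule
   separates the term of [e] from a value of [base_h]. *)
rewrite br0_derivation //; last exact: lift_comp1.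
rewrite cls1_lift cls1_mk br0_edge raddfD /= ractM // lract opprK.
by rewrite [X in (X - _)%R]addrC -addrA [X in (_ + X)%R]addrC.
Qed.
End Presentation.

(** * The resolution *)

Section AcyclicExt.
Context (k : nat) (C : strict_cat k) (A : cell_ext k C).

Lemma ss_parallel (x y : top_ocat C) :
  ss k.-1 x = ss k.-1 y -> tt k.-1 x = tt k.-1 y -> parallel (tv x) (tv y).
Proof.
move=> es et; have [dx dy] := (dim_tv x, dim_tv y).
split=> [|k0]; first by rewrite dx dy.
rewrite dx in k0; have kk : k - k.-1 = 1 by lia.
have kl : k.-1 <= k.-1 <= k by rewrite leqnn leq_pred.
split.
  have := congr1 (fun z : top C => bsrc k.-1 (tv z)) es.
  rewrite /= !bsrc_unit_from ?dim_bsrc ?dx ?dy ?leq_pred ?leqnn //.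
  by rewrite /bsrc dx dy kk.
have := congr1 (fun z : top C => btgt k.-1 (tv z)) et.
rewrite /= !btgt_unit_from ?dim_btgt ?dx ?dy ?leq_pred ?leqnn //.
by rewrite /btgt dx dy kk.
Qed.

Lemma acyclic_ext_over : acyclic_ext A -> acyclic_over (ext_free_over A).
Proof.
move=> acy x x' es et.
have [|f [df sf_ tf_]] := acy (tv x) (tv x').
  by split; [exact: dim_tv|exact: ss_parallel].
exists (@Top _ (free_ext A) f df); split; apply: top_eq.
  by have [] := etrans (esym sf_) (src_top (@Top _ (free_ext A) f df)).
by have [] := etrans (esym tf_) (tgt_top (@Top _ (free_ext A) f df)).
Qed.
End AcyclicExt.

(** Globularity of the boundary of a generator; it is the reason why two successive boundary maps
    compose to zero. *)
Lemma sf_boundary n (X : ocat n) (Y : ocat n.+1) (Z : ocat n.+2) (B A : Type)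
    (cs ct : B -> X) (bs bt : A -> Y) (G : free_over Y cs ct)
    (F : free_over Z bs bt) a : sf G (bs a) = sf G (bt a) /\ tf G (bs a) = tf G (bt a).
Proof.
by split; apply: (@io_inj _ _ _ _ _ _ G); apply: (@io_inj _ _ _ _ _ _ F);
  rewrite ?io_sf ?io_tf ?io_ss ?io_tt -(ssn_gn F) -(ttn_gn F) ?ssss ?sstt ?ttss ?tttt.
Qed.

Definition hdT k (C : strict_cat k) (T : infinite_tower C) : cell_ext k C :=
  let: InfiniteTower A _ := T in A.

Definition tlT k (C : strict_cat k) (T : infinite_tower C) :
    infinite_tower (free_ext (hdT T)) :=
  match T as T return infinite_tower (free_ext (hdT T)) with
  | InfiniteTower A T' => T'
  end.

Lemma acyclic_hdT k (C : strict_cat k) (T : infinite_tower C) m :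
  acyclic_tower (truncation m.+1 T) ->
  acyclic_ext (hdT T) /\ acyclic_tower (truncation m (tlT T)).
Proof. by case: T. Qed.

Lemma finite_hdT k (C : strict_cat k) (T : infinite_tower C) m :
  finite_tower (truncation m.+1 T) ->
  finite_type (hdT T) /\ finite_tower (truncation m (tlT T)).
Proof. by case: T. Qed.

Section Resolution.
Context (C : category).

(** One level of a tower: [sgen] holds the generators of dimension [sdim] + 1, and [sbase] those
    just below, in which the brackets [sbr] of the cells of [slow] are expressed. Since the layers
    of a tower have types that depend on one another, all degrees of the complex are reached by
    iterating a map on this package. *)
Record stage := Stage {
  sdim : nat;
  slow : strict_cat sdim;
  sgen : cell_ext sdim slow;
  stow : infinite_tower (free_ext sgen);
  scstr : cstr C (top_ocat (free_ext sgen));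
  sbase : Type;
  slab : sbase -> arrow C;
  sbr : top_ocat slow -> fab (triples C sbase);
  sbr_homog : forall x, homog slab (cls scstr (io (ext_free_over sgen) x)) (sbr x);
  sbr_der : derivation (fun x => cls scstr (io (ext_free_over sgen) x)) sbr
}.

Section NextStage.
Context (p : stage).
Let F := ext_free_over (sgen p).
Let F' := ext_free_over (hdT (stow p)).

Definition nlab : sgen p -> arrow C := label F (scstr p).
Definition nbr : top_ocat (free_ext (sgen p)) -> fab (triples C (sgen p)) :=
  projT1 (cid (bracket_exists F (scstr p))).
Definition nbd : sgen p -> fab (triples C (sbase p)) :=
  bdry (ext_bs (A := sgen p)) (ext_bt (A := sgen p)) (@sbr p).

Lemma nbrP : bracket F (scstr p) nbr.
Proof. by rewrite /nbr; case: cid. Qed.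

Definition ncstr : cstr C (top_ocat (free_ext (hdT (stow p)))) :=
  cstr_free F' (scstr p).

Lemma nbr_homog x : homog nlab (cls ncstr (io F' x)) (nbr x).
Proof. by rewrite cls_io; exact: br_homog nbrP _. Qed.

Lemma nbr_der : derivation (fun x => cls ncstr (io F' x)) nbr.
Proof.
have -> : (fun x => cls ncstr (io F' x)) = cls (scstr p).
  by apply/funext => x; rewrite cls_io.
by have [] := nbrP.
Qed.

Definition next_stage : stage := Stage (tlT (stow p)) nbr_homog nbr_der.

Lemma nbd_homog a : homog (@slab p) (nlab a) (nbd a).
Proof. exact: (@bdry_homog _ _ _ _ _ _ _ F _ _ _ _ _ _ (@sbr_homog p)). Qed.

Lemma nbd_bracket y : bilin nbd (nbr y) = (sbr (sf F y) - sbr (tf F y))%R.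
Proof.
exact: (@bdry_bracket _ _ _ _ _ _ _ F _ _ _ _ _ _ (@sbr_homog p) (@sbr_der p) _ y nbrP).
Qed.

Definition contractible : Prop :=
  (forall m, acyclic_tower (truncation m (stow p))) /\
  exists tau, strategy (scstr p) tau /\ contraction (scstr p) tau nbr nbd.
End NextStage.

Lemma stage_exact p w z : contractible p -> homog (@slab (next_stage p)) w z ->
  bilin (@nbd p) z = 0%R ->
  exists2 y, homog (@slab (next_stage (next_stage p))) w y & bilin (@nbd (next_stage p)) y = z.
Proof.
move=> [acy [tau [H ctr]]].
have [/acyclic_ext_over acy1 _] := acyclic_hdT (acy 1).
have [tau' [H' tt']] := strategy_step (ext_free_over (sgen p)) H acy1.
exact: (exact_step H' tt' (nbrP p) (nbrP (next_stage p)) ctr).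
Qed.

Lemma next_contractible p : contractible p -> contractible (next_stage p).
Proof.
move=> [acy [tau [H ctr]]].
have [/acyclic_ext_over acy1 _] := acyclic_hdT (acy 1).
have [tau' [H' tt']] := strategy_step (ext_free_over (sgen p)) H acy1.
split; first by move=> m; have [] := acyclic_hdT (acy m.+1).
exists tau'; split=> //.
exact: (contraction_step H' (nbrP p) (nbrP (next_stage p))).
Qed.

Lemma nbd_nbd p a : bilin (@nbd p) (@nbd (next_stage p) a) = 0%R.
Proof.
rewrite {2}/nbd /bdry raddfB /= !nbd_bracket.
have [-> ->] := sf_boundary (ext_free_over (sgen p)) (ext_free_over (hdT (stow p))) a.
by rewrite subrr.
Qed.

Lemma finite_stow j p : finite_tower (truncation j.+1 (stow p)) ->
  finite_type (hdT (stow (iter j next_stage p))).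
Proof.
elim: j p => [|j IH] p /finite_hdT[] //= _ /(IH (next_stage p)).
by rewrite -iterSr.
Qed.
End Resolution.

(** * Padding by full extensions *)

Section PresentedResolution.
Context (C : category) (G : graph) (R : cell_ext 1 (cat1 (free_cat G))).
Context (Phi : functor (free_cat G) C) (T : infinite_tower (free_ext R)) (n : enat).
Hypothesis Phi_inj : injective (fob Phi).
Hypothesis Phi_surj : forall x : C, exists v, fob Phi v = x.
Hypothesis Phi_full : forall (v v' : vertex G) (f : hom (fob Phi v) (fob Phi v')),
  exists p : path v v', fhom Phi (p : @hom (free_cat G) v v') = f.
Hypothesis Phi_rel : forall a : R,
  cls1 Phi (ext_bs (A := R) a) = cls1 Phi (ext_bt (A := R) a).
Hypothesis Phi_congr : forall x y (p q : path x y), im Phi p = im Phi q ->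
  congr (@ext_rel _ R) (p : @hom (free_cat G) x y) q.
Hypothesis T_acyclic : forall m, acyclic_tower (truncation m T).
Hypothesis finite_ob : below 0 n -> finite_type C.
Hypothesis finite_edge : below 1 n -> finite_type (edge G).
Hypothesis finite_rel : below 2 n -> finite_type R.
Hypothesis finite_T : forall m, below m.+3 n -> finite_tower (truncation m.+1 T).

Let S := cstr_base Phi_inj Phi_surj Phi_full Phi_rel Phi_congr.

Lemma base_homog x :
  homog (elabel Phi) (cls S (io (ext_free_over R) x)) (br0 Phi x).
Proof. by rewrite -(cls1_cls Phi_inj); exact: br0_homog. Qed.

Lemma base_der : derivation (fun x => cls S (io (ext_free_over R) x)) (br0 Phi).
Proof.
have -> : (fun x => cls S (io (ext_free_over R) x)) = cls1 Phi.
  by apply/funext => x; rewrite -(cls1_cls Phi_inj).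
exact: br0_derivation.
Qed.

Definition base_stage : stage C := Stage T base_homog base_der.

Lemma base_contractible : contractible base_stage.
Proof.
split=> //; exists (fun _ _ x => x); split; first exact: strategy_base.
exact: contraction_base (nbrP base_stage).
Qed.

Definition nth_stage (i : nat) : stage C := iter i (@next_stage C) base_stage.

Lemma nth_stage_contractible i : contractible (nth_stage i).
Proof. by elim: i => [|i IH]; [exact: base_contractible|exact: next_contractible]. Qed.

(** The stage 0 has the edges as [sbase] and the 2-cells as [sgen], and each further stage moves up
    by one dimension. In degree i + 3 the generators are thus those of the layer i of the tower [T],
    counted from 0. *)
Definition generators (i : nat) : Type :=
  if i is j.+1 then sbase (nth_stage j) else C.

Definition generator_label i : generators i -> arrow C :=
  match i with 0 => @aid C | j.+1 => @slab C (nth_stage j) end.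

Definition generator_bd i : generators i.+1 -> fab (triples C (generators i)) :=
  match i with 0 => @edge_bd C G Phi | j.+1 => @nbd C (nth_stage j) end.

Lemma FP_of_presentation : FP n C.
Proof.
apply: (@FP_of_chain C n generators generator_label generator_bd).
- by move=> [|i] a; [exact: edge_bd_homog|exact: nbd_homog].
- move=> [|[|[|i]]] //= hi; apply: finite_stow; exact: finite_T.
- by move=> x; exists x.
- by move=> a u v; exact: edge_bd_augm.
- by move=> _ w z; exact: base_exact0.
- by move=> [|i] a _; [exact: edge_bd_rel_bd|exact: nbd_nbd].
move=> [|i] _ w z; first exact: (base_exact1 (nbrP base_stage)).
exact: stage_exact (nth_stage_contractible i).
Qed.
End PresentedResolution.

Definition full_ext k (C : strict_cat k) : cell_ext k C :=
  @CellExt k C {s : C * C | sphere k s.1 s.2} (fun s => (proj1_sig s).1)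
    (fun s => (proj1_sig s).2) (fun s => proj2_sig s).

CoFixpoint full_tower k (C : strict_cat k) : infinite_tower C :=
  @InfiniteTower k C (full_ext C) (full_tower (free_ext (full_ext C))).

Fixpoint pad l k (C : strict_cat k) : tower l C -> infinite_tower C :=
  match l return tower l C -> infinite_tower C with
  | 0 => fun _ => full_tower C
  | l'.+1 => fun T => InfiniteTower (pad (projT2 T))
  end.

Lemma full_ext_acyclic k (C : strict_cat k) : acyclic_ext (full_ext C).
Proof.
move=> x y xy; pose F := ext_free_over (full_ext C).
pose a : full_ext C := exist (fun s : C * C => sphere k s.1 s.2) (x, y) xy.
exists (tv (gn F a)); split; first exact: dim_tv.
  by rewrite src_top sf_gn.
by rewrite tgt_top tf_gn.
Qed.

Lemma full_tower_acyclic k (C : strict_cat k) m :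
  acyclic_tower (truncation m (full_tower C)).
Proof.
elim: m k C => [//|m IH] k C; split; first exact: full_ext_acyclic.
exact: IH.
Qed.

Lemma pad_acyclic l k (C : strict_cat k) (T : tower l C) m :
  acyclic_tower T -> acyclic_tower (truncation m (pad T)).
Proof.
elim: l k C T m => [|l IH] k C T m; first by move=> _; exact: full_tower_acyclic.
by case: m => [//|m] [h1 h2]; split=> //; exact: IH.
Qed.

Lemma pad_finite l k (C : strict_cat k) (T : tower l C) m : m <= l ->
  finite_tower T -> finite_tower (truncation m (pad T)).
Proof.
elim: l k C T m => [|l IH] k C T [|m] //= ml [h1 h2].
by split=> //; exact: IH.
Qed.

(** * From an isomorphism with the presented category to a functor on paths *)

Section Presents.
Context (C : category) (S : polygraph2) (F : functor (presented_cat S) C).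
Hypothesis F_bij : bijective (fob F).
Hypothesis Fhom_bij : forall x y, bijective (@fhom _ _ F x y).
Let A : category := free_cat (gens1 S).
Let cl (x y : A) (p : @hom A x y) : @hom (presented_cat S) x y :=
  class (@congr A (@ext_rel _ (gens2 S)) x y) p.

Lemma clM (x y z : A) (p : @hom A x y) (q : @hom A y z) : cl (p \; q) = cl p \; cl q.
Proof. by apply/qclass_eq/congr_cmp; apply/congr_sym/qrep_class. Qed.

Definition quotient_functor : functor A C.
Proof.
apply: (@Functor A C (fob F) (fun x y p => fhom F (cl p))).
  by move=> x; exact: (fhom1 F x).
by move=> x y z p q; rewrite clM; exact: (fhomM F).
Defined.
Let Phi := quotient_functor.

Lemma quotient_functor_full (v v' : A) (f : hom (Phi v) (Phi v')) :
  exists p : path v v', fhom Phi (p : @hom A v v') = f.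
Proof.
have [g _ gK] := Fhom_bij v v'; exists (rep (g f)).
by rewrite /= /cl repK gK.
Qed.

Lemma quotient_functor_congr (x y : A) (p q : @hom A x y) :
  fhom Phi p = fhom Phi q <-> congr (@ext_rel _ (gens2 S)) p q.
Proof.
split=> [/(bij_inj (Fhom_bij x y))/qclass_eq//|pq].
by rewrite /=; congr (fhom F _); apply/qclass_eq.
Qed.
End Presents.

(** The boundary of a 2-cell is a sphere of dimension 1, hence a pair of paths with common ends; the
    cases of 0-cells are excluded by their dimension. *)
Lemma cls1_rel (C : category) (G : graph) (R : cell_ext 1 (cat1 (free_cat G)))
    (Phi : functor (free_cat G) C) (a : R) :
  (forall x y (p q : path x y), @ext_rel _ R x y p q -> im Phi p = im Phi q) ->
  cls1 Phi (ext_bs (A := R) a) = cls1 Phi (ext_bt (A := R) a).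
Proof.
rewrite /cls1 /=; have [d [_ /(_ _)]] := gsphere a; rewrite d => /(_ isT).
case es: (gsrc a) d => [//|[x y p]] _; case et: (gtgt a) => [v|[x' y' q]] [] //.
  by have := congr1 (@dim _) et; rewrite dim_gtgt.
move=> /= [ex] [ey]; subst x' y' => H; apply: (H _ _ p q); exists a.
by rewrite es et.
Qed.

Lemma FP_of_polygraph (C : category) (n : enat) (S : polygraph2)
    (T : infinite_tower (free2 S)) :
  presents S C -> (forall m, acyclic_tower (truncation m T)) ->
  finite_type (vertex (gens1 S)) -> finite_type (edge (gens1 S)) ->
  finite_type (gens2 S) ->
  (forall m, below m.+3 n -> finite_tower (truncation m.+1 T)) -> FP n C.
Proof.
move=> [F [F_bij Fhom_bij]] acy finV finE finR finT.
have [g gK Kg] := F_bij.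
apply: (@FP_of_presentation C (gens1 S) (gens2 S) (quotient_functor F) T n) => //.
- exact: bij_inj.
- by move=> x; exists (g x); exact: Kg.
- exact: quotient_functor_full.
- move=> a; apply: cls1_rel => x y p q pq; rewrite /im; congr Arrow.
  by apply/quotient_functor_congr => //; exact: congr_gen.
- move=> x y p q e; apply/(quotient_functor_congr Fhom_bij); exact: Arrow_inj e.
move=> _; rewrite /finite_type.
have -> : [set: C]%classic = (fob F @` [set: vertex (gens1 S)])%classic.
  by apply/seteqP; split=> // x _; exists (g x) => //; exact: Kg.
exact: finite_image.
Qed.

(** * The cases n = 0 and n = 1 *)

Section Generators.
Context (C : category) (E : Type) (lab : E -> arrow C).

Definition generator_graph : graph :=
  @Graph C E (fun e => asrc (lab e)) (fun e => atgt (lab e)).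

Fixpoint eval (x y : C) (p : @path generator_graph x y) : @hom C x y :=
  match p in path x y return @hom C x y with
  | pnil x => idm x
  | pcons e _ p' => amor (lab e) \; eval p'
  end.

Lemma eval_cat (x y z : C) (p : @path generator_graph x y) (q : @path generator_graph y z) :
  eval (pcat p q) = eval p \; eval q.
Proof. by elim: p q => [a|e a p IH] q; rewrite /= ?cmp1f // IH cmpA. Qed.

Definition eval_functor : functor (free_cat generator_graph) C :=
  @Functor (free_cat generator_graph) C id eval (fun _ => erefl) eval_cat.

Definition equal_paths : Type :=
  {x : C & {y : C & {s : @path generator_graph x y * @path generator_graph x y |
    eval s.1 = eval s.2}}}.

Definition path_arrow (x y : C) (p : @path generator_graph x y) :
  cat1 (free_cat generator_graph) :=
  inr (Arrow (p : @hom (free_cat generator_graph) x y)).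

Lemma path_sphere (x y : C) (p q : @path generator_graph x y) :
  sphere 1 (path_arrow p) (path_arrow q).
Proof. by []. Qed.

Definition equal_paths_ext : cell_ext 1 (cat1 (free_cat generator_graph)) :=
  @CellExt 1 (cat1 (free_cat generator_graph)) equal_paths
    (fun s => path_arrow (proj1_sig (projT2 (projT2 s))).1)
    (fun s => path_arrow (proj1_sig (projT2 (projT2 s))).2)
    (fun s => path_sphere _ _).

Lemma FP_of_generators n :
  (forall (x y : C) (f : hom x y), exists p : @path generator_graph x y, eval p = f) ->
  (below 0 n -> finite_type C) -> (below 1 n -> finite_type E) -> ~ below 2 n ->
  FP n C.
Proof.
move=> full finC finE n2.
apply: (@FP_of_presentation C generator_graph equal_paths_ext eval_functor
  (full_tower _) n) => //.
- by move=> x; exists x.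
- move=> a; apply: cls1_rel => x y p q [[x' [y' [[p' q'] e]]] [ep eq]].
  (* The equations [ep] and [eq] hold between 1-cells, not between paths with fixed ends, so the
     evaluation is extended to all cells before rewriting; its value on 0-cells is a dummy. *)
  pose ev (c : cat1 (free_cat generator_graph)) : arrow C :=
    if c is inr f then im eval_functor (amor f) else im eval_functor p.
  rewrite -[LHS]/(ev (inr (Arrow (p : @hom (free_cat generator_graph) x y)))).
  rewrite -[RHS]/(ev (inr (Arrow (q : @hom (free_cat generator_graph) x y)))).
  rewrite -ep -eq /= /im /=; congr Arrow; exact: e.
- move=> x y p q e; apply: congr_gen.
  by exists (existT _ x (existT _ y (exist _ (p, q) (@Arrow_inj C _ _ _ _ e)))).
- by move=> m; exact: full_tower_acyclic.
- by move=> m h; case: n2; case: (n) h => // k /=; lia.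
Qed.
End Generators.

Theorem corollary5p4p4 (C : category) (n : enat) : FDT n C -> FP n C.
Proof.
case: n => [[|[|m]]|].
- move=> finC; apply: (@FP_of_generators C (arrow C) id) => //=.
  move=> x y f; exists (@pcons (generator_graph id) (Arrow f) y (@pnil (generator_graph id) y)).
  exact: cmpf1.
- move=> [finC [S [finS genS]]].
  apply: (@FP_of_generators C {f : arrow C | S f} (@proj1_sig _ _)) => //=.
    move=> x y f; elim: (genS x y f) => [x' y' g Sg|x'|x' y' z' g h _ [p <-] _ [q <-]].
    + exists (@pcons (generator_graph (@proj1_sig _ S)) (exist _ (Arrow g) Sg) y' (@pnil (generator_graph (@proj1_sig _ S)) y')).
      exact: cmpf1.
    + by exists (@pnil (generator_graph (@proj1_sig _ S)) x').
    + by exists (pcat p q); exact: eval_cat.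
  move=> _; rewrite /finite_type.
  have -> : [set: {f : arrow C | S f}]%classic = (@proj1_sig _ _ @^-1` S)%classic.
    by apply/seteqP; split=> // -[f Sf].
  apply: finite_preimage finS => -[f Sf] [g Sg] _ _ /=.
  exact: eq_exist.
- move=> [S [[finV finE finR finT] acy pres]].
  apply: (@FP_of_polygraph C _ S (pad (upper S))) => //.
    by move=> k; exact: pad_acyclic.
  (* The bound k + 3 <= m + 2 gives k + 1 <= m: the truncation stays within the given tower, below
     the padding. *)
  by move=> k h; exact: pad_finite.
move=> [S [[finV finE finR finT] acy pres]].
by apply: (@FP_of_polygraph C _ S (upper S)) => // k _.
Qed.
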